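(* Let $F:\mathbb{R}\to\mathbb{R}$ be continuously differentiable, let $\omega\in\mathbb{R}$, and let $\psi:\mathbb{S}^2\to\mathbb{R}$ be a classical solution of $$\Delta\psi=F(\psi)-2\omega\sin\theta\quad\text{on }\mathbb{S}^2 .$$ (i) If $\omega=0$ and $F'>-2$, then $\psi$ is constant. This is optimal, since the non-constant elements of $\mathbb{E}_1$ satisfy $\Delta\psi=-2\psi$. (ii) If $\omega=0$ and $F'>-6$, then $\psi$ is zonal up to a transformation in $\mathbb{SO}(3)$. This is optimal, since the non-zonal elements of $\mathbb{E}_2$ satisfy $\Delta\psi=-6\psi$. (iii) If $\omega\neq0$, there exists $\alpha\in\mathbb{R}$ such that $\mathbb{P}_1\psi=\alpha\sin\theta$. (iv) If $\omega\ne0$ and $F'>-6$, then $\psi$ is zonal up to a transformation in $\mathbb{SO}(3)$. This is optimal, since the Rossby-Haurwitz wave $\psi=-\frac{\omega}{2}\sin\theta+\beta Y$, with $\beta\in\mathbb{R}\setminus\{0\}$ and $Y\in\mathbb{E}_2$ a non-trivial linear combination of all the spherical harmonics $\{Y_2^m\}_{|m|\le2}$, satisfies $\Delta\psi=-6\psi-2\omega\sin\theta$.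
   Context: $\mathbb{S}^2\subset\mathbb{R}^3$ is the unit sphere with points $(\cos\varphi\cos\theta,\sin\varphi\cos\theta,\sin\theta)$, where $\varphi$ is the longitude and $\theta\in[-\frac{\pi}{2},\frac{\pi}{2}]$ the latitude; $\Delta=\partial_\theta^2-\tan\theta\,\partial_\theta+\frac{1}{\cos^2\theta}\partial_\varphi^2$ is the Laplace-Beltrami operator. $\mathbb{E}_j$ is the eigenspace of $\Delta$ for the eigenvalue $-j(j+1)$, spanned by the spherical harmonics $Y_j^m$, $|m|\le j$; $\mathbb{P}_j$ is the $L^2(\mathbb{S}^2)$-orthogonal projector onto $\mathbb{E}_j$. A function is zonal if it depends only on $\theta$; it is zonal up to a transformation in $\mathbb{SO}(3)$ if $X\mapsto\psi(GX)$ is zonal for some $G\in\mathbb{SO}(3)$. *)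

(* Defs.v *)
From Stdlib Require Import Reals ZArith Lra.
From Coquelicot Require Import Coquelicot.
Open Scope R_scope.

Definition vec : Type := (R * R * R)%type.
Definition px (X : vec) : R := fst (fst X).
Definition py (X : vec) : R := snd (fst X).
Definition pz (X : vec) : R := snd X.
Definition dot (X Y : vec) : R := px X * px Y + py X * py Y + pz X * pz Y.

Definition S2 : Type := {X : vec | dot X X = 1}.

Lemma sph_on_S2 (phi theta : R) :
  let X := (cos phi * cos theta, sin phi * cos theta, sin theta) in dot X X = 1.
Proof.
unfold dot, px, py, pz; simpl.
generalize (sin2_cos2 phi) (sin2_cos2 theta); unfold Rsqr; intros H1 H2.
replace 1 with ((sin phi * sin phi + cos phi * cos phi) * (cos theta * cos theta)
                + sin theta * sin theta) by (rewrite H1; lra).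
ring.
Qed.

(* Longitude phi ranges over all of R (2 PI-periodically); the latitude theta of
   a point lies in [-PI/2, PI/2]. *)
Definition sph (phi theta : R) : S2 :=
  exist _ (cos phi * cos theta, sin phi * cos theta, sin theta)
    (sph_on_S2 phi theta).

Definition is_latitude (theta : R) : Prop := - (PI / 2) <= theta <= PI / 2.

(* The sine of the latitude is the third Cartesian coordinate. *)
Definition sin_lat (X : S2) : R := pz (proj1_sig X).

(* An element of SO(3), given by the columns of its matrix: orthonormality of the
   columns is G^T G = 1, and the triple product is det G. *)
Record SO3 := mkSO3 {
  col1 : vec; col2 : vec; col3 : vec;
  col11 : dot col1 col1 = 1; col22 : dot col2 col2 = 1; col33 : dot col3 col3 = 1;
  col12 : dot col1 col2 = 0; col13 : dot col1 col3 = 0; col23 : dot col2 col3 = 0;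
  SO3_det :
    px col1 * (py col2 * pz col3 - pz col2 * py col3)
    - px col2 * (py col1 * pz col3 - pz col1 * py col3)
    + px col3 * (py col1 * pz col2 - pz col1 * py col2) = 1 }.

Definition mulv (G : SO3) (X : vec) : vec :=
  (px (col1 G) * px X + px (col2 G) * py X + px (col3 G) * pz X,
   py (col1 G) * px X + py (col2 G) * py X + py (col3 G) * pz X,
   pz (col1 G) * px X + pz (col2 G) * py X + pz (col3 G) * pz X).

Lemma dot_mulv (G : SO3) (X Y : vec) : dot (mulv G X) (mulv G Y) = dot X Y.
Proof.
transitivity
  (px X * px Y * dot (col1 G) (col1 G) + py X * py Y * dot (col2 G) (col2 G)
   + pz X * pz Y * dot (col3 G) (col3 G)
   + (px X * py Y + py X * px Y) * dot (col1 G) (col2 G)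
   + (px X * pz Y + pz X * px Y) * dot (col1 G) (col3 G)
   + (py X * pz Y + pz X * py Y) * dot (col2 G) (col3 G)).
- unfold dot, mulv, px, py, pz; simpl; ring.
- rewrite col11, col22, col33, col12, col13, col23; unfold dot; ring.
Qed.

Lemma mulv_on_S2 (G : SO3) (X : S2) :
  dot (mulv G (proj1_sig X)) (mulv G (proj1_sig X)) = 1.
Proof. rewrite dot_mulv; exact (proj2_sig X). Qed.

Definition rot (G : SO3) (X : S2) : S2 :=
  exist _ (mulv G (proj1_sig X)) (mulv_on_S2 G X).

Definition constant_on_sphere (psi : S2 -> R) : Prop := exists c, forall X, psi X = c.

Definition zonal (psi : S2 -> R) : Prop :=
  exists f : R -> R,
    forall phi theta, is_latitude theta -> psi (sph phi theta) = f theta.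

Definition zonal_up_to_rotation (psi : S2 -> R) : Prop :=
  exists G : SO3, zonal (fun X => psi (rot G X)).

Definition partial_x (f : vec -> R) (X : vec) : R :=
  Derive (fun t => f (t, py X, pz X)) (px X).
Definition partial_y (f : vec -> R) (X : vec) : R :=
  Derive (fun t => f (px X, t, pz X)) (py X).
Definition partial_z (f : vec -> R) (X : vec) : R :=
  Derive (fun t => f (px X, py X, t)) (pz X).

Fixpoint Ck_on (k : nat) (U : vec -> Prop) (f : vec -> R) : Prop :=
  match k with
  | O => forall X : vec, U X -> continuous f X
  | S k' =>
      (forall X : vec, U X ->
         ex_derive (fun t => f (t, py X, pz X)) (px X) /\
         ex_derive (fun t => f (px X, t, pz X)) (py X) /\
         ex_derive (fun t => f (px X, py X, t)) (pz X)) /\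
      Ck_on k' U (partial_x f) /\ Ck_on k' U (partial_y f) /\
      Ck_on k' U (partial_z f)
  end.

(* C^2 on the embedded submanifold S2: restriction of a C^2 function defined on
   some open neighbourhood of S2 in R^3. *)
Definition C2_sphere (psi : S2 -> R) : Prop :=
  exists (U : vec -> Prop) (Psi : vec -> R),
    open U /\ Ck_on 2 U Psi /\
    forall X : S2, U (proj1_sig X) /\ Psi (proj1_sig X) = psi X.

Definition laplace_coord (psi : S2 -> R) (phi theta : R) : R :=
  Derive_n (fun t => psi (sph phi t)) 2 theta
  - tan theta * Derive (fun t => psi (sph phi t)) theta
  + 1 / (cos theta) ^ 2 * Derive_n (fun t => psi (sph t theta)) 2 phi.

(* The value of Delta psi at the point sph phi theta. The coordinate formula is
   singular at the two poles; there Delta psi is its continuous extension, i.e.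
   the limit along the meridian phi (independent of phi when psi is C^2). *)
Definition laplace_beltrami (psi : S2 -> R) (phi theta : R) : R :=
  if Req_EM_T (cos theta) 0
  then real (Lim (laplace_coord psi phi) theta)
  else laplace_coord psi phi theta.

Definition cont_differentiable (F : R -> R) : Prop :=
  forall s, ex_derive F s /\ continuous (Derive F) s.

Definition classical_solution (F : R -> R) (omega : R) (psi : S2 -> R) : Prop :=
  C2_sphere psi /\
  forall phi theta, is_latitude theta ->
    laplace_beltrami psi phi theta
    = F (psi (sph phi theta)) - 2 * omega * sin theta.

Definition eigenspace (j : nat) (Y : S2 -> R) : Prop :=
  C2_sphere Y /\
  forall phi theta, is_latitude theta ->
    laplace_beltrami Y phi theta = - (INR j * (INR j + 1)) * Y (sph phi theta).

(* L^2 inner product for the surface measure cos theta dphi dtheta; only used for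
   continuous f and g. *)
Definition inner (f g : S2 -> R) : R :=
  RInt (fun theta =>
    RInt (fun phi => f (sph phi theta) * g (sph phi theta) * cos theta) 0 (2 * PI))
    (- (PI / 2)) (PI / 2).

(* p is the L^2-orthogonal projection of psi onto the j-th eigenspace. *)
Definition is_projection (j : nat) (psi p : S2 -> R) : Prop :=
  eigenspace j p /\
  forall Y, eigenspace j Y -> inner (fun X => psi X - p X) Y = 0.

(* Y_j^m for 0 <= m <= j, with Condon-Shortley phase:
   sqrt ((2j+1)/(4 PI) (j-m)!/(j+m)!) P_j^m(sin theta) e^{i m phi}, where
   P_j^m(s) = (-1)^m (1-s^2)^{m/2} (d/ds)^{j+m} (s^2-1)^j / (2^j j!), and
   (1-s^2)^{1/2} = cos theta at s = sin theta. *)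
Definition Ylm_nonneg (j m : nat) (phi theta : R) : C :=
  Cmult
    (RtoC (sqrt ((2 * INR j + 1) / (4 * PI)
                 * (INR (fact (j - m)) / INR (fact (j + m))))
           * (-1) ^ m * (cos theta) ^ m
           * Derive_n (fun s => (s ^ 2 - 1) ^ j / (2 ^ j * INR (fact j)))
               (j + m) (sin theta)))
    (cos (INR m * phi), sin (INR m * phi)).

Definition Ylm (j : nat) (m : Z) (phi theta : R) : C :=
  if (0 <=? m)%Z then Ylm_nonneg j (Z.to_nat m) phi theta
  else Cmult (RtoC ((-1) ^ Z.to_nat (- m)))
         (Cconj (Ylm_nonneg j (Z.to_nat (- m)) phi theta)).

(* The real function Y equals sum_{m=-j}^{j} c_m Y_j^m, with complex c_m. *)
Definition is_combination (j : nat) (c : Z -> C) (Y : S2 -> R) : Prop :=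
  forall phi theta, is_latitude theta ->
    RtoC (Y (sph phi theta))
    = sum_n (fun k : nat =>
        let m := (Z.of_nat k - Z.of_nat j)%Z in Cmult (c m) (Ylm j m phi theta))
        (2 * j).

Definition rossby_haurwitz (omega beta : R) (Y : S2 -> R) (X : S2) : R :=
  - (omega / 2) * sin_lat X + beta * Y X.

(* Main.v *)
Require Import Defs.
From Stdlib Require Import Reals ZArith Lra Lia Psatz Nsatz.
From Stdlib Require Import FunctionalExtensionality ProofIrrelevance ClassicalEpsilon.
From Coquelicot Require Import Coquelicot.
Open Scope R_scope.

(** The proof compares a solution [psi] with its rotated copies.  Differentiating the
    equation along a rotation would cost a derivative of [psi]; finite rotations do not: if [R] is a rotation about the polar axis, [w = psi o R - psi] is of
    class C^2 and [Lap w = F(psi o R) - F(psi)], because [sin theta] is invariant.  By the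
    mean value theorem [w Lap w > - mu w^2] wherever [w <> 0], as soon as [F' > - mu].
    On the other hand the spectral gap of the sphere says that
    [int w Lap w <= - mu int w^2] for [mu = N(N+1)] when [w] is orthogonal to the spherical
    harmonics of degree less than [N].  So [w = 0] ([rigidity]).

    For [N = 1] the orthogonality only asks that [w] have mean zero, which holds for every
    rotation [R] when [omega = 0]; then [psi] is constant ([constant_of_gap]).  For [N = 2]
    the first moments of [w] must vanish too, and they do as soon as the first moment
    [int X psi(X)] of [psi] points along the axis of [R] ([invariant_of_gap]).  When
    [omega = 0] the axis can be chosen so ([align_moment]).  When [omega <> 0] the equation
    forces it: if [psi_t] is [psi] rotated by the angle [t] about a horizontal axis, then
    [int Lap psi (psi_t - psi_(-t)) = 0] by symmetry, [int F(psi) (psi_t - psi_(-t))] is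
    of order [t^2] since the integral of an antiderivative of [F] at [psi_t] does not depend
    on [t], while [int sin theta (psi_t - psi_(-t))] is [2 sin t] times a horizontal
    component of the first moment, up to sign.  So these components vanish
    ([moments_vanish]).

    The analysis on the sphere rests on the kernels [u^n], [u = (1 + X.Y) / 2], through the
    identity [Lap u^n = n^2 u^(n-1) - n(n+1) u^n].  Integrated in longitude and latitude,
    where it is a divergence, it gives the mass [4 PI / (n + 1)] of [u^n] ([surf_ker]).
    Hence the operators [Kop n] with these kernels, suitably normalised, form an approximate
    identity ([Kop_approx]), and since the mass does not depend on the centre, the
    coordinate integral is invariant under rotations ([surf_rot]).  The Laplacian is treated
    as a uniform limit of second differences along rotations; its symmetry ([green]) is
    then a consequence of that invariance, without an integration by parts across the
    singularity of the coordinates at the poles.  Finally [(Lap + n(n+1)) Kop n = n^2 Kop (n-1)] decomposes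
    [Kop n w] into finitely many eigenfunctions, by solving one linear equation for each
    eigenvalue ([Kop_band]), and letting [n] tend to infinity in the inequality for such
    sums proves the spectral gap for [w] ([spectral_gap]).

    The examples showing optimality are quadratic polynomials in the Cartesian coordinates.
    A zonal one has a very restricted form ([zonal_quadratic]); the linear part
    [- omega/2 sin theta] of a Rossby-Haurwitz wave pins its axis to the poles. *)

(** * Cartesian coordinates *)

Lemma S2_eq (X Y : S2) : proj1_sig X = proj1_sig Y -> X = Y.
Proof.
destruct X as [X hX], Y as [Y hY]; simpl; intros ->.
now rewrite (proof_irrelevance _ hX hY).
Qed.

Inductive axis : Set := ax1 | ax2 | ax3.

Definition coord (i : axis) (X : vec) : R :=
  match i with ax1 => px X | ax2 => py X | ax3 => pz X end.

Definition sum3 (f : axis -> R) : R := f ax1 + f ax2 + f ax3.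

Definition sc (i : axis) (X : S2) : R := coord i (proj1_sig X).

Lemma vec_eq (X Y : vec) : (forall i, coord i X = coord i Y) -> X = Y.
Proof.
destruct X as [[x1 x2] x3], Y as [[y1 y2] y3]; intros h.
generalize (h ax1) (h ax2) (h ax3); unfold coord, px, py, pz; simpl.
now intros -> -> ->.
Qed.

Lemma sc_norm (X : S2) : sc ax1 X * sc ax1 X + sc ax2 X * sc ax2 X + sc ax3 X * sc ax3 X = 1.
Proof. exact (proj2_sig X). Qed.

Lemma sc_bound (i : axis) (X : S2) : Rabs (sc i X) <= 1.
Proof.
generalize (sc_norm X); intros h; apply Rabs_le.
destruct i; nra.
Qed.

(** * Rotations *)

Definition det3 (a b c : vec) : R :=
  px a * (py b * pz c - pz b * py c)
  - px b * (py a * pz c - pz a * py c)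
  + px c * (py a * pz b - pz a * py b).

Definition mulSO3 (G H : SO3) : SO3.
Proof.
refine (mkSO3 (mulv G (col1 H)) (mulv G (col2 H)) (mulv G (col3 H)) _ _ _ _ _ _ _).
- rewrite dot_mulv; apply col11.
- rewrite dot_mulv; apply col22.
- rewrite dot_mulv; apply col33.
- rewrite dot_mulv; apply col12.
- rewrite dot_mulv; apply col13.
- rewrite dot_mulv; apply col23.
- transitivity (det3 (col1 G) (col2 G) (col3 G) * det3 (col1 H) (col2 H) (col3 H)).
  + unfold det3, mulv, px, py, pz; simpl; ring.
  + unfold det3; rewrite !SO3_det; ring.
Defined.

Lemma mulv_mulSO3 (G H : SO3) (X : vec) : mulv (mulSO3 G H) X = mulv G (mulv H X).
Proof.
apply vec_eq; intros i; destruct i; unfold mulSO3, mulv, coord, px, py, pz; simpl; ring.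
Qed.

Lemma rot_mulSO3 (G H : SO3) (X : S2) : rot (mulSO3 G H) X = rot G (rot H X).
Proof. apply S2_eq; apply mulv_mulSO3. Qed.

Lemma sum_sq3_0 (x y z : R) : x * x + y * y + z * z = 0 -> x = 0 /\ y = 0 /\ z = 0.
Proof.
intros h; generalize (Rle_0_sqr x) (Rle_0_sqr y) (Rle_0_sqr z); unfold Rsqr; intros.
repeat split; apply Rsqr_0_uniq; unfold Rsqr; lra.
Qed.

(** Because [|a - b x c|^2 = |a|^2 - 2 det + |b x c|^2 = 0]. *)
Lemma cross_of_orthonormal (a b c : vec) :
  dot a a = 1 -> dot b b = 1 -> dot c c = 1 -> dot b c = 0 -> det3 a b c = 1 ->
  px a = py b * pz c - pz b * py c /\
  py a = pz b * px c - px b * pz c /\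
  pz a = px b * py c - py b * px c.
Proof.
unfold dot, det3; destruct a as [[a1 a2] a3], b as [[b1 b2] b3], c as [[c1 c2] c3].
unfold px, py, pz; simpl; intros ha hb hc hbc hd.
set (v1 := b2 * c3 - b3 * c2); set (v2 := b3 * c1 - b1 * c3); set (v3 := b1 * c2 - b2 * c1).
assert (hv : v1 * v1 + v2 * v2 + v3 * v3 = 1).
{ transitivity ((b1*b1+b2*b2+b3*b3)*(c1*c1+c2*c2+c3*c3)
                - (b1*c1+b2*c2+b3*c3)*(b1*c1+b2*c2+b3*c3)).
  - unfold v1, v2, v3; ring.
  - rewrite hb, hc, hbc; ring. }
assert (hav : a1 * v1 + a2 * v2 + a3 * v3 = 1).
{ rewrite <- hd; unfold v1, v2, v3; ring. }
assert (h0 : (a1 - v1) * (a1 - v1) + (a2 - v2) * (a2 - v2) + (a3 - v3) * (a3 - v3) = 0).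
{ transitivity ((a1*a1+a2*a2+a3*a3) - 2 * (a1 * v1 + a2 * v2 + a3 * v3)
                + (v1 * v1 + v2 * v2 + v3 * v3)); [ring|].
  rewrite ha, hav, hv; ring. }
destruct (sum_sq3_0 _ _ _ h0) as [k1 [k2 k3]].
unfold v1, v2, v3 in *; repeat split; lra.
Qed.

(** The columns being cross products of one another, every dot product of two rows is a
    determinant: that of the matrix, or one with a repeated row. *)
Lemma SO3_rows (G : SO3) :
  forall i j, coord i (col1 G) * coord j (col1 G) + coord i (col2 G) * coord j (col2 G)
         + coord i (col3 G) * coord j (col3 G)
         = match i, j with ax1, ax1 | ax2, ax2 | ax3, ax3 => 1 | _, _ => 0 end.
Proof.
assert (hd : det3 (col1 G) (col2 G) (col3 G) = 1) by apply SO3_det.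
generalize (col11 G) (col22 G) (col33 G) (col12 G) (col13 G) (col23 G).
intros h11 h22 h33 h12 h13 h23.
destruct (cross_of_orthonormal (col1 G) (col2 G) (col3 G)) as [e1 [e2 e3]]; auto.
destruct (cross_of_orthonormal (col2 G) (col3 G) (col1 G)) as [f1 [f2 f3]]; auto.
{ unfold dot in *; lra. }
{ rewrite <- hd; unfold det3; ring. }
destruct (cross_of_orthonormal (col3 G) (col1 G) (col2 G)) as [g1 [g2 g3]]; auto.
{ rewrite <- hd; unfold det3; ring. }
revert hd e1 e2 e3 f1 f2 f3 g1 g2 g3; unfold det3; clear.
destruct (col1 G) as [[a1 a2] a3], (col2 G) as [[b1 b2] b3], (col3 G) as [[c1 c2] c3].
unfold coord, px, py, pz; simpl; intros hd e1 e2 e3 f1 f2 f3 g1 g2 g3.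
assert (k1 : forall y1 y2 y3, a1 * y1 + b1 * y2 + c1 * y3 =
   (b2 * c3 - b3 * c2) * y1 + (c2 * a3 - c3 * a2) * y2 + (a2 * b3 - a3 * b2) * y3).
{ intros; rewrite <- e1, <- f1, <- g1; ring. }
assert (k2 : forall y1 y2 y3, a2 * y1 + b2 * y2 + c2 * y3 =
   (b3 * c1 - b1 * c3) * y1 + (c3 * a1 - c1 * a3) * y2 + (a3 * b1 - a1 * b3) * y3).
{ intros; rewrite <- e2, <- f2, <- g2; ring. }
assert (k3 : forall y1 y2 y3, a3 * y1 + b3 * y2 + c3 * y3 =
   (b1 * c2 - b2 * c1) * y1 + (c1 * a2 - c2 * a1) * y2 + (a1 * b2 - a2 * b1) * y3).
{ intros; rewrite <- e3, <- f3, <- g3; ring. }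
clear e1 e2 e3 f1 f2 f3 g1 g2 g3.
intros i j; destruct i, j; try rewrite k1; try rewrite k2; try rewrite k3; try ring;
 rewrite <- hd; ring.
Qed.

Definition row (G : SO3) (i : axis) : vec :=
  (coord i (col1 G), coord i (col2 G), coord i (col3 G)).

Definition trSO3 (G : SO3) : SO3.
Proof.
refine (mkSO3 (row G ax1) (row G ax2) (row G ax3) (SO3_rows G ax1 ax1) (SO3_rows G ax2 ax2)
 (SO3_rows G ax3 ax3) (SO3_rows G ax1 ax2) (SO3_rows G ax1 ax3) (SO3_rows G ax2 ax3) _).
rewrite <- (SO3_det G); unfold row, coord, px, py, pz; simpl; ring.
Defined.

Lemma dot_trSO3 (G : SO3) (X Y : vec) : dot (mulv G X) Y = dot X (mulv (trSO3 G) Y).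
Proof. unfold dot, trSO3, mulv, row, coord, px, py, pz; simpl; ring. Qed.

Lemma mulv_sum (G : SO3) (X : vec) (i : axis) :
  coord i (mulv G X) = coord i (col1 G) * coord ax1 X + coord i (col2 G) * coord ax2 X
                       + coord i (col3 G) * coord ax3 X.
Proof. destruct i; reflexivity. Qed.

Lemma mulv_tr_r (G : SO3) (X : vec) : mulv G (mulv (trSO3 G) X) = X.
Proof.
apply vec_eq; intros i; rewrite mulv_sum.
transitivity (sum3 (fun j => (coord i (col1 G) * coord j (col1 G) + coord i (col2 G) * coord j (col2 G)
         + coord i (col3 G) * coord j (col3 G)) * coord j X)).
- unfold sum3, trSO3, mulv, row, coord, px, py, pz; simpl; ring.
- unfold sum3; rewrite !SO3_rows; destruct i; ring.
Qed.

Lemma rot_tr_r (G : SO3) (X : S2) : rot G (rot (trSO3 G) X) = X.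
Proof. apply S2_eq; apply mulv_tr_r. Qed.

Definition idSO3 : SO3.
Proof.
refine (mkSO3 (1,0,0) (0,1,0) (0,0,1) _ _ _ _ _ _ _);
 unfold dot, px, py, pz; simpl; ring.
Defined.

Lemma rot_id (X : S2) : rot idSO3 X = X.
Proof.
apply S2_eq; apply vec_eq; intros i; destruct i; unfold rot, mulv, coord, px, py, pz; simpl; ring.
Qed.

Lemma cs2 (t : R) : cos t * cos t + sin t * sin t = 1.
Proof. generalize (sin2_cos2 t); unfold Rsqr; lra. Qed.

Definition axrot (i : axis) (t : R) : SO3.
Proof.
destruct i.
- refine (mkSO3 (1,0,0) (0,cos t,sin t) (0,- sin t,cos t) _ _ _ _ _ _ _);
  generalize (cs2 t); unfold dot, px, py, pz; simpl; intros h; lra.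
- refine (mkSO3 (cos t,0,- sin t) (0,1,0) (sin t,0,cos t) _ _ _ _ _ _ _);
  generalize (cs2 t); unfold dot, px, py, pz; simpl; intros h; lra.
- refine (mkSO3 (cos t,sin t,0) (-sin t,cos t,0) (0,0,1) _ _ _ _ _ _ _);
  generalize (cs2 t); unfold dot, px, py, pz; simpl; intros h; lra.
Defined.

Lemma axrot_neg (i : axis) (t : R) (X : S2) : rot (axrot i (- t)) (rot (axrot i t) X) = X.
Proof.
apply S2_eq; apply vec_eq; intros j; generalize (cs2 t); intros h.
destruct X as [[[x y] z] hX].
destruct i, j; unfold rot, mulv, coord, px, py, pz; simpl; rewrite ?cos_neg, ?sin_neg;
 try ring; nsatz.
Qed.

Lemma axrot_0 (i : axis) (X : S2) : rot (axrot i 0) X = X.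
Proof.
apply S2_eq, vec_eq; intros j; destruct X as [[[x y] z] hX].
destruct i, j; unfold rot, mulv, coord, px, py, pz; simpl; rewrite ?cos_0, ?sin_0; ring.
Qed.

(** * Longitude and latitude cover the sphere *)

Lemma circle_param (a b : R) : a * a + b * b = 1 ->
  exists phi, - PI <= phi <= PI /\ a = cos phi /\ b = sin phi.
Proof.
intros h.
assert (ha : -1 <= a <= 1) by nra.
generalize (acos_bound a); intros hb.
destruct (Rle_dec 0 b) as [b0|b0].
- exists (acos a); split; [lra|split].
  + now rewrite cos_acos.
  + rewrite sin_acos by assumption.
    replace (1 - a²) with (b * b) by (unfold Rsqr; lra).
    symmetry; now apply sqrt_square.
- exists (- acos a); split; [lra|split].
  + now rewrite cos_neg, cos_acos.
  + rewrite sin_neg, sin_acos by assumption.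
    replace (1 - a²) with ((- b) * (- b)) by (unfold Rsqr; lra).
    rewrite sqrt_square; lra.
Qed.

Lemma sph_surj (X : S2) :
  exists phi theta, - PI <= phi <= PI /\ is_latitude theta /\ X = sph phi theta.
Proof.
generalize (sc_norm X); set (x := sc ax1 X); set (y := sc ax2 X); set (z := sc ax3 X); intros h.
assert (hz : -1 <= z <= 1) by nra.
assert (hc : 0 <= cos (asin z)).
{ generalize (asin_bound z); intros; apply cos_ge_0; lra. }
assert (hc2 : cos (asin z) * cos (asin z) = x * x + y * y).
{ generalize (cs2 (asin z)); rewrite sin_asin by assumption; intros; lra. }
assert (hx : exists phi, - PI <= phi <= PI /\ x = cos phi * cos (asin z) /\ y = sin phi * cos (asin z)).
{ destruct (Req_dec (cos (asin z)) 0) as [e|e].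
  - exists 0; generalize PI_RGT_0; rewrite e in *; split; [lra|split]; nra.
  - destruct (circle_param (x / cos (asin z)) (y / cos (asin z))) as [phi [hp [e1 e2]]].
    + field_simplify_eq; [|assumption]. simpl; lra.
    + exists phi; split; [assumption|]; rewrite <- e1, <- e2; split; field; assumption. }
destruct hx as [phi [hp [e1 e2]]].
exists phi, (asin z); split; [assumption|split].
- apply asin_bound.
- apply S2_eq, vec_eq; intros i; destruct i; simpl.
  + exact e1.
  + exact e2.
  + change (z = sin (asin z)); now rewrite sin_asin.
Qed.

(** The rotation whose columns are the unit vectors pointing East, North and up at a
    point takes the North pole to that point. *)
Definition frame (phi theta : R) : SO3.
Proof.
refine (mkSO3 (- sin phi, cos phi, 0) (- cos phi * sin theta, - sin phi * sin theta, cos theta)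
  (cos phi * cos theta, sin phi * cos theta, sin theta) _ _ _ _ _ _ _);
generalize (cs2 phi) (cs2 theta); unfold dot, px, py, pz; simpl; intros h1 h2; try ring; nsatz.
Defined.

Definition pole : S2 := sph 0 (PI / 2).

Lemma pole_coord : proj1_sig pole = (0, 0, 1).
Proof. unfold pole, sph; simpl; rewrite cos_PI2, sin_PI2, !Rmult_0_r; reflexivity. Qed.

Lemma pole_moves (X : S2) : exists G, col3 G = proj1_sig X.
Proof.
destruct (sph_surj X) as [phi [theta [_ [_ ->]]]]; exists (frame phi theta); reflexivity.
Qed.

(** * Continuous functions on the sphere *)

Definition nearby (d : R) (X Y : S2) : Prop := forall i, Rabs (sc i Y - sc i X) < d.

Definition contS (f : S2 -> R) : Prop :=
  forall X eps, 0 < eps -> exists d, 0 < d /\ forall Y, nearby d X Y -> Rabs (f Y - f X) < eps.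

Lemma nearby_weaken (d e : R) (X Y : S2) : d <= e -> nearby d X Y -> nearby e X Y.
Proof. intros hd h i; eapply Rlt_le_trans; [apply h|exact hd]. Qed.

Lemma contS_comp2 (h : R -> R -> R) (f g : S2 -> R) :
  (forall x y, continuity_2d_pt h x y) -> contS f -> contS g -> contS (fun X => h (f X) (g X)).
Proof.
intros hh hf hg X eps he.
destruct (hh (f X) (g X) (mkposreal eps he)) as [d hd].
destruct (hf X d (cond_pos d)) as [d1 [p1 h1]].
destruct (hg X d (cond_pos d)) as [d2 [p2 h2]].
exists (Rmin d1 d2); split; [now apply Rmin_pos|].
intros Y hY; apply hd.
- apply h1; eapply nearby_weaken; [apply Rmin_l|exact hY].
- apply h2; eapply nearby_weaken; [apply Rmin_r|exact hY].
Qed.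

Lemma contS_const (c : R) : contS (fun _ => c).
Proof.
intros X eps he; exists 1; split; [lra|]; intros; rewrite Rminus_diag, Rabs_R0; exact he.
Qed.

Lemma contS_sc (i : axis) : contS (sc i).
Proof. intros X eps he; exists eps; split; [assumption|]; intros Y h; apply h. Qed.

Lemma contS_plus (f g : S2 -> R) : contS f -> contS g -> contS (fun X => f X + g X).
Proof.
intros hf hg; apply (contS_comp2 Rplus); [|assumption|assumption].
intros; apply (continuity_2d_pt_plus (fun u _ => u) (fun _ v => v)).
- apply continuity_2d_pt_id1.
- apply continuity_2d_pt_id2.
Qed.

Lemma contS_mult (f g : S2 -> R) : contS f -> contS g -> contS (fun X => f X * g X).
Proof.
intros hf hg; apply (contS_comp2 Rmult); [|assumption|assumption].
intros; apply (continuity_2d_pt_mult (fun u _ => u) (fun _ v => v)).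
- apply continuity_2d_pt_id1.
- apply continuity_2d_pt_id2.
Qed.

Lemma contS_comp (F : R -> R) (f : S2 -> R) :
  (forall s, continuous F s) -> contS f -> contS (fun X => F (f X)).
Proof.
intros hF hf; apply (contS_comp2 (fun u _ => F u) f f); [|assumption|assumption].
intros x y; apply (continuity_1d_2d_pt_comp F (fun u _ => u)).
- apply continuity_pt_filterlim, hF.
- apply continuity_2d_pt_id1.
Qed.

Lemma contS_opp (f : S2 -> R) : contS f -> contS (fun X => - f X).
Proof.
intros hf; replace (fun X => - f X) with (fun X => (-1) * f X)
  by (apply functional_extensionality; intros; ring).
apply contS_mult; [apply contS_const|assumption].
Qed.

Lemma contS_minus (f g : S2 -> R) : contS f -> contS g -> contS (fun X => f X - g X).
Proof. intros; apply contS_plus; [assumption|now apply contS_opp]. Qed.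

Lemma contS_pow (f : S2 -> R) (n : nat) : contS f -> contS (fun X => f X ^ n).
Proof.
intros hf; induction n as [|n IH]; simpl.
- apply contS_const.
- now apply contS_mult.
Qed.

Lemma contS_sum3 (f : axis -> S2 -> R) :
  (forall i, contS (f i)) -> contS (fun X => sum3 (fun i => f i X)).
Proof. intros h; unfold sum3; repeat apply contS_plus; apply h. Qed.

Ltac contS_tac := repeat (cbv beta; first
  [ assumption
  | match goal with
    | h : forall _, contS _ |- contS _ => apply h
    | h : forall _ _, contS _ |- contS _ => apply h
    | |- contS (fun _ => ?c) => apply (contS_const c)
    | |- contS (fun X => @?f X + @?g X) => apply (contS_plus f g)
    | |- contS (fun X => @?f X - @?g X) => apply (contS_minus f g)
    | |- contS (fun X => - @?f X) => apply (contS_opp f)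
    | |- contS (fun X => @?f X * @?g X) => apply (contS_mult f g)
    | |- contS (fun X => @?f X ^ ?n) => apply (contS_pow f n)
    | |- contS (fun X => sc ?i X) => apply (contS_sc i)
    | |- contS (sc ?i) => apply (contS_sc i)
    | |- contS (fun X => sum3 (fun i => @?f X i)) => apply (contS_sum3 (fun i X => f X i)); intros
    end ]).

Lemma coord_col_bound (G : SO3) (i : axis) :
  Rabs (coord i (col1 G)) <= 1 /\ Rabs (coord i (col2 G)) <= 1 /\ Rabs (coord i (col3 G)) <= 1.
Proof.
generalize (SO3_rows G i i); intros h.
assert (h1 : coord i (col1 G) * coord i (col1 G) + coord i (col2 G) * coord i (col2 G)
         + coord i (col3 G) * coord i (col3 G) = 1) by (destruct i; exact h).
repeat split; apply Rabs_le; nra.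
Qed.

Lemma sc_rot (G : SO3) (X : S2) (i : axis) :
  sc i (rot G X) = coord i (col1 G) * sc ax1 X + coord i (col2 G) * sc ax2 X
                   + coord i (col3 G) * sc ax3 X.
Proof. apply mulv_sum. Qed.

Lemma nearby_rot (G : SO3) (d : R) (X Y : S2) : nearby d X Y -> nearby (3 * d) (rot G X) (rot G Y).
Proof.
intros h i; rewrite !sc_rot; destruct (coord_col_bound G i) as [b1 [b2 b3]].
generalize (h ax1) (h ax2) (h ax3); intros h1 h2 h3.
set (a := coord i (col1 G)) in *; set (b := coord i (col2 G)) in *; set (c := coord i (col3 G)) in *.
assert (aux : forall u v, Rabs u <= 1 -> Rabs v < d -> Rabs (u * v) < d).
{ intros u v hu hv; rewrite Rabs_mult; generalize (Rabs_pos u) (Rabs_pos v); nra. }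
replace (_ - _) with (a * (sc ax1 Y - sc ax1 X) + b * (sc ax2 Y - sc ax2 X) + c * (sc ax3 Y - sc ax3 X))
  by ring.
eapply Rle_lt_trans; [apply Rabs_triang|].
eapply Rle_lt_trans; [apply Rplus_le_compat_r, Rabs_triang|].
generalize (aux _ _ b1 h1) (aux _ _ b2 h2) (aux _ _ b3 h3); lra.
Qed.

Lemma contS_rot (G : SO3) (f : S2 -> R) : contS f -> contS (fun X => f (rot G X)).
Proof.
intros hf X eps he; destruct (hf (rot G X) eps he) as [d [pd hd]].
exists (d / 3); split; [lra|]; intros Y hY; apply hd.
replace d with (3 * (d / 3)) by field; now apply nearby_rot.
Qed.

Lemma sin_lip (a b : R) : Rabs (sin b - sin a) <= Rabs (b - a).
Proof.
destruct (MVT_gen sin a b cos) as [c [_ ->]].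
- intros; apply is_derive_sin.
- intros; apply continuity_sin.
- rewrite Rabs_mult; generalize (COS_bound c) (Rabs_pos (b - a)); intros h1 h2.
  assert (Rabs (cos c) <= 1) by (apply Rabs_le; lra); nra.
Qed.

Lemma cos_lip (a b : R) : Rabs (cos b - cos a) <= Rabs (b - a).
Proof.
rewrite !cos_sin; replace (b - a) with ((PI / 2 + b) - (PI / 2 + a)) by ring; apply sin_lip.
Qed.

Lemma mult_lip (a b c d : R) :
  Rabs b <= 1 -> Rabs c <= 1 -> Rabs (a * b - c * d) <= Rabs (a - c) + Rabs (b - d).
Proof.
intros hb hc; replace (a * b - c * d) with ((a - c) * b + c * (b - d)) by ring.
eapply Rle_trans; [apply Rabs_triang|]; rewrite !Rabs_mult.
generalize (Rabs_pos (a - c)) (Rabs_pos (b - d)); nra.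
Qed.

Lemma Rabs_cos (t : R) : Rabs (cos t) <= 1.
Proof. generalize (COS_bound t); intros; apply Rabs_le; lra. Qed.

Lemma Rabs_sin (t : R) : Rabs (sin t) <= 1.
Proof. generalize (SIN_bound t); intros; apply Rabs_le; lra. Qed.

Lemma sph_lip (d phi theta phi' theta' : R) :
  Rabs (phi' - phi) < d -> Rabs (theta' - theta) < d ->
  nearby (2 * d) (sph phi theta) (sph phi' theta').
Proof.
intros h1 h2 i; unfold sc; destruct i; simpl; unfold px, py, pz; simpl.
- eapply Rle_lt_trans; [apply mult_lip; apply Rabs_cos|].
  generalize (cos_lip phi phi') (cos_lip theta theta'); lra.
- eapply Rle_lt_trans; [apply mult_lip; [apply Rabs_cos|apply Rabs_sin]|].
  generalize (sin_lip phi phi') (cos_lip theta theta'); lra.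
- generalize (sin_lip theta theta') (Rabs_pos (theta' - theta)); lra.
Qed.

(** Compactness of the sphere, inherited from the rectangle of longitudes and latitudes.
    The radius attached to a point is also made smaller than [1 / (1 + |f|)] there, so
    that the Lebesgue number of the cover bounds [f] at the same time. *)
Lemma contS_compact (f : S2 -> R) (eps : R) : contS f -> 0 < eps ->
  exists d, 0 < d /\ (forall X Y, nearby d X Y -> Rabs (f Y - f X) < eps)
       /\ (forall X, Rabs (f X) <= / d + eps).
Proof.
intros hf he.
assert (hd : forall X, exists d : posreal, d <= / (1 + Rabs (f X)) /\
   forall Y, nearby (4 * d) X Y -> Rabs (f Y - f X) < eps / 2).
{ intros X; destruct (hf X (eps / 2)) as [d [pd h]]; [lra|].
  assert (p1 : 0 < / (1 + Rabs (f X))) by (apply Rinv_0_lt_compat; generalize (Rabs_pos (f X)); lra).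
  assert (p : 0 < Rmin (d / 4) (/ (1 + Rabs (f X)))) by (apply Rmin_pos; lra).
  exists (mkposreal _ p); simpl; split; [apply Rmin_r|].
  intros Y hY; apply h; revert hY; apply nearby_weaken.
  generalize (Rmin_l (d / 4) (/ (1 + Rabs (f X)))); lra. }
set (dl := fun X => proj1_sig (constructive_indefinite_description _ (hd X))).
assert (hdl : forall X, dl X <= / (1 + Rabs (f X)) /\
   forall Y, nearby (4 * dl X) X Y -> Rabs (f Y - f X) < eps / 2).
{ intros X; exact (proj2_sig (constructive_indefinite_description _ (hd X))). }
destruct (compactness_value_2d (-PI) PI (-(PI/2)) (PI/2) (fun u v => dl (sph u v))) as [d hc].
assert (key : forall X, exists Z, nearby (2 * dl Z) Z X /\ d <= dl Z).
{ intros X; destruct (sph_surj X) as [phi [theta [h1 [h2 ->]]]].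
  apply NNPP; intros hn; apply (hc phi theta h1 h2); intros [u [v [_ [_ [k1 [k2 k3]]]]]].
  apply hn; exists (sph u v); split; [|exact k3].
  now apply sph_lip. }
exists (Rmin d (2 * d)); assert (hd0 := cond_pos d).
rewrite Rmin_left by lra.
split; [exact hd0|split].
- intros X Y hXY; destruct (key X) as [Z [k1 k2]].
  assert (e1 : Rabs (f X - f Z) < eps / 2).
  { apply hdl; revert k1; apply nearby_weaken; generalize (cond_pos (dl Z)); lra. }
  assert (e2 : Rabs (f Y - f Z) < eps / 2).
  { apply hdl; intros i; generalize (hXY i) (k1 i).
    intros a b; replace (sc i Y - sc i Z) with ((sc i Y - sc i X) + (sc i X - sc i Z)) by ring.
    eapply Rle_lt_trans; [apply Rabs_triang|]; generalize (cond_pos (dl Z)); lra. }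
  replace (f Y - f X) with ((f Y - f Z) - (f X - f Z)) by ring.
  eapply Rle_lt_trans; [apply Rabs_triang|]; rewrite Rabs_Ropp; lra.
- intros X; destruct (key X) as [Z [k1 k2]].
  assert (e1 : Rabs (f X - f Z) < eps / 2).
  { apply hdl; revert k1; apply nearby_weaken; generalize (cond_pos (dl Z)); lra. }
  destruct (hdl Z) as [b _].
  assert (b2 : Rabs (f Z) <= / d).
  { assert (hz := Rabs_pos (f Z)).
    assert (1 + Rabs (f Z) <= / d); [|lra].
    rewrite <- (Rinv_inv (1 + Rabs (f Z))).
    apply Rinv_le_contravar; [exact hd0|]; lra. }
  replace (f X) with (f Z + (f X - f Z)) by ring.
  eapply Rle_trans; [apply Rabs_triang|]; lra.
Qed.

Lemma contS_unif (f : S2 -> R) (eps : R) : contS f -> 0 < eps ->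
  exists d, 0 < d /\ forall X Y, nearby d X Y -> Rabs (f Y - f X) < eps.
Proof.
intros hf he; destruct (contS_compact f eps hf he) as [d [pd [h _]]]; now exists d.
Qed.

Lemma contS_bounded (f : S2 -> R) : contS f -> exists M, 0 < M /\ forall X, Rabs (f X) <= M.
Proof.
intros hf; destruct (contS_compact f 1 hf Rlt_0_1) as [d [pd [_ h]]].
exists (/ d + 1); split; [generalize (Rinv_0_lt_compat d pd); lra|exact h].
Qed.

(** * The surface integral *)

Definition slice (f : S2 -> R) (theta : R) : R :=
  RInt (fun phi => f (sph phi theta) * cos theta) 0 (2 * PI).

Definition surf (f : S2 -> R) : R := RInt (slice f) (- (PI / 2)) (PI / 2).

Lemma inner_surf (f g : S2 -> R) : inner f g = surf (fun X => f X * g X).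
Proof. reflexivity. Qed.

Lemma continuous_eps (h : R -> R) (x : R) :
  (forall eps, 0 < eps -> exists d, 0 < d /\ forall y, Rabs (y - x) < d -> Rabs (h y - h x) < eps) ->
  continuous h x.
Proof.
intros H; apply continuity_pt_filterlim, continuity_pt_locally; intros eps.
destruct (H eps (cond_pos eps)) as [d [pd hd]].
exists (mkposreal d pd); intros y hy; apply hd, hy.
Qed.

Lemma continuous_sph_theta (h : S2 -> R) (phi theta : R) : contS h ->
  continuous (fun t => h (sph phi t)) theta.
Proof.
intros hf; apply continuous_eps; intros eps he.
destruct (hf (sph phi theta) eps he) as [d [pd hd]].
exists (d / 2); split; [lra|]; intros y hy; apply hd.
replace d with (2 * (d / 2)) by field; apply sph_lip; [|assumption].
rewrite Rminus_diag, Rabs_R0; lra.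
Qed.

Lemma continuous_sph_phi (f : S2 -> R) (phi theta : R) : contS f ->
  continuous (fun t => f (sph t theta)) phi.
Proof.
intros hf; apply continuous_eps; intros eps he.
destruct (hf (sph phi theta) eps he) as [d [pd hd]].
exists (d / 2); split; [lra|]; intros y hy; apply hd.
replace d with (2 * (d / 2)) by field; apply sph_lip; [assumption|].
rewrite Rminus_diag, Rabs_R0; lra.
Qed.

Lemma ex_RInt_slice (f : S2 -> R) (theta : R) (a b : R) : contS f ->
  ex_RInt (fun phi => f (sph phi theta) * cos theta) a b.
Proof.
intros hf; apply (ex_RInt_continuous (V := R_CompleteNormedModule)); intros z _.
apply (continuous_mult (fun t => f (sph t theta)) (fun _ => cos theta)).
- now apply continuous_sph_phi.
- apply continuous_const.
Qed.

Lemma two_PI_pos : 0 <= 2 * PI.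
Proof. generalize PI_RGT_0; lra. Qed.

Lemma lat_le : - (PI / 2) <= PI / 2.
Proof. generalize PI_RGT_0; lra. Qed.

Lemma slice_plus (f g : S2 -> R) (theta : R) : contS f -> contS g ->
  slice (fun X => f X + g X) theta = slice f theta + slice g theta.
Proof.
intros hf hg; unfold slice.
rewrite <- (RInt_plus (V := R_CompleteNormedModule)) by now apply ex_RInt_slice.
apply RInt_ext; intros; apply Rmult_plus_distr_r.
Qed.

Lemma slice_scal (c : R) (f : S2 -> R) (theta : R) : contS f ->
  slice (fun X => c * f X) theta = c * slice f theta.
Proof.
intros hf; unfold slice.
rewrite <- (RInt_scal (V := R_CompleteNormedModule) _ _ _ c) by now apply ex_RInt_slice.
apply RInt_ext; intros; unfold scal; simpl; unfold mult; simpl; ring.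
Qed.

Lemma slice_bound (f : S2 -> R) (M theta : R) : contS f -> (forall X, Rabs (f X) <= M) ->
  Rabs (slice f theta) <= 2 * PI * M.
Proof.
intros hf hM; unfold slice.
replace (2 * PI * M) with ((2 * PI - 0) * M) by ring.
apply abs_RInt_le_const; [apply two_PI_pos|now apply ex_RInt_slice|].
intros t _; rewrite Rabs_mult.
generalize (hM (sph t theta)) (Rabs_cos theta) (Rabs_pos (f (sph t theta))) (Rabs_pos (cos theta)); nra.
Qed.

Lemma slice_continuous (f : S2 -> R) (theta : R) : contS f -> continuous (slice f) theta.
Proof.
intros hf; apply continuous_eps; intros eps he.
assert (hpi := PI_RGT_0).
destruct (contS_bounded f hf) as [M [pM hM]].
assert (p1 : 0 < eps / (8 * PI)) by (apply Rdiv_lt_0_compat; lra).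
destruct (contS_unif f (eps / (8 * PI)) hf p1) as [d [pd hd]].
assert (p2 : 0 < eps / (8 * PI) / M) by (apply Rdiv_lt_0_compat; lra).
exists (Rmin (d / 2) (eps / (8 * PI) / M)); split; [apply Rmin_pos; lra|]; intros y hy.
unfold slice.
assert (e1 := ex_RInt_slice f y 0 (2 * PI) hf).
assert (e2 := ex_RInt_slice f theta 0 (2 * PI) hf).
replace (RInt _ _ _ - RInt _ _ _) with
 (RInt (fun phi => f (sph phi y) * cos y - f (sph phi theta) * cos theta) 0 (2 * PI)).
2:{ exact (RInt_minus (V := R_CompleteNormedModule) _ _ _ _ e1 e2). }
apply Rle_lt_trans with ((2 * PI - 0) * (eps / (4 * PI))).
2:{ replace ((2 * PI - 0) * (eps / (4 * PI))) with (eps / 2); [lra|field; lra]. }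
apply abs_RInt_le_const; [apply two_PI_pos| |].
{ exact (ex_RInt_minus (V := R_CompleteNormedModule) _ _ _ _ e1 e2). }
intros t _.
replace (_ - _) with ((f (sph t y) - f (sph t theta)) * cos y + f (sph t theta) * (cos y - cos theta))
  by ring.
eapply Rle_trans; [apply Rabs_triang|]; rewrite !Rabs_mult.
assert (a1 : Rabs (f (sph t y) - f (sph t theta)) < eps / (8 * PI)).
{ apply hd; replace d with (2 * (d / 2)) by field; apply sph_lip.
  - rewrite Rminus_diag, Rabs_R0; lra.
  - eapply Rlt_le_trans; [exact hy|apply Rmin_l]. }
assert (a2 : M * Rabs (cos y - cos theta) <= eps / (8 * PI)).
{ replace (eps / (8 * PI)) with (M * (eps / (8 * PI) / M)) by (field; lra).
  apply Rmult_le_compat_l; [lra|].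
  eapply Rle_trans; [apply cos_lip|].
  apply Rlt_le; eapply Rlt_le_trans; [exact hy|apply Rmin_r]. }
replace (eps / (4 * PI)) with (eps / (8 * PI) + eps / (8 * PI)) by (field; lra).
generalize (hM (sph t theta)) (Rabs_cos y) (Rabs_pos (cos y)) (Rabs_pos (cos y - cos theta))
  (Rabs_pos (f (sph t y) - f (sph t theta))); intros.
apply Rplus_le_compat; [nra|].
eapply Rle_trans; [|exact a2]; now apply Rmult_le_compat_r.
Qed.

Lemma ex_RInt_surf (f : S2 -> R) (a b : R) : contS f -> ex_RInt (slice f) a b.
Proof.
intros hf; apply (ex_RInt_continuous (V := R_CompleteNormedModule)).
intros z _; now apply slice_continuous.
Qed.

Lemma surf_plus (f g : S2 -> R) : contS f -> contS g ->
  surf (fun X => f X + g X) = surf f + surf g.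
Proof.
intros hf hg; unfold surf.
rewrite <- (RInt_plus (V := R_CompleteNormedModule)) by now apply ex_RInt_surf.
apply RInt_ext; intros; now apply slice_plus.
Qed.

Lemma surf_scal (c : R) (f : S2 -> R) : contS f -> surf (fun X => c * f X) = c * surf f.
Proof.
intros hf; unfold surf.
rewrite <- (RInt_scal (V := R_CompleteNormedModule) _ _ _ c) by now apply ex_RInt_surf.
apply RInt_ext; intros; now apply slice_scal.
Qed.

Lemma surf_minus (f g : S2 -> R) : contS f -> contS g ->
  surf (fun X => f X - g X) = surf f - surf g.
Proof.
intros hf hg.
replace (fun X => f X - g X) with (fun X => f X + (-1) * g X)
  by (apply functional_extensionality; intros; ring).
rewrite surf_plus, surf_scal; [ring| | |]; auto.
apply contS_mult; [apply contS_const|assumption].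
Qed.

Lemma surf_le (f g : S2 -> R) : contS f -> contS g -> (forall X, f X <= g X) -> surf f <= surf g.
Proof.
intros hf hg h; unfold surf; apply RInt_le; [apply lat_le|now apply ex_RInt_surf|now apply ex_RInt_surf|].
intros t ht; unfold slice; apply RInt_le;
  [apply two_PI_pos|now apply ex_RInt_slice|now apply ex_RInt_slice|].
intros u _; apply Rmult_le_compat_r; [apply cos_ge_0; lra|apply h].
Qed.

Lemma surf_bound (f : S2 -> R) (M : R) : contS f -> (forall X, Rabs (f X) <= M) ->
  Rabs (surf f) <= 2 * PI * PI * M.
Proof.
intros hf hM; unfold surf.
replace (2 * PI * PI * M) with ((PI / 2 - - (PI / 2)) * (2 * PI * M)) by field.
apply abs_RInt_le_const; [apply lat_le|now apply ex_RInt_surf|].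
intros; now apply slice_bound.
Qed.

Lemma surf_ext (f g : S2 -> R) : (forall X, f X = g X) -> surf f = surf g.
Proof. intros h; f_equal; now apply functional_extensionality. Qed.

Lemma surf_sum3 (f : axis -> S2 -> R) : (forall i, contS (f i)) ->
  surf (fun X => sum3 (fun i => f i X)) = sum3 (fun i => surf (f i)).
Proof.
intros h; unfold sum3; rewrite !surf_plus; auto.
now apply contS_plus.
Qed.

Lemma surf_const (c : R) : surf (fun _ => c) = 4 * PI * c.
Proof.
unfold surf.
rewrite (RInt_ext _ (fun t => (2 * PI * c) * cos t)).
2:{ intros t _; unfold slice; rewrite RInt_const; unfold scal; simpl; unfold mult; simpl; ring. }
rewrite (RInt_scal (V := R_CompleteNormedModule)).
- rewrite (is_RInt_unique cos _ _ (minus (sin (PI / 2)) (sin (- (PI / 2))))).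
  + unfold scal, minus, plus, opp, mult; simpl; unfold mult; simpl.
    rewrite sin_neg, sin_PI2; ring.
  + apply (is_RInt_derive sin cos).
    * intros; apply is_derive_sin.
    * intros; apply continuity_pt_filterlim, continuity_cos.
- apply (ex_RInt_continuous (V := R_CompleteNormedModule)).
  intros; apply continuity_pt_filterlim, continuity_cos.
Qed.

(** * Powers of the affinity of two points *)

(** A kernel that depends on the distance only, takes values in [[0, 1]], and is equal to
    [1] exactly on the diagonal; its powers concentrate there. *)
Definition affinity (X Y : S2) : R := (1 + dot (proj1_sig X) (proj1_sig Y)) / 2.

Lemma affinity_sc (X Y : S2) :
  affinity X Y = (1 + (sc ax1 X * sc ax1 Y + sc ax2 X * sc ax2 Y + sc ax3 X * sc ax3 Y)) / 2.
Proof. reflexivity. Qed.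

Lemma affinity_sym (X Y : S2) : affinity X Y = affinity Y X.
Proof. rewrite !affinity_sc; field. Qed.

Lemma affinity_rot (G : SO3) (X Y : S2) : affinity (rot G X) Y = affinity X (rot (trSO3 G) Y).
Proof. unfold affinity; simpl; now rewrite dot_trSO3. Qed.

Lemma affinity_dist (X Y : S2) :
  4 * (1 - affinity X Y) = (sc ax1 Y - sc ax1 X) * (sc ax1 Y - sc ax1 X)
   + (sc ax2 Y - sc ax2 X) * (sc ax2 Y - sc ax2 X) + (sc ax3 Y - sc ax3 X) * (sc ax3 Y - sc ax3 X).
Proof.
rewrite affinity_sc; generalize (sc_norm X) (sc_norm Y); intros h1 h2; nra.
Qed.

Lemma affinity_bounds (X Y : S2) : 0 <= affinity X Y <= 1.
Proof.
split.
- rewrite affinity_sc; generalize (sc_norm X) (sc_norm Y); intros h1 h2.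
  set (a := sc ax1 X) in *; set (b := sc ax2 X) in *; set (c := sc ax3 X) in *.
  set (a' := sc ax1 Y) in *; set (b' := sc ax2 Y) in *; set (c' := sc ax3 Y) in *.
  generalize (Rle_0_sqr (a + a')) (Rle_0_sqr (b + b')) (Rle_0_sqr (c + c')).
  unfold Rsqr; intros; nra.
- generalize (affinity_dist X Y).
  generalize (Rle_0_sqr (sc ax1 Y - sc ax1 X)) (Rle_0_sqr (sc ax2 Y - sc ax2 X))
    (Rle_0_sqr (sc ax3 Y - sc ax3 X)); unfold Rsqr; intros; lra.
Qed.

Lemma affinity_far (d : R) (X Y : S2) : 0 < d -> ~ nearby d X Y -> d * d <= 4 * (1 - affinity X Y).
Proof.
intros hd hn; rewrite affinity_dist.
assert (aux : forall t, d <= Rabs t -> d * d <= t * t).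
{ intros t ht.
  generalize (Rsqr_abs t); unfold Rsqr; intros ->; nra. }
generalize (Rle_0_sqr (sc ax1 Y - sc ax1 X)) (Rle_0_sqr (sc ax2 Y - sc ax2 X))
    (Rle_0_sqr (sc ax3 Y - sc ax3 X)); unfold Rsqr; intros.
destruct (Rle_dec d (Rabs (sc ax1 Y - sc ax1 X))) as [h1|h1]; [generalize (aux _ h1); lra|].
destruct (Rle_dec d (Rabs (sc ax2 Y - sc ax2 X))) as [h2|h2]; [generalize (aux _ h2); lra|].
destruct (Rle_dec d (Rabs (sc ax3 Y - sc ax3 X))) as [h3|h3]; [generalize (aux _ h3); lra|].
exfalso; apply hn; intros i; destruct i; lra.
Qed.

Lemma pow_bounds (u : R) (n : nat) : 0 <= u <= 1 -> 0 <= u ^ n <= 1.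
Proof.
intros h; split; [apply pow_le; lra|]; rewrite <- (pow1 n); apply pow_incr; lra.
Qed.

Lemma contS_affinity_r (X : S2) : contS (fun Y => affinity X Y).
Proof.
apply (contS_mult (fun Y => 1 + dot (proj1_sig X) (proj1_sig Y)) (fun _ => / 2)).
- apply contS_plus; [apply contS_const|].
  apply (contS_sum3 (fun i Y => sc i X * sc i Y)); intros i.
  apply contS_mult; [apply contS_const|apply contS_sc].
- apply contS_const.
Qed.

Ltac contK := repeat first [progress contS_tac | apply contS_affinity_r].

Lemma contS_ker_r (n : nat) (X : S2) : contS (fun Y => affinity X Y ^ n).
Proof. apply contS_pow, contS_affinity_r. Qed.

(** The Laplacian [(1 - s^2) g'' - 2 s g'] of [g(s) = u^n], where [u = (1 + s) / 2]. *)
Definition zonal_lap (n : nat) (u : R) : R :=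
  INR n * INR n * u ^ (pred n) - INR n * (INR n + 1) * u ^ n.

Lemma continuity_2d_pt_pow (f : R -> R -> R) (n : nat) (x y : R) :
  continuity_2d_pt f x y -> continuity_2d_pt (fun a b => f a b ^ n) x y.
Proof.
intros h; induction n as [|n IH]; simpl.
- apply continuity_2d_pt_const.
- now apply continuity_2d_pt_mult.
Qed.

Lemma continuity_2d_pt_cos (f : R -> R -> R) (x y : R) :
  continuity_2d_pt f x y -> continuity_2d_pt (fun a b => cos (f a b)) x y.
Proof. intros; apply (continuity_1d_2d_pt_comp cos); [apply continuity_cos|assumption]. Qed.

Lemma continuity_2d_pt_sin (f : R -> R -> R) (x y : R) :
  continuity_2d_pt f x y -> continuity_2d_pt (fun a b => sin (f a b)) x y.
Proof. intros; apply (continuity_1d_2d_pt_comp sin); [apply continuity_sin|assumption]. Qed.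

Ltac cont2d := repeat first
  [ apply continuity_2d_pt_const | apply continuity_2d_pt_id1 | apply continuity_2d_pt_id2
  | apply continuity_2d_pt_plus | apply continuity_2d_pt_minus | apply continuity_2d_pt_mult
  | apply continuity_2d_pt_opp | apply continuity_2d_pt_pow
  | apply continuity_2d_pt_cos | apply continuity_2d_pt_sin ].

(** The function integrated here is the spherical Laplacian of [u ^ n].  In coordinates,
    [cos theta] times it is the divergence
    [d/dphi (g'(s) s_phi / cos theta) + d/dtheta (cos theta g'(s) s_theta)] for
    [s = X.Y] and [u ^ n = g(s)].  The first term integrates to zero by periodicity and
    the flux in the second one vanishes at the poles. *)
Lemma surf_zonal_lap (n : nat) (X : S2) : surf (fun Y => zonal_lap n (affinity X Y)) = 0.
Proof.
destruct n as [|m].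
{ rewrite (surf_ext _ (fun _ => 0)), surf_const; [ring|].
  intros; unfold zonal_lap; simpl; ring. }
generalize (sc_norm X); set (x := sc ax1 X); set (y := sc ax2 X); set (z := sc ax3 X); intros hX.
set (h := fun Y => zonal_lap (S m) (affinity X Y)).
set (u := fun phi theta => (1 + (x * (cos phi * cos theta) + y * (sin phi * cos theta) + z * sin theta)) / 2).
set (k := INR (S m) / 2).
set (st := fun phi theta => - sin theta * (x * cos phi + y * sin phi) + z * cos theta).
set (A := fun phi theta => k * u phi theta ^ m * (- x * sin phi + y * cos phi)).
set (dA := fun phi theta =>
   k * (INR m * (/ 2 * ((- x * sin phi + y * cos phi) * cos theta)) * u phi theta ^ pred m) * (- x * sin phi + y * cos phi)
   + k * u phi theta ^ m * (- x * cos phi - y * sin phi)).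
set (B := fun theta phi => cos theta * (k * u phi theta ^ m) * st phi theta).
set (dB := fun theta phi =>
   - sin theta * (k * u phi theta ^ m) * st phi theta
   + cos theta * (k * (INR m * (/ 2 * st phi theta) * u phi theta ^ pred m)) * st phi theta
   - cos theta * (k * u phi theta ^ m) * (cos theta * (x * cos phi + y * sin phi) + z * sin theta)).
assert (hA : forall phi theta, is_derive (fun t => A t theta) phi (dA phi theta)).
{ intros; unfold A, dA, u; auto_derive; [trivial|]; unfold Rdiv; ring. }
assert (hB : forall phi theta, is_derive (fun t => B t phi) theta (dB theta phi)).
{ intros; unfold B, dB, u, st; auto_derive; [trivial|]; unfold Rdiv; ring. }
assert (hdiv : forall phi theta, h (sph phi theta) * cos theta = dA phi theta + dB theta phi).
{ intros phi theta; unfold h, zonal_lap; rewrite affinity_sc.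
  change (sc ax1 (sph phi theta)) with (cos phi * cos theta).
  change (sc ax2 (sph phi theta)) with (sin phi * cos theta).
  change (sc ax3 (sph phi theta)) with (sin theta).
  fold x y z; change ((1 + (x * (cos phi * cos theta) + y * (sin phi * cos theta) + z * sin theta)) / 2)
    with (u phi theta).
  unfold dA, dB, k, st; rewrite S_INR; simpl pred.
  set (a := x * cos phi + y * sin phi); set (a' := - x * sin phi + y * cos phi).
  set (s := cos theta * a + z * sin theta).
  assert (ha : a * a + a' * a' = 1 - z * z).
  { transitivity ((x * x + y * y) * (cos phi * cos phi + sin phi * sin phi)); [unfold a, a'; ring|].
    rewrite cs2; lra. }
  assert (hu : u phi theta = (1 + s) / 2) by (unfold u, s, a; field).
  set (s' := - sin theta * a + z * cos theta).
  assert (hs : s * s + s' * s' = a * a + z * z).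
  { transitivity ((a * a + z * z) * (cos theta * cos theta + sin theta * sin theta)); [unfold s, s'; ring|].
    rewrite cs2; lra. }
  assert (hq : a' * a' + s' * s' = 1 - s * s) by lra.
  assert (hp : INR m * u phi theta ^ m = INR m * u phi theta ^ pred m * u phi theta).
  { destruct m as [|m']; simpl; ring. }
  assert (hl : a + sin theta * s' + cos theta * s = 2 * cos theta * s).
  { transitivity (a * (1 - sin theta * sin theta + cos theta * cos theta) + 2 * z * sin theta * cos theta).
    - unfold s, s'; ring.
    - replace (1 - sin theta * sin theta) with (cos theta * cos theta)
        by (generalize (cs2 theta); lra).
      unfold s; ring. }
  set (P := u phi theta ^ pred m) in *.
  replace (u phi theta ^ S m) with (u phi theta ^ m * u phi theta) by (simpl; ring).
  set (Q := u phi theta ^ m) in *.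
  replace (x * sin phi) with (y * cos phi - a') by (unfold a'; ring).
  transitivity ((INR m + 1) / 2 * (INR m / 2 * P) * cos theta * (a' * a' + s' * s')
                - (INR m + 1) / 2 * Q * (a + sin theta * s' + cos theta * s)).
  2:{ replace (- x * cos phi - y * sin phi) with (- a) by (unfold a; ring).
      fold s; unfold Rdiv; unfold a'; ring. }
  rewrite hq, hl.
  assert (hsu : s = 2 * u phi theta - 1) by (rewrite hu; field).
  rewrite hsu.
  replace ((INR m + 1) / 2 * (INR m / 2 * P) * cos theta *
    (1 - (2 * u phi theta - 1) * (2 * u phi theta - 1)))
   with ((INR m + 1) * cos theta * (1 - u phi theta) * (INR m * P * u phi theta)) by field.
  rewrite <- hp; field. }
assert (ch : contS h).
{ apply contS_minus; apply contS_mult; try apply contS_const; apply contS_ker_r. }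
assert (hb : forall theta, is_derive (fun t => RInt (B t) 0 (2 * PI)) theta (slice h theta)).
{ intros theta.
  replace (slice h theta) with (RInt (fun phi => Derive (fun t => B t phi) theta) 0 (2 * PI)).
  - apply is_derive_RInt_param.
    + apply filter_forall; intros t phi _; exists (dB t phi); apply hB.
    + intros phi _; apply continuity_2d_pt_ext with dB.
      * intros a b; symmetry; apply is_derive_unique, hB.
      * unfold dB, st, u, Rdiv; cont2d.
    + apply filter_forall; intros t; apply (ex_RInt_continuous (V := R_CompleteNormedModule)).
      intros phi _; apply (ex_derive_continuous (V := R_NormedModule)).
      unfold B, st, u; auto_derive; trivial.
  - unfold slice.
    assert (eA : is_RInt (fun phi => dA phi theta) 0 (2 * PI) 0).
    { replace 0 with (minus (A (2 * PI) theta) (A 0 theta)) at 2.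
      - apply (is_RInt_derive (fun t => A t theta)).
        + intros; apply hA.
        + intros; apply (ex_derive_continuous (V := R_NormedModule)); unfold dA, u.
          auto_derive; trivial.
      - unfold A, u; rewrite cos_2PI, sin_2PI, cos_0, sin_0.
        unfold minus, plus, opp; simpl; ring. }
    assert (eB : ex_RInt (fun phi => dB theta phi) 0 (2 * PI)).
    { apply (ex_RInt_continuous (V := R_CompleteNormedModule)); intros phi _.
      apply (ex_derive_continuous (V := R_NormedModule)); unfold dB, u, st; auto_derive; trivial. }
    rewrite (RInt_ext (fun phi => h (sph phi theta) * cos theta) (fun phi => plus (dA phi theta) (dB theta phi))).
    2:{ intros; apply hdiv. }
    rewrite (RInt_plus (V := R_CompleteNormedModule)); [|now exists 0|exact eB].
    rewrite (is_RInt_unique _ _ _ _ eA); unfold plus; simpl; rewrite Rplus_0_l.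
    apply RInt_ext; intros; apply is_derive_unique, hB. }
unfold surf; apply is_RInt_unique.
replace 0 with (minus (RInt (B (PI / 2)) 0 (2 * PI)) (RInt (B (- (PI / 2))) 0 (2 * PI))).
- apply (is_RInt_derive (fun t => RInt (B t) 0 (2 * PI))); intros; [apply hb|now apply slice_continuous].
- rewrite (RInt_ext (B (PI / 2)) (fun _ => 0)), (RInt_ext (B (- (PI / 2))) (fun _ => 0)).
  + unfold minus, plus, opp; simpl; ring.
  + intros; unfold B; now rewrite cos_neg, cos_PI2, !Rmult_0_l.
  + intros; unfold B; now rewrite cos_PI2, !Rmult_0_l.
Qed.

(** The previous lemma is a recursion on [n] for the mass of [u ^ n]. *)
Lemma surf_ker (n : nat) (X : S2) : surf (fun Y => affinity X Y ^ n) = 4 * PI / (INR n + 1).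
Proof.
induction n as [|n IH].
- simpl; rewrite surf_const; field.
- generalize (surf_zonal_lap (S n) X); unfold zonal_lap.
  rewrite surf_minus, !surf_scal; try (apply contS_mult; [apply contS_const|]); try apply contS_ker_r.
  simpl pred; rewrite IH; intros h.
  assert (hn := pos_INR n); rewrite S_INR in *.
  set (J := surf (fun Y => affinity X Y ^ S n)) in *.
  apply Rmult_eq_reg_l with ((INR n + 1) * (INR n + 1 + 1)); [|nra].
  replace ((INR n + 1) * (INR n + 1 + 1) * J) with ((INR n + 1) * (INR n + 1) * (4 * PI / (INR n + 1))) by lra.
  field; lra.
Qed.

(** * The kernel operators *)

Definition Kop (n : nat) (f : S2 -> R) (X : S2) : R := surf (fun Y => affinity X Y ^ n * f Y).

Lemma contS_ker_mult (n : nat) (X : S2) (f : S2 -> R) :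
  contS f -> contS (fun Y => affinity X Y ^ n * f Y).
Proof. intros; apply contS_mult; [apply contS_ker_r|assumption]. Qed.

Lemma Kop_S (n : nat) (f : S2 -> R) (X : S2) : contS f ->
  Kop (S n) f X = / 2 * (Kop n f X + sum3 (fun i => sc i X * Kop n (fun Y => sc i Y * f Y) X)).
Proof.
intros hf; unfold Kop.
assert (hc : forall i, contS (fun Y => sc i X * (affinity X Y ^ n * (sc i Y * f Y)))).
{ intros i; apply contS_mult; [apply contS_const|].
  apply contS_ker_mult, contS_mult; [apply contS_sc|assumption]. }
rewrite (surf_ext _ (fun Y => / 2 * (affinity X Y ^ n * f Y
   + sum3 (fun i => sc i X * (affinity X Y ^ n * (sc i Y * f Y)))))).
2:{ intros Y; simpl; rewrite (affinity_sc X Y) at 1; unfold sum3; field. }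
rewrite surf_scal.
2:{ apply contS_plus; [now apply contS_ker_mult|].
    now apply (contS_sum3 (fun i Y => sc i X * (affinity X Y ^ n * (sc i Y * f Y)))). }
rewrite surf_plus; [|now apply contS_ker_mult|].
2:{ now apply (contS_sum3 (fun i Y => sc i X * (affinity X Y ^ n * (sc i Y * f Y)))). }
rewrite (surf_sum3 (fun i Y => sc i X * (affinity X Y ^ n * (sc i Y * f Y)))) by assumption.
do 2 f_equal; unfold sum3; rewrite !surf_scal; trivial;
 apply contS_ker_mult, contS_mult; try apply contS_sc; assumption.
Qed.

Lemma contS_Kop (n : nat) : forall f, contS f -> contS (Kop n f).
Proof.
induction n as [|n IH]; intros f hf.
- replace (Kop 0 f) with (fun _ : S2 => surf f); [apply contS_const|].
  apply functional_extensionality; intros X; unfold Kop; apply surf_ext; intros; simpl; ring.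
- replace (Kop (S n) f) with (fun X => / 2 * (Kop n f X + sum3 (fun i => sc i X * Kop n (fun Y => sc i Y * f Y) X))).
  2:{ apply functional_extensionality; intros X; now rewrite Kop_S. }
  apply contS_mult; [apply contS_const|]; apply contS_plus; [now apply IH|].
  apply (contS_sum3 (fun i X => sc i X * Kop n (fun Y => sc i Y * f Y) X)); intros i.
  apply contS_mult; [apply contS_sc|]; apply IH, contS_mult; [apply contS_sc|assumption].
Qed.

(** Exchanging the two integrations is elementary because the kernel is a finite sum of
    products; the induction on [n] peels off one affine factor at a time.  The rotation
    is part of the statement because the rotation invariance of the integral is deduced
    from it. *)
Lemma Kop_fubini (G : SO3) (n : nat) : forall a f, contS a -> contS f ->
  surf (fun X => a X * Kop n f (rot G X))
  = surf (fun Y => f Y * surf (fun X => a X * affinity (rot G X) Y ^ n)).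
Proof.
induction n as [|n IH]; intros a f ha hf.
- rewrite (surf_ext _ (fun X => surf f * a X)).
  2:{ intros X; unfold Kop; rewrite (surf_ext _ f); [ring|]; intros; simpl; ring. }
  rewrite (surf_ext (fun Y => f Y * surf (fun X => a X * affinity (rot G X) Y ^ 0))
    (fun Y => surf a * f Y)).
  2:{ intros Y; rewrite (surf_ext (fun X => a X * affinity (rot G X) Y ^ 0) a); [ring|]; intros; simpl; ring. }
  rewrite !surf_scal by assumption; ring.
- assert (hai : forall i, contS (fun X => a X * sc i (rot G X))).
  { intros i; apply contS_mult; [assumption|]; apply (contS_rot G (sc i)), contS_sc. }
  assert (hfi : forall i, contS (fun Y => sc i Y * f Y)).
  { intros i; apply contS_mult; [apply contS_sc|assumption]. }
  assert (hk : forall g, contS g -> contS (fun X => Kop n g (rot G X))).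
  { intros g hg; apply (contS_rot G (Kop n g)); now apply contS_Kop. }
  assert (hkr : forall Y, contS (fun X => affinity (rot G X) Y ^ n)).
  { intros Y; apply contS_pow.
    replace (fun X => affinity (rot G X) Y) with (fun X => affinity (rot (trSO3 G) Y) X).
    - apply contS_affinity_r.
    - apply functional_extensionality; intros; now rewrite affinity_rot, affinity_sym. }
  set (p := fun i X => a X * sc i (rot G X) * Kop n (fun Y => sc i Y * f Y) (rot G X)).
  assert (hp : forall i, contS (p i)) by (intros i; apply contS_mult; auto).
  rewrite (surf_ext _ (fun X => / 2 * (a X * Kop n f (rot G X) + sum3 (fun i => p i X)))).
  2:{ intros X; rewrite Kop_S by assumption; unfold sum3, p; ring. }
  rewrite surf_scal, surf_plus, (surf_sum3 p); contS_tac; try now apply hk.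
  set (q := fun i Y X => a X * sc i (rot G X) * affinity (rot G X) Y ^ n).
  assert (hq : forall i Y, contS (q i Y)) by (intros i Y; apply contS_mult; auto).
  rewrite (surf_ext (fun Y => f Y * surf (fun X => a X * affinity (rot G X) Y ^ S n))
    (fun Y => / 2 * (f Y * surf (fun X => a X * affinity (rot G X) Y ^ n)
     + sum3 (fun i => sc i Y * f Y * surf (q i Y))))).
  2:{ intros Y.
      rewrite (surf_ext (fun X => a X * affinity (rot G X) Y ^ S n) (fun X => / 2 * (a X * affinity (rot G X) Y ^ n
         + sum3 (fun i => sc i Y * q i Y X)))).
      2:{ intros X; simpl; rewrite (affinity_sc (rot G X) Y) at 1; unfold sum3, q; field. }
      assert (hq' : forall i, contS (fun X => sc i Y * q i Y X)).
      { intros i; apply contS_mult; [apply contS_const|apply hq]. }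
      rewrite surf_scal, surf_plus, (surf_sum3 (fun i X => sc i Y * q i Y X));
       contS_tac.
      unfold sum3; rewrite !surf_scal by apply hq; ring. }
  assert (hs : forall b, contS b -> contS (fun Y => surf (fun X => b X * affinity (rot G X) Y ^ n))).
  { intros b hb.
    replace (fun Y => surf (fun X => b X * affinity (rot G X) Y ^ n))
     with (fun Y => Kop n b (rot (trSO3 G) Y)).
    2:{ apply functional_extensionality; intros Y; unfold Kop; apply surf_ext; intros X.
        now rewrite affinity_rot, affinity_sym, Rmult_comm. }
    apply (contS_rot _ (Kop n b)); now apply contS_Kop. }
  set (r := fun i Y => sc i Y * f Y * surf (q i Y)).
  assert (hr : forall i, contS (r i)).
  { intros i; apply contS_mult; [auto|]; apply (hs (fun X => a X * sc i (rot G X))); auto. }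
  change (/ 2 * (surf (fun X => a X * Kop n f (rot G X)) + sum3 (fun i => surf (p i))) =
    surf (fun Y => / 2 * (f Y * surf (fun X => a X * affinity (rot G X) Y ^ n) + sum3 (fun i => r i Y)))).
  assert (hr0 : contS (fun Y => f Y * surf (fun X => a X * affinity (rot G X) Y ^ n))).
  { apply contS_mult; auto. }
  assert (hr1 : contS (fun Y => sum3 (fun i => r i Y))) by now apply contS_sum3.
  rewrite surf_scal, surf_plus, (surf_sum3 r); contS_tac; try now apply hk.
  rewrite IH by assumption.
  assert (e : forall i, surf (p i) = surf (r i)).
  { intros i; unfold p, r, q; now rewrite IH. }
  unfold sum3; now rewrite !e.
Qed.

(** The normalised kernel has mass one and concentrates at [X]: away from [X] it is
    dominated by a multiple of [1 - u], whose integral against [u ^ n] is smaller than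
    that of [u ^ n] by the factor [1 / (n + 2)]. *)
Lemma Kop_approx (f : S2 -> R) (eps : R) : contS f -> 0 < eps ->
  exists N, forall n X, (N <= n)%nat -> Rabs ((INR n + 1) / (4 * PI) * Kop n f X - f X) <= eps.
Proof.
intros hf he; assert (hpi := PI_RGT_0).
destruct (contS_bounded f hf) as [M [pM hM]].
destruct (contS_unif f (eps / 2) hf) as [d [pd hd]]; [lra|].
set (C := 8 * M / (d * d)).
assert (pC : 0 < C) by (apply Rdiv_lt_0_compat; nra).
destruct (INR_unbounded (2 * C / eps)) as [N hN].
exists N; intros n X hn.
assert (hcn : 0 < (INR n + 1) / (4 * PI)) by (apply Rdiv_lt_0_compat; generalize (pos_INR n); lra).
set (c := (INR n + 1) / (4 * PI)) in *.
assert (pn := pos_INR n).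
assert (hfX : contS (fun Y => f Y - f X)) by (apply contS_minus; [assumption|apply contS_const]).
assert (e : c * Kop n f X - f X = c * surf (fun Y => affinity X Y ^ n * (f Y - f X))).
{ rewrite (surf_ext _ (fun Y => affinity X Y ^ n * f Y - f X * affinity X Y ^ n)) by (intros; ring).
  rewrite surf_minus, surf_scal, surf_ker; contK.
  unfold c, Kop; field; lra. }
rewrite e, Rabs_mult, (Rabs_right c) by lra.
set (b := fun Y => (eps / 2 + C) * affinity X Y ^ n - C * affinity X Y ^ S n).
assert (cb : contS b).
{ unfold b; contK. }
assert (hb : forall Y, Rabs (affinity X Y ^ n * (f Y - f X)) <= b Y).
{ intros Y; unfold b; destruct (affinity_bounds X Y) as [u0 u1].
  destruct (pow_bounds (affinity X Y) n) as [p0 p1]; [lra|].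
  rewrite Rabs_mult, (Rabs_right (_ ^ _)) by lra.
  replace ((eps / 2 + C) * affinity X Y ^ n - C * affinity X Y ^ S n)
    with (affinity X Y ^ n * (eps / 2 + C * (1 - affinity X Y))) by (simpl; ring).
  apply Rmult_le_compat_l; [assumption|].
  destruct (Classical_Prop.classic (nearby d X Y)) as [hc|hc].
  - generalize (hd _ _ hc); nra.
  - generalize (affinity_far d X Y pd hc); intros far.
    assert (h2 : Rabs (f Y - f X) <= 2 * M).
    { eapply Rle_trans; [apply Rabs_triang|]; rewrite Rabs_Ropp.
      generalize (hM X) (hM Y); lra. }
    assert (h3 : 2 * M <= C * (1 - affinity X Y)); [|lra].
    replace (2 * M) with (C * ((d * d) / 4)) by (unfold C; field; lra).
    apply Rmult_le_compat_l; lra. }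
assert (cg : contS (fun Y => affinity X Y ^ n * (f Y - f X))) by now apply contS_ker_mult.
assert (hs : Rabs (surf (fun Y => affinity X Y ^ n * (f Y - f X))) <= surf b).
{ apply Rabs_le; split.
  - replace (- surf b) with (surf (fun Y => (-1) * b Y)) by (rewrite surf_scal; [ring|assumption]).
    apply surf_le; [contS_tac|assumption|].
    intros Y; generalize (hb Y); intros h; apply Rabs_le_between in h; lra.
  - apply surf_le; [assumption|assumption|].
    intros Y; generalize (hb Y); intros h; apply Rabs_le_between in h; lra. }
assert (hsb : c * surf b = eps / 2 + C / (INR n + 2)).
{ unfold b; rewrite surf_minus, !surf_scal, !surf_ker; contK.
  rewrite S_INR; unfold c; field; lra. }
assert (hl : C / (INR n + 2) <= eps / 2).
{ assert (hN' : 2 * C / eps < INR n + 2).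
  { apply le_INR in hn; lra. }
  apply Rmult_le_reg_r with (INR n + 2); [lra|].
  replace (C / (INR n + 2) * (INR n + 2)) with C by (field; lra).
  replace C with (eps / 2 * (2 * C / eps)) at 1 by (field; lra).
  apply Rmult_le_compat_l; lra. }
apply Rle_trans with (c * surf b); [apply Rmult_le_compat_l; lra|lra].
Qed.

Lemma Rabs_small_0 (x : R) : (forall eps, 0 < eps -> Rabs x <= eps) -> x = 0.
Proof.
intros h; destruct (Req_dec x 0) as [e|e]; [exact e|].
assert (p := Rabs_pos_lt x e); generalize (h (Rabs x / 2)); lra.
Qed.

Lemma surf_dist (f g : S2 -> R) (e : R) : contS f -> contS g ->
  (forall X, Rabs (f X - g X) <= e) -> Rabs (surf f - surf g) <= 2 * PI * PI * e.
Proof.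
intros hf hg h; rewrite <- surf_minus by assumption.
apply surf_bound; [now apply contS_minus|exact h].
Qed.

(** The integral of [Kop n f] over the rotated sphere does not depend on the rotation,
    because all kernels [u ^ n] have the same mass; and [Kop n f] is close to [f]. *)
Lemma surf_rot (G : SO3) (f : S2 -> R) : contS f -> surf (fun X => f (rot G X)) = surf f.
Proof.
intros hf; assert (hpi := PI_RGT_0); apply Rminus_diag_uniq, Rabs_small_0; intros eps he.
set (e := eps / (2 * PI * PI)).
assert (pe : 0 < e) by (apply Rdiv_lt_0_compat; nra).
destruct (Kop_approx f e hf pe) as [n hn].
set (c := (INR n + 1) / (4 * PI)).
assert (cK : contS (fun X => c * Kop n f (rot G X))).
{ apply contS_mult; [apply contS_const|]; apply (contS_rot G (Kop n f)); now apply contS_Kop. }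
assert (h1 : surf (fun X => c * Kop n f (rot G X)) = surf f).
{ rewrite (Kop_fubini G n (fun _ => c)); [|apply contS_const|assumption].
  apply surf_ext; intros Y.
  rewrite (surf_ext _ (fun X => c * affinity (rot (trSO3 G) Y) X ^ n)).
  2:{ intros X; now rewrite affinity_rot, affinity_sym. }
  rewrite surf_scal, surf_ker by apply contS_ker_r.
  unfold c; field; generalize (pos_INR n); lra. }
rewrite <- h1.
replace eps with (2 * PI * PI * e) by (unfold e; field; lra).
apply surf_dist; [now apply (contS_rot G f)|exact cK|].
intros X; rewrite Rabs_minus_sym; now apply hn.
Qed.

(** Values of [f] are limits of averages [Kop n f], and these vanish as
    [0 <= Kop n f <= surf f]. *)
Lemma surf_eq_0 (f : S2 -> R) : contS f -> (forall X, 0 <= f X) -> surf f <= 0 ->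
  forall X, f X = 0.
Proof.
intros hf h0 hs X; apply Rabs_small_0; intros eps he.
destruct (Kop_approx f eps hf he) as [n hn].
assert (hk : Kop n f X = 0).
{ apply Rle_antisym.
  - apply Rle_trans with (surf f); [|exact hs].
    apply surf_le; [now apply contS_ker_mult|assumption|].
    intros Y; destruct (pow_bounds (affinity X Y) n (affinity_bounds X Y)).
    generalize (h0 Y); nra.
  - replace 0 with (surf (fun _ => 0)) by (rewrite surf_const; ring).
    apply surf_le; [apply contS_const|now apply contS_ker_mult|].
    intros Y; destruct (pow_bounds (affinity X Y) n (affinity_bounds X Y)).
    generalize (h0 Y); nra. }
generalize (hn n X (le_n n)); rewrite hk, Rmult_0_r, Rminus_0_l, Rabs_Ropp; trivial.
Qed.

(** * The Laplacian as a limit of rotation differences *)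

Definition second_diff (t : R) (f : S2 -> R) (i : axis) (X : S2) : R :=
  f (rot (axrot i t) X) + f (rot (axrot i (- t)) X) - 2 * f X.

Definition rot_diff (t : R) (f : S2 -> R) (X : S2) : R :=
  sum3 (fun i => second_diff t f i X).

(** [L] is the Laplacian of [f]: the sum of the second derivatives along the rotations
    about any three orthogonal axes.  Demanding a limit that is uniform in the point and
    in the axes makes Green's identity and rotation invariance immediate. *)
Definition laplacian (f L : S2 -> R) : Prop :=
  contS f /\ contS L /\
  forall eps, 0 < eps -> exists d, 0 < d /\ forall G t X, 0 < t < d ->
    Rabs (rot_diff t (fun Y => f (rot G Y)) X - t * t * L (rot G X)) <= eps * (t * t).

Lemma laplacian_plus (f Lf g Lg : S2 -> R) : laplacian f Lf -> laplacian g Lg ->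
  laplacian (fun X => f X + g X) (fun X => Lf X + Lg X).
Proof.
intros [cf [cLf hf]] [cg [cLg hg]]; split; [contS_tac|split; [contS_tac|]].
intros eps he.
destruct (hf (eps / 2)) as [d1 [p1 h1]]; [lra|].
destruct (hg (eps / 2)) as [d2 [p2 h2]]; [lra|].
exists (Rmin d1 d2); split; [now apply Rmin_pos|]; intros G t X ht.
assert (t1 : 0 < t < d1) by (generalize (Rmin_l d1 d2); lra).
assert (t2 : 0 < t < d2) by (generalize (Rmin_r d1 d2); lra).
replace (_ - _) with
 ((rot_diff t (fun Y => f (rot G Y)) X - t * t * Lf (rot G X)) +
  (rot_diff t (fun Y => g (rot G Y)) X - t * t * Lg (rot G X)))
 by (unfold rot_diff, second_diff, sum3; ring).
eapply Rle_trans; [apply Rabs_triang|].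
generalize (h1 G t X t1) (h2 G t X t2); lra.
Qed.

Lemma laplacian_scal (c : R) (f Lf : S2 -> R) : laplacian f Lf ->
  laplacian (fun X => c * f X) (fun X => c * Lf X).
Proof.
intros [cf [cLf hf]]; split; [contS_tac|split; [contS_tac|]].
intros eps he.
assert (hc := Rabs_pos c).
assert (pe : 0 < eps / (1 + Rabs c)) by (apply Rdiv_lt_0_compat; lra).
destruct (hf _ pe) as [d1 [p1 h1]].
exists d1; split; [assumption|]; intros G t X ht.
replace (_ - _) with (c * (rot_diff t (fun Y => f (rot G Y)) X - t * t * Lf (rot G X)))
 by (unfold rot_diff, second_diff, sum3; ring).
rewrite Rabs_mult.
apply Rle_trans with (Rabs c * (eps / (1 + Rabs c) * (t * t))).
- apply Rmult_le_compat_l; auto.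
- replace eps with (eps / (1 + Rabs c) * (1 + Rabs c)) at 2 by (field; lra).
  assert (0 <= eps / (1 + Rabs c) * (t * t)) by nra; nra.
Qed.

Lemma laplacian_minus (f Lf g Lg : S2 -> R) : laplacian f Lf -> laplacian g Lg ->
  laplacian (fun X => f X - g X) (fun X => Lf X - Lg X).
Proof.
intros hf hg.
replace (fun X => f X - g X) with (fun X => f X + (-1) * g X)
  by (apply functional_extensionality; intros; ring).
replace (fun X => Lf X - Lg X) with (fun X => Lf X + (-1) * Lg X)
  by (apply functional_extensionality; intros; ring).
apply laplacian_plus; [assumption|now apply laplacian_scal].
Qed.

Lemma laplacian_const (c : R) : laplacian (fun _ => c) (fun _ => 0).
Proof.
split; [contS_tac|split; [contS_tac|]].
intros eps he; exists 1; split; [lra|]; intros G t X ht.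
replace (_ - _) with 0 by (unfold rot_diff, second_diff, sum3; ring).
rewrite Rabs_R0; nra.
Qed.

Lemma laplacian_rot (H : SO3) (f L : S2 -> R) : laplacian f L ->
  laplacian (fun X => f (rot H X)) (fun X => L (rot H X)).
Proof.
intros [cf [cL h]]; split; [now apply (contS_rot H f)|split; [now apply (contS_rot H L)|]].
intros eps he; destruct (h eps he) as [d [pd hd]]; exists d; split; [assumption|].
intros G t X ht; generalize (hd (mulSO3 H G) t X ht); rewrite rot_mulSO3.
replace (fun Y => f (rot (mulSO3 H G) Y)) with (fun Y => f (rot H (rot G Y))); [trivial|].
apply functional_extensionality; intros; now rewrite rot_mulSO3.
Qed.

Lemma axrot_neg_r (i : axis) (t : R) (X : S2) : rot (axrot i t) (rot (axrot i (- t)) X) = X.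
Proof. generalize (axrot_neg i (- t) X); now rewrite Ropp_involutive. Qed.

Lemma surf_axrot_adjoint (i : axis) (t : R) (f g : S2 -> R) : contS f -> contS g ->
  surf (fun X => f X * g (rot (axrot i t) X)) = surf (fun X => f (rot (axrot i (- t)) X) * g X).
Proof.
intros hf hg.
assert (h1 := contS_rot (axrot i t) g hg).
rewrite <- (surf_rot (axrot i (- t)) (fun X => f X * g (rot (axrot i t) X))) by contS_tac.
apply surf_ext; intros X; now rewrite axrot_neg_r.
Qed.

Lemma contS_rot_diff (t : R) (f : S2 -> R) : contS f -> contS (rot_diff t f).
Proof.
intros hf.
assert (h : forall i s, contS (fun X => f (rot (axrot i s) X))).
{ intros i s; now apply (contS_rot (axrot i s) f). }
unfold rot_diff, second_diff; contS_tac; apply h.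
Qed.

Lemma surf_second_diff (t : R) (i : axis) (f g : S2 -> R) : contS f -> contS g ->
  surf (fun X => f X * second_diff t g i X)
  = surf (fun X => f X * g (rot (axrot i t) X)) + surf (fun X => f (rot (axrot i t) X) * g X)
    - 2 * surf (fun X => f X * g X).
Proof.
intros hf hg.
assert (h : forall i s h, contS h -> contS (fun X => h (rot (axrot i s) X))).
{ intros j s h0 hh; now apply (contS_rot (axrot j s) h0). }
rewrite (surf_ext _ (fun X => f X * g (rot (axrot i t) X) + f X * g (rot (axrot i (- t)) X)
   - 2 * (f X * g X))) by (intros; unfold second_diff; ring).
assert (h1 := h i t g hg); assert (h2 := h i (- t) g hg); assert (h3 := h i t f hf).
rewrite surf_minus, surf_plus, surf_scal; contS_tac.
rewrite (surf_axrot_adjoint i (- t)) by assumption; now rewrite Ropp_involutive.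
Qed.

Lemma surf_rot_diff_sym (t : R) (f g : S2 -> R) : contS f -> contS g ->
  surf (fun X => f X * rot_diff t g X) = surf (fun X => g X * rot_diff t f X).
Proof.
intros hf hg.
assert (h : forall i s h, contS h -> contS (fun X => h (rot (axrot i s) X))).
{ intros j s h0 hh; now apply (contS_rot (axrot j s) h0). }
assert (e : forall a b, contS a -> contS b -> surf (fun X => a X * rot_diff t b X)
   = sum3 (fun i => surf (fun X => a X * second_diff t b i X))).
{ intros a b ha hb; rewrite <- (surf_sum3 (fun i X => a X * second_diff t b i X)).
  - apply surf_ext; intros; unfold rot_diff, sum3; ring.
  - intros i; apply contS_mult; [assumption|]; unfold second_diff; contS_tac; now apply h. }
rewrite !e by assumption.
assert (e2 : forall i, surf (fun X => f X * second_diff t g i X) = surf (fun X => g X * second_diff t f i X)).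
{ intros i; rewrite !surf_second_diff by assumption.
  rewrite (surf_ext (fun X => g X * f (rot (axrot i t) X)) (fun X => f (rot (axrot i t) X) * g X))
    by (intros; ring).
  rewrite (surf_ext (fun X => g (rot (axrot i t) X) * f X) (fun X => f X * g (rot (axrot i t) X)))
    by (intros; ring).
  rewrite (surf_ext (fun X => g X * f X) (fun X => f X * g X)) by (intros; ring).
  ring. }
unfold sum3; now rewrite !e2.
Qed.

Lemma rot_diff_id (t : R) (f : S2 -> R) (X : S2) :
  rot_diff t (fun Y => f (rot idSO3 Y)) X = rot_diff t f X.
Proof. unfold rot_diff, second_diff, sum3; now rewrite !rot_id. Qed.

Lemma laplacian_id (f L : S2 -> R) (eps : R) : laplacian f L -> 0 < eps ->
  exists d, 0 < d /\ forall t X, 0 < t < d ->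
    Rabs (rot_diff t f X - t * t * L X) <= eps * (t * t).
Proof.
intros [_ [_ h]] he; destruct (h eps he) as [d [pd hd]]; exists d; split; [assumption|].
intros t X ht; generalize (hd idSO3 t X ht); now rewrite rot_diff_id, rot_id.
Qed.

Lemma green (f Lf g Lg : S2 -> R) : laplacian f Lf -> laplacian g Lg ->
  surf (fun X => f X * Lg X) = surf (fun X => g X * Lf X).
Proof.
intros hf hg; assert (hpi := PI_RGT_0).
assert (cf : contS f) by apply hf; assert (cLf : contS Lf) by apply hf.
assert (cg : contS g) by apply hg; assert (cLg : contS Lg) by apply hg.
destruct (contS_bounded f cf) as [M [pM hM]]; destruct (contS_bounded g cg) as [M' [pM' hM']].
apply Rminus_diag_uniq, Rabs_small_0; intros eps he.
set (e := eps / (2 * PI * PI * (M + M'))).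
assert (pe : 0 < e) by (apply Rdiv_lt_0_compat; [lra|]; apply Rmult_lt_0_compat; nra).
destruct (laplacian_id f Lf e) as [d1 [p1 h1]]; [exact hf|assumption|].
destruct (laplacian_id g Lg e) as [d2 [p2 h2]]; [exact hg|assumption|].
set (t := Rmin d1 d2 / 2).
assert (pt : 0 < t) by (generalize (Rmin_pos d1 d2 p1 p2); unfold t; lra).
assert (t1 : 0 < t < d1) by (generalize (Rmin_l d1 d2); unfold t in *; lra).
assert (t2 : 0 < t < d2) by (generalize (Rmin_r d1 d2); unfold t in *; lra).
assert (cfd := contS_rot_diff t f cf); assert (cgd := contS_rot_diff t g cg).
assert (key : forall a b Lb K, contS a -> contS b -> contS Lb -> contS (rot_diff t b) ->
  (forall X, Rabs (a X) <= K) -> (forall X, Rabs (rot_diff t b X - t * t * Lb X) <= e * (t * t)) ->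
  Rabs (surf (fun X => a X * rot_diff t b X) - t * t * surf (fun X => a X * Lb X))
   <= 2 * PI * PI * (K * (e * (t * t)))).
{ intros a b Lb K ca cb cL cd ha hb.
  rewrite <- surf_scal by contS_tac.
  apply surf_dist; contS_tac.
  intros X; replace (_ - _) with (a X * (rot_diff t b X - t * t * Lb X)) by ring.
  rewrite Rabs_mult; apply Rmult_le_compat; auto using Rabs_pos. }
assert (k1 := key f g Lg M cf cg cLg cgd hM (fun X => h2 t X t2)).
assert (k2 := key g f Lf M' cg cf cLf cfd hM' (fun X => h1 t X t1)).
rewrite (surf_rot_diff_sym t g f) in k2 by assumption.
set (I := surf (fun X => f X * rot_diff t g X)) in *.
set (A := surf (fun X => f X * Lg X)) in *; set (B := surf (fun X => g X * Lf X)) in *.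
apply Rmult_le_reg_l with (t * t); [nra|].
rewrite <- (Rabs_right (t * t)) at 1 by nra.
rewrite <- Rabs_mult.
replace (t * t * (A - B)) with ((I - t * t * B) - (I - t * t * A)) by ring.
eapply Rle_trans; [apply Rabs_triang|]; rewrite Rabs_Ropp.
replace (t * t * eps) with (2 * PI * PI * (M' * (e * (t * t))) + 2 * PI * PI * (M * (e * (t * t))))
 by (unfold e; field; lra).
lra.
Qed.

(** * Functions of class C^2 near the sphere *)

Definition upd (i : axis) (t : R) (X : vec) : vec :=
  match i with ax1 => (t, py X, pz X) | ax2 => (px X, t, pz X) | ax3 => (px X, py X, t) end.

Definition box (d : R) (X Y : vec) : Prop := forall i, Rabs (coord i Y - coord i X) < d.

Lemma ball_box (X Y : vec) (d : posreal) : ball X d Y <-> box d X Y.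
Proof.
destruct X as [[x1 x2] x3], Y as [[y1 y2] y3]; split.
- intros [[h1 h2] h3] i; destruct i; assumption.
- intros h; exact (conj (conj (h ax1) (h ax2)) (h ax3)).
Qed.

Lemma continuous_box (f : vec -> R) (X : vec) : continuous f X <->
  forall eps, 0 < eps -> exists d, 0 < d /\ forall Y, box d X Y -> Rabs (f Y - f X) < eps.
Proof.
split.
- intros h eps he.
  destruct (proj1 (filterlim_locally f (f X)) h (mkposreal eps he)) as [d hd].
  exists d; split; [apply cond_pos|]; intros Y hY; apply hd, ball_box, hY.
- intros h; apply filterlim_locally; intros eps.
  destruct (h eps (cond_pos eps)) as [d [pd hd]].
  exists (mkposreal d pd); intros Y hY; apply hd, (ball_box X Y (mkposreal d pd)), hY.
Qed.

Lemma open_box (U : vec -> Prop) (X : vec) : open U -> U X ->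
  exists d, 0 < d /\ forall Y, box d X Y -> U Y.
Proof.
intros hU hX; destruct (hU X hX) as [d hd].
exists d; split; [apply cond_pos|]; intros Y hY; apply hd, ball_box, hY.
Qed.

Lemma common_radius (d0 d1 d2 d3 : R) : 0 < d0 -> 0 < d1 -> 0 < d2 -> 0 < d3 ->
  exists d, 0 < d /\ d <= d0 /\ d <= d1 /\ d <= d2 /\ d <= d3.
Proof.
intros; exists (Rmin (Rmin d0 d1) (Rmin d2 d3)).
generalize (Rmin_l (Rmin d0 d1) (Rmin d2 d3)) (Rmin_r (Rmin d0 d1) (Rmin d2 d3))
  (Rmin_l d0 d1) (Rmin_r d0 d1) (Rmin_l d2 d3) (Rmin_r d2 d3); intros.
split; [repeat apply Rmin_pos; assumption|lra].
Qed.

Definition partials_on (U : vec -> Prop) (f : vec -> R) (p : axis -> vec -> R) : Prop :=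
  forall X i, U X -> is_derive (fun t => f (upd i t X)) (coord i X) (p i X).


Lemma mvt_incr (h dh : R -> R) (a b d : R) : Rabs (b - a) < d ->
  (forall x, Rabs (x - a) < d -> is_derive h x (dh x)) ->
  exists c, Rabs (c - a) < d /\ h b - h a = dh c * (b - a).
Proof.
intros hb hd.
assert (hx : forall x, Rmin a b <= x <= Rmax a b -> Rabs (x - a) < d).
{ intros x hx; apply Rabs_def2 in hb; apply Rabs_def1;
  revert hx; unfold Rmin, Rmax; destruct (Rle_dec a b); lra. }
destruct (MVT_gen h a b dh) as [c [hc e]].
- intros x hx'; apply hd, hx; lra.
- intros x hx'; apply continuity_pt_filterlim.
  apply (ex_derive_continuous (V := R_NormedModule)); exists (dh x); apply hd, hx, hx'.
- exists c; split; [apply hx, hc|exact e].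
Qed.

(** Continuous partial derivatives make a function differentiable: the increment is split
    along the coordinate directions and the mean value theorem applies to each leg. *)
Lemma differentiable_box (U : vec -> Prop) (f : vec -> R) (p : axis -> vec -> R) (X : vec) (eps : R) :
  open U -> U X -> partials_on U f p -> (forall i, continuous (p i) X) -> 0 < eps ->
  exists d, 0 < d /\ forall Y, box d X Y ->
    Rabs (f Y - f X - sum3 (fun i => p i X * (coord i Y - coord i X)))
     <= eps * sum3 (fun i => Rabs (coord i Y - coord i X)).
Proof.
intros oU hX hp cp he.
destruct (open_box U X oU hX) as [d0 [pd0 hU]].
assert (hc : forall i, exists d, 0 < d /\ forall Y, box d X Y -> Rabs (p i Y - p i X) < eps).
{ intros i; now apply (continuous_box (p i) X). }
destruct (hc ax1) as [d1 [pd1 h1]], (hc ax2) as [d2 [pd2 h2]], (hc ax3) as [d3 [pd3 h3]].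
destruct (common_radius d0 d1 d2 d3 pd0 pd1 pd2 pd3) as [d [pd [l0 [l1 [l2 l3]]]]].
assert (wk : forall e Y, d <= e -> box d X Y -> box e X Y).
{ intros e Y h hY i; generalize (hY i); lra. }
exists d; split; [assumption|]; intros Y hY.
destruct X as [[x1 x2] x3], Y as [[y1 y2] y3].
generalize (hY ax1) (hY ax2) (hY ax3); unfold coord, px, py, pz; simpl; intros k1 k2 k3.
assert (z : forall x, Rabs (x - x) < d) by (intros; rewrite Rminus_diag, Rabs_R0; exact pd).
assert (bx : forall u1 u2 u3, Rabs (u1 - x1) < d -> Rabs (u2 - x2) < d -> Rabs (u3 - x3) < d ->
  box d (x1, x2, x3) (u1, u2, u3)).
{ intros u1 u2 u3 q1 q2 q3 i; destruct i; assumption. }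
destruct (mvt_incr (fun t => f (t, y2, y3)) (fun t => p ax1 (t, y2, y3)) x1 y1 d k1) as [c1 [a1 e1]].
{ intros t ht; apply (hp (t, y2, y3) ax1), hU, wk; auto. }
destruct (mvt_incr (fun t => f (x1, t, y3)) (fun t => p ax2 (x1, t, y3)) x2 y2 d k2) as [c2 [a2 e2]].
{ intros t ht; apply (hp (x1, t, y3) ax2), hU, wk; auto. }
destruct (mvt_incr (fun t => f (x1, x2, t)) (fun t => p ax3 (x1, x2, t)) x3 y3 d k3) as [c3 [a3 e3]].
{ intros t ht; apply (hp (x1, x2, t) ax3), hU, wk; auto. }
assert (b1 := h1 _ (wk _ _ l1 (bx c1 y2 y3 a1 k2 k3))).
assert (b2 := h2 _ (wk _ _ l2 (bx x1 c2 y3 (z x1) a2 k3))).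
assert (b3 := h3 _ (wk _ _ l3 (bx x1 x2 c3 (z x1) (z x2) a3))).
unfold sum3; simpl.
set (P1 := p ax1 (x1, x2, x3)) in *; set (P2 := p ax2 (x1, x2, x3)) in *; set (P3 := p ax3 (x1, x2, x3)) in *.
replace (f (y1, y2, y3) - f (x1, x2, x3) - _) with
 ((p ax1 (c1, y2, y3) - P1) * (y1 - x1) + (p ax2 (x1, c2, y3) - P2) * (y2 - x2)
  + (p ax3 (x1, x2, c3) - P3) * (y3 - x3)) by lra.
eapply Rle_trans; [apply Rabs_triang|].
eapply Rle_trans; [apply Rplus_le_compat_r, Rabs_triang|].
rewrite !Rabs_mult, !Rmult_plus_distr_l.
generalize (Rabs_pos (y1 - x1)) (Rabs_pos (y2 - x2)) (Rabs_pos (y3 - x3)); intros.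
repeat apply Rplus_le_compat; apply Rmult_le_compat_r; lra.
Qed.

Lemma partials_continuous (U : vec -> Prop) (f : vec -> R) (p : axis -> vec -> R) (X : vec) :
  open U -> U X -> partials_on U f p -> (forall i, continuous (p i) X) -> continuous f X.
Proof.
intros oU hX hp cp; apply continuous_box; intros eps he.
destruct (differentiable_box U f p X 1 oU hX hp cp Rlt_0_1) as [d [pd hd]].
set (M := 1 + sum3 (fun i => Rabs (p i X))).
assert (pM : 1 <= M).
{ unfold M, sum3; generalize (Rabs_pos (p ax1 X)) (Rabs_pos (p ax2 X)) (Rabs_pos (p ax3 X)); lra. }
assert (pe : 0 < eps / (3 * M)) by (apply Rdiv_lt_0_compat; lra).
exists (Rmin d (eps / (3 * M))); split; [now apply Rmin_pos|].
intros Y hY.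
assert (hY1 : box d X Y) by (intros i; eapply Rlt_le_trans; [apply hY|apply Rmin_l]).
assert (hY2 : forall i, Rabs (coord i Y - coord i X) < eps / (3 * M)).
{ intros i; eapply Rlt_le_trans; [apply hY|apply Rmin_r]. }
specialize (hd Y hY1).
set (S := sum3 (fun i => p i X * (coord i Y - coord i X))) in *.
replace (f Y - f X) with ((f Y - f X - S) + S) by ring.
eapply Rle_lt_trans; [apply Rabs_triang|].
assert (hS : Rabs S <= sum3 (fun i => Rabs (p i X) * Rabs (coord i Y - coord i X))).
{ unfold S, sum3; eapply Rle_trans; [apply Rabs_triang|].
  eapply Rle_trans; [apply Rplus_le_compat_r, Rabs_triang|]; rewrite !Rabs_mult; lra. }
assert (hi : forall i, (1 + Rabs (p i X)) * Rabs (coord i Y - coord i X) < eps / 3).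
{ intros i; apply Rle_lt_trans with (M * Rabs (coord i Y - coord i X)).
  - apply Rmult_le_compat_r; [apply Rabs_pos|].
    unfold M, sum3; generalize (Rabs_pos (p ax1 X)) (Rabs_pos (p ax2 X)) (Rabs_pos (p ax3 X)).
    destruct i; lra.
  - replace (eps / 3) with (M * (eps / (3 * M))) by (field; lra).
    apply Rmult_lt_compat_l; [lra|apply hY2]. }
generalize (hi ax1) (hi ax2) (hi ax3); unfold sum3 in *; lra.
Qed.

Definition curve (c : axis -> R -> R) (t : R) : vec := (c ax1 t, c ax2 t, c ax3 t).

Lemma coord_curve (c : axis -> R -> R) (t : R) (i : axis) : coord i (curve c t) = c i t.
Proof. destruct i; reflexivity. Qed.

Lemma is_derive_eps (h : R -> R) (t l : R) : is_derive h t l <->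
  forall eps, 0 < eps -> exists d, 0 < d /\ forall s, Rabs (s - t) < d ->
    Rabs (h s - h t - l * (s - t)) <= eps * Rabs (s - t).
Proof.
split.
- intros [_ h1] eps he.
  destruct (h1 t (fun P H => H) (mkposreal eps he)) as [d hd].
  exists d; split; [apply cond_pos|]; intros s hs; generalize (hd s hs).
  unfold norm, minus, plus, opp, scal; simpl; unfold abs, mult; simpl.
  intros hh; replace (h s - h t - l * (s - t)) with (h s + - h t + - ((s + - t) * l)) by ring; exact hh.
- intros h1; split; [apply is_linear_scal_l|].
  intros x hx; apply (is_filter_lim_locally_unique t x) in hx; subst x; intros eps.
  destruct (h1 eps (cond_pos eps)) as [d [pd hd]].
  exists (mkposreal d pd); intros s hs; generalize (hd s hs).
  unfold norm, minus, plus, opp, scal; simpl; unfold abs, mult; simpl.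
  intros hh; replace (h s + - h t + - ((s + - t) * l)) with (h s - h t - l * (s - t)) by ring; exact hh.
Qed.

Lemma is_derive_curve (U : vec -> Prop) (f : vec -> R) (p : axis -> vec -> R)
  (c c' : axis -> R -> R) (t : R) :
  open U -> U (curve c t) -> partials_on U f p -> (forall i, continuous (p i) (curve c t)) ->
  (forall i, is_derive (c i) t (c' i t)) ->
  is_derive (fun s => f (curve c s)) t (sum3 (fun i => p i (curve c t) * c' i t)).
Proof.
intros oU hX hp cp hc; apply is_derive_eps; intros eps he.
set (X := curve c t) in *.
set (M := sum3 (fun i => Rabs (p i X) + Rabs (c' i t) + 1)).
assert (pM : 3 <= M).
{ unfold M, sum3; generalize (Rabs_pos (p ax1 X)) (Rabs_pos (p ax2 X)) (Rabs_pos (p ax3 X))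
   (Rabs_pos (c' ax1 t)) (Rabs_pos (c' ax2 t)) (Rabs_pos (c' ax3 t)); lra. }
set (e := Rmin 1 (eps / M)).
assert (pe : 0 < e) by (apply Rmin_pos; [lra|]; apply Rdiv_lt_0_compat; lra).
assert (e1 : e <= 1) by apply Rmin_l.
assert (e2 : e * M <= eps).
{ replace eps with (eps / M * M) by (field; lra); apply Rmult_le_compat_r; [lra|apply Rmin_r]. }
destruct (differentiable_box U f p X e oU hX hp cp pe) as [d [pd hd]].
assert (hci : forall i, exists d', 0 < d' /\ forall s, Rabs (s - t) < d' ->
  Rabs (c i s - c i t - c' i t * (s - t)) <= e * Rabs (s - t)).
{ intros i; now apply (is_derive_eps (c i) t (c' i t)). }
destruct (hci ax1) as [d1 [p1 h1]], (hci ax2) as [d2 [p2 h2]], (hci ax3) as [d3 [p3 h3]].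
assert (pdM : 0 < d / M) by (apply Rdiv_lt_0_compat; lra).
destruct (common_radius (d / M) d1 d2 d3 pdM p1 p2 p3) as [d' [pd' [l0 [l1 [l2 l3]]]]].
exists d'; split; [assumption|]; intros s hs.
assert (hs' := Rabs_pos (s - t)).
assert (hi : forall i, Rabs (c i s - c i t - c' i t * (s - t)) <= e * Rabs (s - t)).
{ intros i; destruct i; [apply h1|apply h2|apply h3]; lra. }
assert (hj : forall i, Rabs (c i s - c i t) <= (Rabs (c' i t) + 1) * Rabs (s - t)).
{ intros i; replace (c i s - c i t) with ((c i s - c i t - c' i t * (s - t)) + c' i t * (s - t)) by ring.
  eapply Rle_trans; [apply Rabs_triang|]; rewrite Rabs_mult; generalize (hi i); nra. }
assert (hb : box d X (curve c s)).
{ intros i; unfold X; rewrite !coord_curve; eapply Rle_lt_trans; [apply hj|].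
  apply Rle_lt_trans with (M * Rabs (s - t)).
  - apply Rmult_le_compat_r; [assumption|].
    unfold M, sum3; generalize (Rabs_pos (p ax1 X)) (Rabs_pos (p ax2 X)) (Rabs_pos (p ax3 X))
     (Rabs_pos (c' ax1 t)) (Rabs_pos (c' ax2 t)) (Rabs_pos (c' ax3 t)).
    destruct i; lra.
  - replace d with (M * (d / M)) by (field; lra); apply Rmult_lt_compat_l; lra. }
specialize (hd _ hb).
assert (E : forall i, coord i (curve c s) - coord i X = c i s - c i t).
{ intros i; unfold X; now rewrite !coord_curve. }
unfold sum3 in *; rewrite !E in hd.
set (D := f (curve c s) - f X) in *.
replace (D - (p ax1 X * c' ax1 t + p ax2 X * c' ax2 t + p ax3 X * c' ax3 t) * (s - t)) with
 ((D - (p ax1 X * (c ax1 s - c ax1 t) + p ax2 X * (c ax2 s - c ax2 t) + p ax3 X * (c ax3 s - c ax3 t)))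
  + p ax1 X * (c ax1 s - c ax1 t - c' ax1 t * (s - t))
  + p ax2 X * (c ax2 s - c ax2 t - c' ax2 t * (s - t))
  + p ax3 X * (c ax3 s - c ax3 t - c' ax3 t * (s - t))) by ring.
eapply Rle_trans; [apply Rabs_triang|].
eapply Rle_trans; [apply Rplus_le_compat_r, Rabs_triang|].
eapply Rle_trans; [apply Rplus_le_compat_r, Rplus_le_compat_r, Rabs_triang|].
rewrite !Rabs_mult.
apply Rle_trans with (e * M * Rabs (s - t)).
2:{ apply Rmult_le_compat_r; assumption. }
assert (q : forall i, Rabs (p i X) * Rabs (c i s - c i t - c' i t * (s - t))
   <= Rabs (p i X) * (e * Rabs (s - t))).
{ intros i; apply Rmult_le_compat_l; [apply Rabs_pos|apply hi]. }
assert (r : e * (Rabs (c ax1 s - c ax1 t) + Rabs (c ax2 s - c ax2 t) + Rabs (c ax3 s - c ax3 t))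
  <= e * ((Rabs (c' ax1 t) + 1) * Rabs (s - t) + (Rabs (c' ax2 t) + 1) * Rabs (s - t)
          + (Rabs (c' ax3 t) + 1) * Rabs (s - t))).
{ apply Rmult_le_compat_l; [lra|]; repeat apply Rplus_le_compat; apply hj. }
generalize (q ax1) (q ax2) (q ax3); intros q1 q2 q3.
replace (e * M * Rabs (s - t)) with
 (e * ((Rabs (c' ax1 t) + 1) * Rabs (s - t) + (Rabs (c' ax2 t) + 1) * Rabs (s - t)
          + (Rabs (c' ax3 t) + 1) * Rabs (s - t))
  + Rabs (p ax1 X) * (e * Rabs (s - t)) + Rabs (p ax2 X) * (e * Rabs (s - t))
  + Rabs (p ax3 X) * (e * Rabs (s - t))) by (unfold M, sum3; ring).
lra.
Qed.

Record C2_extension (psi : S2 -> R) (U : vec -> Prop) (f : vec -> R) (p : axis -> vec -> R)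
  (H : axis -> axis -> vec -> R) : Prop := {
  ext_open : open U;
  ext_sphere : forall X : S2, U (proj1_sig X);
  ext_val : forall X : S2, f (proj1_sig X) = psi X;
  ext_grad : partials_on U f p;
  ext_hess : forall i, partials_on U (p i) (H i);
  ext_cont : forall i j X, U X -> continuous (H i j) X }.

Definition partial (i : axis) : (vec -> R) -> vec -> R :=
  match i with ax1 => partial_x | ax2 => partial_y | ax3 => partial_z end.

Lemma C2_sphere_extension (psi : S2 -> R) : C2_sphere psi ->
  exists U f p H, C2_extension psi U f p H.
Proof.
intros [U [f [oU [[h1 [hx [hy hz]]] hpsi]]]].
exists U, f, (fun i => partial i f), (fun i j => partial j (partial i f)).
assert (hp : forall g, (forall X, U X ->
   ex_derive (fun t => g (t, py X, pz X)) (px X) /\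
   ex_derive (fun t => g (px X, t, pz X)) (py X) /\
   ex_derive (fun t => g (px X, py X, t)) (pz X)) -> partials_on U g (fun i => partial i g)).
{ intros g hg X i hX; destruct (hg X hX) as [g1 [g2 g3]].
  destruct i; apply Derive_correct; assumption. }
split.
- exact oU.
- intros X; apply hpsi.
- intros X; apply hpsi.
- now apply hp.
- intros i; apply hp; destruct i; [apply hx|apply hy|apply hz].
- intros i j X; destruct i; [destruct hx as [_ hh]|destruct hy as [_ hh]|destruct hz as [_ hh]];
  destruct hh as [q1 [q2 q3]]; destruct j; auto.
Qed.

Lemma C2_sphere_of_partials (psi : S2 -> R) (f : vec -> R) (p : axis -> vec -> R)
  (H : axis -> axis -> vec -> R) :
  (forall X, f (proj1_sig X) = psi X) ->
  partials_on (fun _ => True) f p -> (forall i, partials_on (fun _ => True) (p i) (H i)) ->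
  (forall i j X, continuous (H i j) X) ->
  C2_sphere psi /\ C2_extension psi (fun _ => True) f p H.
Proof.
intros hpsi hp hH hc; split.
2:{ split; auto; intros X _; apply filter_forall; trivial. }
exists (fun _ => True), f; split; [intros X _; apply filter_forall; trivial|].
split; [|intros X; split; [trivial|apply hpsi]].
assert (e : forall g q, partials_on (fun _ => True) g q -> forall i, partial i g = q i).
{ intros g q hg i; apply functional_extensionality; intros X.
  destruct i; apply is_derive_unique; [exact (hg X ax1 I)|exact (hg X ax2 I)|exact (hg X ax3 I)]. }
assert (ex : forall g q, partials_on (fun _ => True) g q -> forall X : vec, True ->
   ex_derive (fun t => g (t, py X, pz X)) (px X) /\
   ex_derive (fun t => g (px X, t, pz X)) (py X) /\
   ex_derive (fun t => g (px X, py X, t)) (pz X)).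
{ intros g q hg X _; split; [|split].
  - exists (q ax1 X); apply (hg X ax1 I).
  - exists (q ax2 X); apply (hg X ax2 I).
  - exists (q ax3 X); apply (hg X ax3 I). }
simpl; split; [now apply (ex f p)|].
change (partial_x f) with (partial ax1 f); change (partial_y f) with (partial ax2 f);
change (partial_z f) with (partial ax3 f).
rewrite !(e f p hp).
assert (k : forall i, Ck_on 1 (fun _ => True) (p i)).
{ intros i; simpl; split; [now apply (ex (p i) (H i))|].
  change (partial_x (p i)) with (partial ax1 (p i)); change (partial_y (p i)) with (partial ax2 (p i));
  change (partial_z (p i)) with (partial ax3 (p i)).
  rewrite !(e (p i) (H i) (hH i)); auto. }
split; [apply (k ax1)|split; [apply (k ax2)|apply (k ax3)]].
Qed.

(** The spherical Laplacian in terms of an extension: the trace of the Hessian on the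
    tangent plane, corrected by the curvature term [- 2 X . grad]. *)
Definition ext_lap (p : axis -> vec -> R) (H : axis -> axis -> vec -> R) (X : vec) : R :=
  sum3 (fun i => H i i X) - sum3 (fun i => sum3 (fun j => H i j X * coord i X * coord j X))
  - 2 * sum3 (fun i => p i X * coord i X).

Definition curve_d1 (p : axis -> vec -> R) (c c' : axis -> R -> R) (t : R) : R :=
  sum3 (fun i => p i (curve c t) * c' i t).

Definition curve_d2 (p : axis -> vec -> R) (H : axis -> axis -> vec -> R)
  (c c' c'' : axis -> R -> R) (t : R) : R :=
  sum3 (fun i => sum3 (fun j => H i j (curve c t) * c' j t) * c' i t + p i (curve c t) * c'' i t).

Lemma is_derive_n2 (h h1 : R -> R) (t l : R) : (forall s, is_derive h s (h1 s)) ->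
  is_derive h1 t l -> Derive_n h 2 t = l.
Proof.
intros k1 k2; simpl; apply is_derive_unique.
apply is_derive_ext with h1; [|exact k2].
intros s; symmetry; now apply is_derive_unique.
Qed.

(** * Second differences along the rotation circles *)

Lemma second_difference_bound (h h1 h2 : R -> R) (d eps t : R) :
  (forall s, is_derive h s (h1 s)) -> (forall s, is_derive h1 s (h2 s)) ->
  (forall s, Rabs s < d -> Rabs (h2 s - h2 0) <= eps) -> 0 < t < d ->
  Rabs (h t + h (- t) - 2 * h 0 - t * t * h2 0) <= 2 * eps * (t * t).
Proof.
intros k1 k2 hb ht.
assert (cont : forall (g g' : R -> R), (forall s, is_derive g s (g' s)) -> forall s, continuity_pt g s).
{ intros g g' hg s; apply continuity_pt_filterlim.
  apply (ex_derive_continuous (V := R_NormedModule)); exists (g' s); apply hg. }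
set (g := fun s => h s + h (- s) - s * s * h2 0).
set (g1 := fun s => h1 s - h1 (- s) - 2 * s * h2 0).
assert (dg : forall s, is_derive g s (g1 s)).
{ intros s; unfold g, g1; auto_derive.
  - split; [|split; trivial]; [exists (h1 s); apply k1|exists (h1 (- s)); apply k1].
  - replace (Derive (fun x => h x) s) with (h1 s) by (symmetry; apply is_derive_unique, k1).
    replace (Derive (fun x => h x) (- s)) with (h1 (- s)) by (symmetry; apply is_derive_unique, k1).
    ring. }
destruct (MVT_gen g 0 t g1) as [c [hc e]].
{ intros; apply dg. }
{ intros; apply (cont g g1 dg). }
rewrite Rmin_left, Rmax_right in hc by lra.
destruct (MVT_gen h1 (- c) c h2) as [x [hx e']].
{ intros; apply k2. }
{ intros; apply (cont h1 h2 k2). }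
rewrite Rmin_left, Rmax_right in hx by lra.
replace (h t + h (- t) - 2 * h 0 - t * t * h2 0) with (g t - g 0).
2:{ unfold g; rewrite Ropp_0; ring. }
rewrite e; replace (g1 c) with ((h2 x - h2 0) * (2 * c)).
2:{ unfold g1; replace (h1 c - h1 (- c)) with (h2 x * (c - - c)) by lra; ring. }
assert (hbx : Rabs (h2 x - h2 0) <= eps) by (apply hb, Rabs_def1; lra).
assert (hp := Rabs_pos (h2 x - h2 0)).
rewrite !Rabs_mult, (Rabs_right (2)), (Rabs_right c), (Rabs_right (t - 0)) by lra.
assert (0 <= c * t <= t * t) by nra; nra.
Qed.

(** The orbit of [X] under rotations about the axis [k] is a circle with centre
    [circle_0], parametrised as [circle_0 + cos t circle_c + sin t circle_s]. *)
Definition circle_c (k : axis) (X : S2) : vec :=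
  match k with ax1 => (0, sc ax2 X, sc ax3 X) | ax2 => (sc ax1 X, 0, sc ax3 X)
  | ax3 => (sc ax1 X, sc ax2 X, 0) end.

Definition circle_s (k : axis) (X : S2) : vec :=
  match k with ax1 => (0, - sc ax3 X, sc ax2 X) | ax2 => (sc ax3 X, 0, - sc ax1 X)
  | ax3 => (- sc ax2 X, sc ax1 X, 0) end.

Definition circle_0 (k : axis) (X : S2) : vec :=
  match k with ax1 => (sc ax1 X, 0, 0) | ax2 => (0, sc ax2 X, 0) | ax3 => (0, 0, sc ax3 X) end.

Definition circ (G : SO3) (k : axis) (X : S2) (i : axis) (t : R) : R :=
  coord i (mulv G (circle_0 k X)) + coord i (mulv G (circle_c k X)) * cos t
  + coord i (mulv G (circle_s k X)) * sin t.

Definition circ1 (G : SO3) (k : axis) (X : S2) (i : axis) (t : R) : R :=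
  coord i (mulv G (circle_s k X)) * cos t + - coord i (mulv G (circle_c k X)) * sin t.

Definition circ2 (G : SO3) (k : axis) (X : S2) (i : axis) (t : R) : R :=
  - coord i (mulv G (circle_c k X)) * cos t + - coord i (mulv G (circle_s k X)) * sin t.

Lemma circ_rot (G : SO3) (k : axis) (X : S2) (t : R) :
  curve (circ G k X) t = proj1_sig (rot G (rot (axrot k t) X)).
Proof.
apply vec_eq; intros i; rewrite coord_curve; unfold circ.
change (coord i (proj1_sig (rot G (rot (axrot k t) X)))) with
  (coord i (mulv G (mulv (axrot k t) (proj1_sig X)))).
rewrite !mulv_sum.
generalize (coord i (col1 G)) (coord i (col2 G)) (coord i (col3 G)); intros a b c.
destruct X as [[[x y] z] hX], k; unfold sc; simpl; unfold px, py, pz; simpl; ring.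
Qed.

Lemma circ_d1 (G : SO3) (k : axis) (X : S2) (i : axis) (t : R) :
  is_derive (circ G k X i) t (circ1 G k X i t).
Proof. unfold circ, circ1; auto_derive; trivial; ring. Qed.

Lemma circ_d2 (G : SO3) (k : axis) (X : S2) (i : axis) (t : R) :
  is_derive (circ1 G k X i) t (circ2 G k X i t).
Proof. unfold circ1, circ2; auto_derive; trivial; ring. Qed.

(** The uniformity in the rotation, the axis and the point is the one required by
    [laplacian]; boundedness makes the class stable under products. *)
Definition unif_at_0 (T : SO3 -> axis -> S2 -> R -> R) : Prop :=
  (exists M, 0 < M /\ forall G k X t, Rabs (T G k X t) <= M) /\
  forall eps, 0 < eps -> exists d, 0 < d /\ forall G k X t, Rabs t < d ->
    Rabs (T G k X t - T G k X 0) <= eps.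

Lemma unif_plus (T T' : SO3 -> axis -> S2 -> R -> R) : unif_at_0 T -> unif_at_0 T' ->
  unif_at_0 (fun G k X t => T G k X t + T' G k X t).
Proof.
intros [[M [pM b]] h] [[M' [pM' b']] h']; split.
- exists (M + M'); split; [lra|]; intros; eapply Rle_trans; [apply Rabs_triang|].
  apply Rplus_le_compat; auto.
- intros eps he; destruct (h (eps / 2)) as [d [pd hd]]; [lra|].
  destruct (h' (eps / 2)) as [d' [pd' hd']]; [lra|].
  exists (Rmin d d'); split; [now apply Rmin_pos|]; intros G k X t ht.
  replace (_ - _) with ((T G k X t - T G k X 0) + (T' G k X t - T' G k X 0)) by ring.
  eapply Rle_trans; [apply Rabs_triang|].
  assert (q : Rabs (T G k X t - T G k X 0) <= eps / 2).
  { apply hd; generalize (Rmin_l d d'); lra. }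
  assert (q' : Rabs (T' G k X t - T' G k X 0) <= eps / 2).
  { apply hd'; generalize (Rmin_r d d'); lra. }
  lra.
Qed.

Lemma unif_mult (T T' : SO3 -> axis -> S2 -> R -> R) : unif_at_0 T -> unif_at_0 T' ->
  unif_at_0 (fun G k X t => T G k X t * T' G k X t).
Proof.
intros [[M [pM b]] h] [[M' [pM' b']] h']; split.
- exists (M * M'); split; [nra|]; intros; rewrite Rabs_mult; apply Rmult_le_compat; auto using Rabs_pos.
- intros eps he; destruct (h (eps / (2 * M'))) as [d [pd hd]]; [apply Rdiv_lt_0_compat; lra|].
  destruct (h' (eps / (2 * M))) as [d' [pd' hd']]; [apply Rdiv_lt_0_compat; lra|].
  exists (Rmin d d'); split; [now apply Rmin_pos|]; intros G k X t ht.
  replace (_ - _) with ((T G k X t - T G k X 0) * T' G k X t + T G k X 0 * (T' G k X t - T' G k X 0)) by ring.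
  eapply Rle_trans; [apply Rabs_triang|]; rewrite !Rabs_mult.
  assert (q : Rabs (T G k X t - T G k X 0) <= eps / (2 * M')).
  { apply hd; generalize (Rmin_l d d'); lra. }
  assert (q' : Rabs (T' G k X t - T' G k X 0) <= eps / (2 * M)).
  { apply hd'; generalize (Rmin_r d d'); lra. }
  replace eps with (eps / (2 * M') * M' + M * (eps / (2 * M))) by (field; lra).
  apply Rplus_le_compat; apply Rmult_le_compat; auto using Rabs_pos.
Qed.

Lemma unif_const (T : SO3 -> axis -> S2 -> R) (M : R) : 0 < M -> (forall G k X, Rabs (T G k X) <= M) ->
  unif_at_0 (fun G k X _ => T G k X).
Proof.
intros pM h; split; [now exists M; split; [|intros; apply h]|].
intros eps he; exists 1; split; [lra|]; intros; rewrite Rminus_diag, Rabs_R0; lra.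
Qed.

Lemma unif_cos : unif_at_0 (fun _ _ _ t => cos t).
Proof.
split; [exists 1; split; [lra|intros; apply Rabs_cos]|].
intros eps he; exists eps; split; [assumption|]; intros G k X t ht.
eapply Rle_trans; [apply cos_lip|]; rewrite Rminus_0_r; lra.
Qed.

Lemma unif_sin : unif_at_0 (fun _ _ _ t => sin t).
Proof.
split; [exists 1; split; [lra|intros; apply Rabs_sin]|].
intros eps he; exists eps; split; [assumption|]; intros G k X t ht.
eapply Rle_trans; [apply sin_lip|]; rewrite Rminus_0_r; lra.
Qed.

Lemma mulv_bound (G : SO3) (V : vec) (i : axis) : (forall j, Rabs (coord j V) <= 1) ->
  Rabs (coord i (mulv G V)) <= 3.
Proof.
intros h; rewrite mulv_sum; destruct (coord_col_bound G i) as [b1 [b2 b3]].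
assert (aux : forall u v, Rabs u <= 1 -> Rabs v <= 1 -> Rabs (u * v) <= 1).
{ intros u v hu hv; rewrite Rabs_mult; generalize (Rabs_pos u) (Rabs_pos v); nra. }
eapply Rle_trans; [apply Rabs_triang|].
eapply Rle_trans; [apply Rplus_le_compat_r, Rabs_triang|].
generalize (aux _ _ b1 (h ax1)) (aux _ _ b2 (h ax2)) (aux _ _ b3 (h ax3)); lra.
Qed.

Lemma circle_bounds (G : SO3) (k : axis) (X : S2) (i : axis) :
  Rabs (coord i (mulv G (circle_c k X))) <= 3 /\ Rabs (coord i (mulv G (circle_s k X))) <= 3.
Proof.
assert (z : Rabs 0 <= 1) by (rewrite Rabs_R0; lra).
assert (b := fun j => sc_bound j X).
split; apply mulv_bound; intros j; unfold circle_c, circle_s; destruct k, j;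
 unfold coord, px, py, pz; cbn [fst snd]; rewrite ?Rabs_Ropp; trivial.
Qed.

Lemma unif_circle (i : axis) :
  unif_at_0 (fun G k X _ => - coord i (mulv G (circle_c k X))) /\
  unif_at_0 (fun G k X _ => coord i (mulv G (circle_s k X))) /\
  unif_at_0 (fun G k X _ => - coord i (mulv G (circle_s k X))).
Proof.
repeat split; try apply (unif_const _ 3); try lra; intros; rewrite ?Rabs_Ropp; apply circle_bounds.
Qed.

Lemma unif_circ1 (i : axis) : unif_at_0 (fun G k X t => circ1 G k X i t).
Proof.
destruct (unif_circle i) as [hc [hs _]].
exact (unif_plus _ _ (unif_mult _ _ hs unif_cos) (unif_mult _ _ hc unif_sin)).
Qed.

Lemma unif_circ2 (i : axis) : unif_at_0 (fun G k X t => circ2 G k X i t).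
Proof.
destruct (unif_circle i) as [hc [_ hs]].
exact (unif_plus _ _ (unif_mult _ _ hc unif_cos) (unif_mult _ _ hs unif_sin)).
Qed.

(** This is [sum_k W_k W_k^T = 1 - X X^T], the projector on the tangent plane, for the
    tangent vectors [W_k = e_k x X] of the three circles, in the frame [G]. *)
Lemma circle_s_sum (G : SO3) (X : S2) (i j : axis) :
  sum3 (fun k => coord i (mulv G (circle_s k X)) * coord j (mulv G (circle_s k X)))
  = match i, j with ax1, ax1 | ax2, ax2 | ax3, ax3 => 1 | _, _ => 0 end
    - sc i (rot G X) * sc j (rot G X).
Proof.
rewrite <- (SO3_rows G i j), !sc_rot; unfold sum3; rewrite !mulv_sum.
generalize (sc_norm X).
generalize (coord i (col1 G)) (coord i (col2 G)) (coord i (col3 G)); intros a b c.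
generalize (coord j (col1 G)) (coord j (col2 G)) (coord j (col3 G)); intros a' b' c'.
unfold circle_s, coord, px, py, pz; cbn [fst snd].
set (x := sc ax1 X); set (y := sc ax2 X); set (z := sc ax3 X).
intros h; transitivity ((a * a' + b * b' + c * c') * (x * x + y * y + z * z)
  - (a * x + b * y + c * z) * (a' * x + b' * y + c' * z)); [ring|rewrite h; ring].
Qed.

Lemma circle_c_sum (G : SO3) (X : S2) (i : axis) :
  sum3 (fun k => coord i (mulv G (circle_c k X))) = 2 * sc i (rot G X).
Proof.
rewrite !sc_rot; unfold sum3; rewrite !mulv_sum.
generalize (coord i (col1 G)) (coord i (col2 G)) (coord i (col3 G)); intros a b c.
unfold circle_c, coord, px, py, pz; cbn [fst snd]; ring.
Qed.

(** * The Laplacian of a C^2 function *)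

Section Extension.

Variables (psi : S2 -> R) (U : vec -> Prop) (f : vec -> R) (p : axis -> vec -> R)
  (H : axis -> axis -> vec -> R).
Hypothesis ext : C2_extension psi U f p H.

Lemma ext_grad_continuous (i : axis) (X : vec) : U X -> continuous (p i) X.
Proof.
intros hX; apply (partials_continuous U (p i) (H i)); auto.
- apply (ext_open _ _ _ _ _ ext).
- apply (ext_hess _ _ _ _ _ ext).
- intros j; now apply (ext_cont _ _ _ _ _ ext).
Qed.

Lemma ext_curve_d1 (c c' : axis -> R -> R) (t : R) : U (curve c t) ->
  (forall i, is_derive (c i) t (c' i t)) ->
  is_derive (fun s => f (curve c s)) t (curve_d1 p c c' t).
Proof.
intros hU hc; apply (is_derive_curve U); auto.
- apply (ext_open _ _ _ _ _ ext).
- apply (ext_grad _ _ _ _ _ ext).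
- intros i; now apply ext_grad_continuous.
Qed.

Lemma ext_curve_d2 (c c' c'' : axis -> R -> R) (t : R) : U (curve c t) ->
  (forall i, is_derive (c i) t (c' i t)) -> (forall i, is_derive (c' i) t (c'' i t)) ->
  is_derive (curve_d1 p c c') t (curve_d2 p H c c' c'' t).
Proof.
intros hU hc hc'.
assert (hi : forall i, is_derive (fun s => p i (curve c s) * c' i s) t
  (sum3 (fun j => H i j (curve c t) * c' j t) * c' i t + p i (curve c t) * c'' i t)).
{ intros i.
  assert (h1 : is_derive (fun s => p i (curve c s)) t (sum3 (fun j => H i j (curve c t) * c' j t))).
  { apply (is_derive_curve U); auto.
    - apply (ext_open _ _ _ _ _ ext).
    - apply (ext_hess _ _ _ _ _ ext).
    - intros j; now apply (ext_cont _ _ _ _ _ ext). }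
  apply (is_derive_mult (fun s => p i (curve c s)) (c' i) t _ _ h1 (hc' i)).
  intros n m; apply Rmult_comm. }
apply (is_derive_plus (fun s => p ax1 (curve c s) * c' ax1 s + p ax2 (curve c s) * c' ax2 s)
  (fun s => p ax3 (curve c s) * c' ax3 s)); [|apply hi].
apply (is_derive_plus (fun s => p ax1 (curve c s) * c' ax1 s) (fun s => p ax2 (curve c s) * c' ax2 s));
 apply hi.
Qed.

Lemma contS_ext (h : vec -> R) : (forall X, U X -> continuous h X) ->
  contS (fun X => h (proj1_sig X)).
Proof.
intros hc X eps he.
destruct (proj1 (continuous_box h (proj1_sig X)) (hc _ (ext_sphere _ _ _ _ _ ext X)) eps he)
  as [d [pd hd]].
exists d; split; [assumption|]; intros Y hY; apply hd, hY.
Qed.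

Lemma contS_ext_lap : contS (fun X => ext_lap p H (proj1_sig X)).
Proof.
assert (hH : forall i j, contS (fun X => H i j (proj1_sig X))).
{ intros i j; apply contS_ext; intros; now apply (ext_cont _ _ _ _ _ ext). }
assert (hp : forall i, contS (fun X => p i (proj1_sig X))).
{ intros i; apply contS_ext; intros; now apply ext_grad_continuous. }
assert (hs : forall i, contS (fun X => coord i (proj1_sig X))) by apply contS_sc.
unfold ext_lap, sum3; contS_tac; first [apply hH|apply hp|apply hs].
Qed.

Lemma laplace_coord_ext (phi theta : R) : cos theta <> 0 ->
  laplace_coord psi phi theta = ext_lap p H (proj1_sig (sph phi theta)).
Proof.
intros hc.
set (a := fun i t => match i with ax1 => cos phi * cos t | ax2 => sin phi * cos t | ax3 => sin t end).
set (a' := fun i t => match i with ax1 => - (cos phi * sin t) | ax2 => - (sin phi * sin t) | ax3 => cos t end).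
set (a'' := fun i t => match i with ax1 => - (cos phi * cos t) | ax2 => - (sin phi * cos t) | ax3 => - sin t end).
set (b := fun i t => match i with ax1 => cos t * cos theta | ax2 => sin t * cos theta | ax3 => sin theta end).
set (b' := fun i t => match i with ax1 => - (sin t * cos theta) | ax2 => cos t * cos theta | ax3 => 0 end).
set (b'' := fun i t => match i with ax1 => - (cos t * cos theta) | ax2 => - (sin t * cos theta) | ax3 => 0 end).
assert (da : forall i t, is_derive (a i) t (a' i t)).
{ intros i t; destruct i; unfold a, a'; auto_derive; trivial; ring. }
assert (da' : forall i t, is_derive (a' i) t (a'' i t)).
{ intros i t; destruct i; unfold a', a''; auto_derive; trivial; ring. }
assert (db : forall i t, is_derive (b i) t (b' i t)).
{ intros i t; destruct i; unfold b, b'; auto_derive; trivial; ring. }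
assert (db' : forall i t, is_derive (b' i) t (b'' i t)).
{ intros i t; destruct i; unfold b', b''; auto_derive; trivial; ring. }
assert (Ua : forall t, U (curve a t)) by (intros t; apply (ext_sphere _ _ _ _ _ ext (sph phi t))).
assert (Ub : forall t, U (curve b t)) by (intros t; apply (ext_sphere _ _ _ _ _ ext (sph t theta))).
assert (ea : forall t, f (curve a t) = psi (sph phi t)).
{ intros t; apply (ext_val _ _ _ _ _ ext (sph phi t)). }
assert (eb : forall t, f (curve b t) = psi (sph t theta)).
{ intros t; apply (ext_val _ _ _ _ _ ext (sph t theta)). }
assert (d1 : forall t, is_derive (fun s => psi (sph phi s)) t (curve_d1 p a a' t)).
{ intros t; apply (is_derive_ext (fun s => f (curve a s))); [exact ea|]; now apply ext_curve_d1. }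
assert (d2 : forall t, is_derive (fun s => psi (sph s theta)) t (curve_d1 p b b' t)).
{ intros t; apply (is_derive_ext (fun s => f (curve b s))); [exact eb|]; now apply ext_curve_d1. }
unfold laplace_coord.
assert (E1 : Derive_n (fun t => psi (sph phi t)) 2 theta = curve_d2 p H a a' a'' theta).
{ apply (is_derive_n2 _ _ _ _ d1); now apply ext_curve_d2. }
assert (E2 : Derive_n (fun t => psi (sph t theta)) 2 phi = curve_d2 p H b b' b'' phi).
{ apply (is_derive_n2 _ _ _ _ d2); now apply ext_curve_d2. }
assert (E3 : Derive (fun t => psi (sph phi t)) theta = curve_d1 p a a' theta).
{ apply is_derive_unique, d1. }
rewrite E1, E2, E3.
unfold curve_d1, curve_d2, ext_lap, sum3.
change (curve a theta) with (proj1_sig (sph phi theta)).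
change (curve b phi) with (proj1_sig (sph phi theta)).
set (X := proj1_sig (sph phi theta)).
change (coord ax1 X) with (cos phi * cos theta); change (coord ax2 X) with (sin phi * cos theta);
change (coord ax3 X) with (sin theta).
unfold a', a'', b', b'', tan.
assert (s1 : sin phi * sin phi = 1 - cos phi * cos phi) by (generalize (cs2 phi); lra).
assert (s2 : sin theta * sin theta = 1 - cos theta * cos theta) by (generalize (cs2 theta); lra).
set (h11 := H ax1 ax1 X); set (h12 := H ax1 ax2 X); set (h13 := H ax1 ax3 X).
set (h21 := H ax2 ax1 X); set (h22 := H ax2 ax2 X); set (h23 := H ax2 ax3 X).
set (h31 := H ax3 ax1 X); set (h32 := H ax3 ax2 X); set (h33 := H ax3 ax3 X).
set (q1 := p ax1 X); set (q2 := p ax2 X); set (q3 := p ax3 X).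
set (c := cos phi) in *; set (s := sin phi) in *; set (C := cos theta) in *; set (S := sin theta) in *.
field_simplify_eq; [|exact hc].
assert (s1' : s ^ 2 = 1 - c ^ 2) by (simpl; lra).
assert (s2' : S ^ 2 = 1 - C ^ 2) by (simpl; lra).
clear - s1' s2'.
ring [s1' s2'].
Qed.

(** At the poles the coordinate formula is used only in a punctured neighbourhood, where
    it agrees with the continuous function [ext_lap]. *)
Lemma laplace_beltrami_ext (phi theta : R) :
  laplace_beltrami psi phi theta = ext_lap p H (proj1_sig (sph phi theta)).
Proof.
unfold laplace_beltrami; destruct (Req_EM_T (cos theta) 0) as [e|e]; [|now apply laplace_coord_ext].
set (g := fun t => ext_lap p H (proj1_sig (sph phi t))).
assert (hg : continuous g theta).
{ apply (continuous_sph_theta (fun X => ext_lap p H (proj1_sig X))), contS_ext_lap. }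
assert (hl : is_lim (laplace_coord psi phi) theta (g theta)).
{ apply (is_lim_ext_loc g).
  (* the zero of the cosine at the pole is isolated since its derivative is nonzero *)
  - assert (hs : sin theta <> 0) by (generalize (cs2 theta); rewrite e; nra).
    assert (hn := Rabs_pos_lt _ hs).
    destruct (proj1 (is_derive_eps cos theta (- sin theta)) (is_derive_cos theta) (Rabs (sin theta) / 2))
      as [d [pd hd]]; [lra|].
    exists (mkposreal d pd); intros t ht hne; symmetry; apply laplace_coord_ext; intros ct.
    generalize (hd t ht); rewrite ct, e.
    replace (0 - 0 - - sin theta * (t - theta)) with (sin theta * (t - theta)) by ring.
    rewrite Rabs_mult.
    assert (0 < Rabs (t - theta)) by (apply Rabs_pos_lt; lra); nra.
  - apply is_lim_continuity, continuity_pt_filterlim, hg. }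
rewrite (is_lim_unique _ _ _ hl); reflexivity.
Qed.


Lemma unif_ext (h : vec -> R) : (forall X, U X -> continuous h X) ->
  unif_at_0 (fun G k X t => h (curve (circ G k X) t)).
Proof.
intros hc; assert (cS := contS_ext h hc); split.
- destruct (contS_bounded _ cS) as [M [pM hM]]; exists M; split; [assumption|].
  intros G k X t; rewrite circ_rot; apply hM.
- intros eps he; destruct (contS_unif _ eps cS he) as [d [pd hd]].
  exists (d / 6); split; [lra|]; intros G k X t ht; rewrite !circ_rot; apply Rlt_le, hd.
  intros i; unfold sc; rewrite <- !circ_rot, !coord_curve; unfold circ.
  destruct (circle_bounds G k X i) as [b1 b2].
  set (a := coord i (mulv G (circle_c k X))) in *; set (b := coord i (mulv G (circle_s k X))) in *.
  replace (_ - _) with (a * (cos t - cos 0) + b * (sin t - sin 0)) by ring.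
  eapply Rle_lt_trans; [apply Rabs_triang|]; rewrite !Rabs_mult.
  generalize (cos_lip 0 t) (sin_lip 0 t); rewrite Rminus_0_r; intros q1 q2.
  generalize (Rabs_pos (cos t - cos 0)) (Rabs_pos (sin t - sin 0)) (Rabs_pos a) (Rabs_pos b); nra.
Qed.

Lemma curve_d2_unif :
  unif_at_0 (fun G k X t => curve_d2 p H (circ G k X) (circ1 G k X) (circ2 G k X) t).
Proof.
assert (hH : forall i j, unif_at_0 (fun G k X t => H i j (curve (circ G k X) t))).
{ intros i j; apply (unif_ext (H i j)); intros; now apply (ext_cont _ _ _ _ _ ext). }
assert (hp : forall i, unif_at_0 (fun G k X t => p i (curve (circ G k X) t))).
{ intros i; apply (unif_ext (p i)); intros; now apply ext_grad_continuous. }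
unfold curve_d2, sum3.
assert (hi : forall i, unif_at_0 (fun G k X t =>
  (H i ax1 (curve (circ G k X) t) * circ1 G k X ax1 t + H i ax2 (curve (circ G k X) t) * circ1 G k X ax2 t
   + H i ax3 (curve (circ G k X) t) * circ1 G k X ax3 t) * circ1 G k X i t
  + p i (curve (circ G k X) t) * circ2 G k X i t)).
{ intros i.
  refine (unif_plus _ _ (unif_mult _ _ (unif_plus _ _ (unif_plus _ _ (unif_mult _ _ (hH i ax1) (unif_circ1 ax1))
   (unif_mult _ _ (hH i ax2) (unif_circ1 ax2))) (unif_mult _ _ (hH i ax3) (unif_circ1 ax3))) (unif_circ1 i))
   (unif_mult _ _ (hp i) (unif_circ2 i))). }
exact (unif_plus _ _ (unif_plus _ _ (hi ax1) (hi ax2)) (hi ax3)).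
Qed.

Lemma curve_d2_sum (G : SO3) (X : S2) :
  sum3 (fun k => curve_d2 p H (circ G k X) (circ1 G k X) (circ2 G k X) 0)
  = ext_lap p H (proj1_sig (rot G X)).
Proof.
assert (e0 : forall k, curve (circ G k X) 0 = proj1_sig (rot G X)).
{ intros k; now rewrite circ_rot, axrot_0. }
assert (e1 : forall k i, circ1 G k X i 0 = coord i (mulv G (circle_s k X))).
{ intros; unfold circ1; rewrite cos_0, sin_0; ring. }
assert (e2 : forall k i, circ2 G k X i 0 = - coord i (mulv G (circle_c k X))).
{ intros; unfold circ2; rewrite cos_0, sin_0; ring. }
set (Z := proj1_sig (rot G X)) in *.
transitivity (sum3 (fun i => sum3 (fun j => H i j Z *
   sum3 (fun k => coord i (mulv G (circle_s k X)) * coord j (mulv G (circle_s k X)))))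
  - sum3 (fun i => p i Z * sum3 (fun k => coord i (mulv G (circle_c k X))))).
- unfold curve_d2, sum3; rewrite !e0, !e1, !e2; ring.
- assert (es := circle_s_sum G X); assert (ec := circle_c_sum G X).
  unfold sum3 in es, ec |- *; rewrite !es, !ec.
  unfold ext_lap, sum3, sc; fold Z; ring.
Qed.

Theorem ext_laplacian : laplacian psi (fun X => ext_lap p H (proj1_sig X)).
Proof.
split; [|split; [apply contS_ext_lap|]].
{ replace psi with (fun X : S2 => f (proj1_sig X)).
  - apply contS_ext; intros X hX; apply (partials_continuous U f p); auto.
    + apply (ext_open _ _ _ _ _ ext).
    + apply (ext_grad _ _ _ _ _ ext).
    + intros i; now apply ext_grad_continuous.
  - apply functional_extensionality; intros X; apply (ext_val _ _ _ _ _ ext). }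
intros eps he; destruct curve_d2_unif as [_ hu].
destruct (hu (eps / 6)) as [d [pd hd]]; [lra|].
exists d; split; [assumption|]; intros G t X ht.
rewrite <- curve_d2_sum.
assert (hk : forall k, Rabs (second_diff t (fun Y => psi (rot G Y)) k X
   - t * t * curve_d2 p H (circ G k X) (circ1 G k X) (circ2 G k X) 0) <= 2 * (eps / 6) * (t * t)).
{ intros k.
  assert (Uc : forall s, U (curve (circ G k X) s)).
  { intros s; rewrite circ_rot; apply (ext_sphere _ _ _ _ _ ext). }
  assert (ev : forall s, f (curve (circ G k X) s) = psi (rot G (rot (axrot k s) X))).
  { intros s; rewrite circ_rot; apply (ext_val _ _ _ _ _ ext). }
  unfold second_diff; rewrite <- (axrot_0 k X) at 3; rewrite <- !ev.
  apply (second_difference_bound (fun s => f (curve (circ G k X) s)) (curve_d1 p (circ G k X) (circ1 G k X))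
    (curve_d2 p H (circ G k X) (circ1 G k X) (circ2 G k X)) d); [| |intros; now apply hd|exact ht].
  - intros s; apply ext_curve_d1; [apply Uc|intros; apply circ_d1].
  - intros s; apply ext_curve_d2; [apply Uc|intros; apply circ_d1|intros; apply circ_d2]. }
unfold rot_diff, sum3.
replace (_ - _) with
 ((second_diff t (fun Y => psi (rot G Y)) ax1 X
   - t * t * curve_d2 p H (circ G ax1 X) (circ1 G ax1 X) (circ2 G ax1 X) 0)
  + (second_diff t (fun Y => psi (rot G Y)) ax2 X
   - t * t * curve_d2 p H (circ G ax2 X) (circ1 G ax2 X) (circ2 G ax2 X) 0)
  + (second_diff t (fun Y => psi (rot G Y)) ax3 X
   - t * t * curve_d2 p H (circ G ax3 X) (circ1 G ax3 X) (circ2 G ax3 X) 0)) by ring.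
eapply Rle_trans; [apply Rabs_triang|].
eapply Rle_trans; [apply Rplus_le_compat_r, Rabs_triang|].
generalize (hk ax1) (hk ax2) (hk ax3); lra.
Qed.

End Extension.

Lemma laplacian_pole_ker (n : nat) :
  laplacian (fun Y => affinity pole Y ^ n) (fun Y => zonal_lap n (affinity pole Y)).
Proof.
set (u := fun X : vec => (1 + pz X) / 2).
assert (hu : forall X, u (proj1_sig X) = affinity pole X).
{ intros X; unfold u, affinity; rewrite pole_coord; unfold dot, px, py, pz; simpl; field. }
set (p := fun i X => match i with ax3 => INR n / 2 * u X ^ pred n | _ => 0 end).
set (H := fun i j X => match i, j with ax3, ax3 => INR n / 2 * (INR (pred n) / 2 * u X ^ pred (pred n)) | _, _ => 0 end).
assert (cont : forall i j X, continuous (H i j) X).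
{ intros i j X; destruct i, j; try apply continuous_const.
  apply (continuous_comp (fun X : vec => pz X)
    (fun z => INR n / 2 * (INR (pred n) / 2 * ((1 + z) / 2) ^ pred (pred n)))).
  - apply continuous_snd.
  - apply (ex_derive_continuous (V := R_NormedModule)); auto_derive; trivial. }
destruct (C2_sphere_of_partials (fun Y => affinity pole Y ^ n) (fun X => u X ^ n) p H) as [_ e]; auto.
- intros X; now rewrite hu.
- intros X i _; destruct i; [exact (is_derive_const (u X ^ n) _)|exact (is_derive_const (u X ^ n) _)|].
  unfold u, p; cbn [upd coord]; unfold pz; cbn [snd]; cbv beta iota; auto_derive; trivial.
  unfold u, pz, Rdiv; ring.
- intros i X j _; destruct i, j; try exact (is_derive_const 0 _);
   try exact (is_derive_const (p ax3 X) _).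
  unfold p, H, u; cbn [upd coord]; unfold pz; cbn [snd]; cbv beta iota; auto_derive; trivial.
  unfold u, pz, Rdiv; ring.
- generalize (ext_laplacian _ _ _ _ _ e).
  replace (fun X : S2 => ext_lap p H (proj1_sig X)) with (fun Y => zonal_lap n (affinity pole Y)); [trivial|].
  apply functional_extensionality; intros X.
  unfold ext_lap, sum3, p, H, zonal_lap; rewrite hu.
  assert (hz : coord ax3 (proj1_sig X) = 2 * affinity pole X - 1) by (rewrite <- hu; unfold u, coord; field).
  rewrite hz; destruct n as [|[|m]]; simpl pred; [simpl; field|simpl; field|].
  rewrite !S_INR; simpl pow; field.
Qed.

(** * Spectral gap *)

Lemma rot_pole (G : SO3) : proj1_sig (rot G pole) = col3 G.
Proof.
apply vec_eq; intros i; change (sc i (rot G pole) = coord i (col3 G)); rewrite sc_rot.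
unfold sc; rewrite pole_coord; unfold coord at 2 4 6, px, py, pz; simpl; ring.
Qed.

Lemma affinity_from_pole (X : S2) :
  exists H, forall Y, affinity X Y = affinity pole (rot H Y).
Proof.
destruct (pole_moves X) as [G hG]; exists (trSO3 G); intros Y.
rewrite <- affinity_rot; f_equal; apply S2_eq; now rewrite rot_pole.
Qed.

Lemma laplacian_ker (n : nat) (X : S2) :
  laplacian (fun Y => affinity X Y ^ n) (fun Y => zonal_lap n (affinity X Y)).
Proof.
destruct (affinity_from_pole X) as [H hH].
generalize (laplacian_rot H _ _ (laplacian_pole_ker n)).
replace (fun Y => affinity X Y ^ n) with (fun Y => affinity pole (rot H Y) ^ n)
  by (apply functional_extensionality; intros; now rewrite hH).
replace (fun Y => zonal_lap n (affinity X Y)) with (fun Y => zonal_lap n (affinity pole (rot H Y)))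
  by (apply functional_extensionality; intros; now rewrite hH).
trivial.
Qed.

(** What the Laplacian of [Kop n f] must be, from that of the kernel. *)
Definition Kop_lap (n : nat) (f : S2 -> R) (X : S2) : R :=
  INR n * INR n * Kop (pred n) f X - INR n * (INR n + 1) * Kop n f X.

Lemma surf_zonal_lap_mult (n : nat) (f : S2 -> R) (X : S2) : contS f ->
  surf (fun Y => f Y * zonal_lap n (affinity X Y)) = Kop_lap n f X.
Proof.
intros hf; unfold Kop_lap, Kop.
rewrite <- !surf_scal, <- surf_minus; contK.
apply surf_ext; intros Y; unfold zonal_lap; ring.
Qed.

Lemma Kop_laplacian_comm (n : nat) (w L : S2 -> R) (X : S2) : laplacian w L ->
  Kop n L X = Kop_lap n w X.
Proof.
intros h; unfold Kop; rewrite (green _ _ _ _ (laplacian_ker n X) h).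
apply surf_zonal_lap_mult, h.
Qed.

Lemma laplacian_Kop (n : nat) (w : S2 -> R) : contS w -> laplacian (Kop n w) (Kop_lap n w).
Proof.
intros hw; assert (hpi := PI_RGT_0).
assert (hK := contS_Kop n w hw); assert (hK' := contS_Kop (pred n) w hw).
split; [assumption|split].
{ unfold Kop_lap; apply contS_minus; apply contS_mult; assumption || apply contS_const. }
intros eps he.
destruct (contS_bounded w hw) as [M [pM hM]].
set (e := eps / (2 * PI * PI * M)).
assert (pe : 0 < e) by (apply Rdiv_lt_0_compat; [lra|]; apply Rmult_lt_0_compat; nra).
destruct (laplacian_pole_ker n) as [_ [_ hl]].
destruct (hl e pe) as [d [pd hd]].
exists d; split; [assumption|]; intros G t X ht.
assert (hY : forall Y, Rabs (rot_diff t (fun Z => affinity (rot G Z) Y ^ n) X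
    - t * t * zonal_lap n (affinity (rot G X) Y)) <= e * (t * t)).
{ intros Y; destruct (affinity_from_pole Y) as [H hH].
  generalize (hd (mulSO3 H G) t X ht); rewrite rot_mulSO3, <- hH, affinity_sym.
  replace (fun Z => affinity (rot G Z) Y ^ n) with (fun Z => affinity pole (rot (mulSO3 H G) Z) ^ n); [trivial|].
  apply functional_extensionality; intros Z; now rewrite rot_mulSO3, <- hH, affinity_sym. }
assert (hker : forall H, contS (fun Y => affinity (rot G (rot H X)) Y ^ n * w Y)).
{ intros H; now apply contS_ker_mult. }
assert (hker0 : contS (fun Y => affinity (rot G X) Y ^ n * w Y)) by now apply contS_ker_mult.
assert (hsd : forall i, contS (fun Y => second_diff t (fun Z => affinity (rot G Z) Y ^ n) i X * w Y)).
{ intros i; unfold second_diff; contK. }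
assert (e1 : rot_diff t (fun Z => Kop n w (rot G Z)) X =
  surf (fun Y => rot_diff t (fun Z => affinity (rot G Z) Y ^ n) X * w Y)).
{ unfold rot_diff at 2.
  rewrite (surf_ext _ (fun Y => sum3 (fun i => second_diff t (fun Z => affinity (rot G Z) Y ^ n) i X * w Y)))
   by (intros; unfold sum3; ring).
  rewrite (surf_sum3 (fun i Y => second_diff t (fun Z => affinity (rot G Z) Y ^ n) i X * w Y)) by assumption.
  assert (ei : forall i, second_diff t (fun Z => Kop n w (rot G Z)) i X
     = surf (fun Y => second_diff t (fun Z => affinity (rot G Z) Y ^ n) i X * w Y)).
  { intros i; unfold second_diff, Kop.
    rewrite <- surf_scal, <- surf_plus, <- surf_minus; contK.
    apply surf_ext; intros; ring. }
  unfold rot_diff, sum3; now rewrite !ei. }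
rewrite e1, <- surf_zonal_lap_mult by assumption.
assert (hz : contS (fun Y => zonal_lap n (affinity (rot G X) Y))) by (unfold zonal_lap; contK).
assert (hrd : contS (fun Y => rot_diff t (fun Z => affinity (rot G Z) Y ^ n) X)).
{ unfold rot_diff, second_diff; contK. }
rewrite <- surf_scal by contS_tac.
replace (eps * (t * t)) with (2 * PI * PI * ((e * (t * t)) * M)) by (unfold e; field; lra).
apply surf_dist; contS_tac.
intros Y; replace (_ - _) with ((rot_diff t (fun Z => affinity (rot G Z) Y ^ n) X
    - t * t * zonal_lap n (affinity (rot G X) Y)) * w Y) by ring.
rewrite Rabs_mult; apply Rmult_le_compat; auto using Rabs_pos.
Qed.

(** Sums of eigenfunctions of the eigenvalues [-j(j+1)] with [N <= j < k], at most
    one for each level, together with their Laplacians. *)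
Inductive band (N : nat) : nat -> (S2 -> R) -> (S2 -> R) -> Prop :=
| band_nil k : band N k (fun _ => 0) (fun _ => 0)
| band_cons k v Lv h : band N k v Lv -> (N <= k)%nat ->
    laplacian h (fun X => - (INR k * (INR k + 1)) * h X) ->
    band N (S k) (fun X => v X + h X) (fun X => Lv X + - (INR k * (INR k + 1)) * h X).

Lemma band_laplacian (N k : nat) (v Lv : S2 -> R) : band N k v Lv -> laplacian v Lv.
Proof.
intros b; induction b as [k|k v Lv h b IH hk hh].
- apply laplacian_const.
- now apply laplacian_plus.
Qed.

Lemma level_lt (k n : nat) : (k < n)%nat -> INR k * (INR k + 1) < INR n * (INR n + 1).
Proof. intros h; apply lt_INR in h; generalize (pos_INR k); nra. Qed.

(** Green's identity, with two different eigenvalues. *)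
Lemma eigen_orth (j k : nat) (g h : S2 -> R) : (j < k)%nat ->
  laplacian g (fun X => - (INR j * (INR j + 1)) * g X) ->
  laplacian h (fun X => - (INR k * (INR k + 1)) * h X) ->
  surf (fun X => g X * h X) = 0.
Proof.
intros hjk hg hh; generalize (green _ _ _ _ hg hh) (level_lt j k hjk).
destruct hg as [cg _], hh as [ch _].
rewrite (surf_ext _ (fun X => - (INR k * (INR k + 1)) * (g X * h X))) by (intros; ring).
rewrite (surf_ext (fun X => h X * _) (fun X => - (INR j * (INR j + 1)) * (g X * h X))) by (intros; ring).
rewrite !surf_scal by contS_tac.
intros; nra.
Qed.

Lemma band_orth (N k j : nat) (v Lv h : S2 -> R) : band N k v Lv -> (k <= j)%nat ->
  laplacian h (fun X => - (INR j * (INR j + 1)) * h X) -> surf (fun X => v X * h X) = 0.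
Proof.
intros b; induction b as [k|k v Lv g b IH hk hg]; intros hj hh.
- rewrite (surf_ext _ (fun _ => 0)), surf_const by (intros; ring); ring.
- assert (cv := proj1 (band_laplacian _ _ _ _ b)); assert (ch := proj1 hh); assert (cg := proj1 hg).
  rewrite (surf_ext _ (fun X => v X * h X + g X * h X)) by (intros; ring).
  rewrite surf_plus, IH, (eigen_orth k j g h); contS_tac; trivial; try lia; ring.
Qed.

Lemma band_energy (N k : nat) (v Lv : S2 -> R) : band N k v Lv ->
  INR N * (INR N + 1) * surf (fun X => v X * v X) <= - surf (fun X => v X * Lv X).
Proof.
intros b; induction b as [k|k v Lv h b IH hk hh].
- rewrite (surf_ext _ (fun _ => 0)), surf_const by (intros; ring); lra.
- assert (lv := band_laplacian _ _ _ _ b).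
  assert (cv := proj1 lv); assert (cLv := proj1 (proj2 lv)); assert (ch := proj1 hh).
  assert (o := band_orth _ _ k _ _ _ b (le_n k) hh).
  set (c := INR k * (INR k + 1)) in *.
  assert (e1 : surf (fun X => (v X + h X) * (v X + h X)) =
    surf (fun X => v X * v X) + surf (fun X => h X * h X)).
  { rewrite (surf_ext _ (fun X => (v X * v X + h X * h X) + 2 * (v X * h X))) by (intros; ring).
    rewrite !surf_plus, surf_scal, o; contS_tac; ring. }
  assert (o' : surf (fun X => h X * Lv X) = 0).
  { rewrite (green _ _ _ _ hh lv).
    rewrite (surf_ext _ (fun X => - c * (v X * h X))) by (intros; ring).
    rewrite surf_scal, o; contS_tac; ring. }
  assert (e2 : surf (fun X => (v X + h X) * (Lv X + - c * h X)) =
    surf (fun X => v X * Lv X) - c * surf (fun X => h X * h X)).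
  { rewrite (surf_ext _ (fun X => (v X * Lv X + h X * Lv X) + (- c * (v X * h X) + - c * (h X * h X))))
      by (intros; ring).
    rewrite !surf_plus, !surf_scal, o, o'; contS_tac; ring. }
  rewrite e1, e2.
  assert (hp : 0 <= surf (fun X => h X * h X)).
  { replace 0 with (surf (fun _ => 0)) by (rewrite surf_const; ring).
    apply surf_le; contS_tac; intros; nra. }
  assert (hc : INR N * (INR N + 1) <= c).
  { unfold c; apply le_INR in hk; generalize (pos_INR N); nra. }
  nra.
Qed.

(** Below level [n], the operator [Lap + n(n+1)] is invertible: it multiplies each
    eigenfunction by a nonzero number. *)
Lemma band_resolvent (c : R) (n N k : nat) (v Lv : S2 -> R) : band N k v Lv -> (k <= n)%nat ->
  exists v' Lv', band N k v' Lv' /\ forall X, Lv' X + INR n * (INR n + 1) * v' X = c * v X.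
Proof.
intros b; induction b as [k|k v Lv h b IH hk hh]; intros hn.
- exists (fun _ => 0), (fun _ => 0); split; [constructor|intros; ring].
- destruct IH as [v' [Lv' [b' hv']]]; [lia|].
  assert (hl := level_lt k n hn).
  set (q := c / (INR n * (INR n + 1) - INR k * (INR k + 1))).
  exists (fun X => v' X + q * h X), (fun X => Lv' X + - (INR k * (INR k + 1)) * (q * h X)).
  split.
  + apply (band_cons N k v' Lv' (fun X => q * h X)); [assumption|assumption|].
    replace (fun X => - (INR k * (INR k + 1)) * (q * h X)) with
     (fun X => q * (- (INR k * (INR k + 1)) * h X))
     by (apply functional_extensionality; intros; ring).
    now apply laplacian_scal.
  + intros X; replace (c * (v X + h X)) with (c * v X + c * h X) by ring; rewrite <- hv'.
    assert (hq : c = q * (INR n * (INR n + 1) - INR k * (INR k + 1))) by (unfold q; field; lra).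
    rewrite hq; ring.
Qed.

(** The recursion [(Lap + n(n+1)) Kop n w = n^2 Kop (n-1) w] decomposes [Kop n w] into
    eigenfunctions, one new eigenvalue at a time. *)
Lemma Kop_band (N n : nat) (w : S2 -> R) : contS w ->
  (forall j X, (j < N)%nat -> Kop j w X = 0) -> band N (S n) (Kop n w) (Kop_lap n w).
Proof.
intros cw h0; revert n; fix IH 1; intros n.
assert (hz : (n < N)%nat -> band N (S n) (Kop n w) (Kop_lap n w)).
{ intros hn.
  replace (Kop n w) with (fun _ : S2 => 0).
  2:{ apply functional_extensionality; intros; now rewrite h0. }
  replace (Kop_lap n w) with (fun _ : S2 => 0); [constructor|].
  apply functional_extensionality; intros; unfold Kop_lap; rewrite !h0 by lia; ring. }
destruct (Compare_dec.le_lt_dec N n) as [hN|hN]; [|now apply hz].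
assert (hr : exists v' Lv', band N n v' Lv' /\
   forall X, Lv' X + INR n * (INR n + 1) * v' X = INR n * INR n * Kop (pred n) w X).
{ destruct n as [|m].
  - exists (fun _ => 0), (fun _ => 0); split; [constructor|intros; simpl; ring].
  - exact (band_resolvent _ (S m) _ _ _ _ (IH m) (le_n _)). }
clear IH hz.
destruct hr as [v' [Lv' [b hv]]].
assert (hh : laplacian (fun X => Kop n w X - v' X) (fun X => - (INR n * (INR n + 1)) * (Kop n w X - v' X))).
{ replace (fun X => - (INR n * (INR n + 1)) * (Kop n w X - v' X))
    with (fun X => Kop_lap n w X - Lv' X).
  - apply laplacian_minus; [now apply laplacian_Kop|now apply (band_laplacian N n)].
  - apply functional_extensionality; intros X; unfold Kop_lap; generalize (hv X); lra. }
generalize (band_cons N n v' Lv' _ b hN hh).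
replace (fun X => v' X + (Kop n w X - v' X)) with (Kop n w)
  by (apply functional_extensionality; intros; ring).
replace (fun X => Lv' X + - (INR n * (INR n + 1)) * (Kop n w X - v' X)) with (Kop_lap n w); [trivial|].
apply functional_extensionality; intros X; unfold Kop_lap; generalize (hv X); lra.
Qed.

(** [w] is the uniform limit of multiples of [Kop n w], whose Laplacians are multiples of
    [Kop n L] and converge to [L]. *)
Theorem spectral_gap (N : nat) (w L : S2 -> R) : laplacian w L ->
  (forall j X, (j < N)%nat -> Kop j w X = 0) ->
  INR N * (INR N + 1) * surf (fun X => w X * w X) <= - surf (fun X => w X * L X).
Proof.
intros hw h0; assert (hpi := PI_RGT_0).
assert (cw := proj1 hw); assert (cL := proj1 (proj2 hw)).
destruct (contS_bounded w cw) as [M1 [p1 h1]]; destruct (contS_bounded L cL) as [M2 [p2 h2]].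
set (mu := INR N * (INR N + 1)).
assert (hmu : 0 <= mu) by (unfold mu; generalize (pos_INR N); nra).
set (q := fun (f g : S2 -> R) (X : S2) => - (f X * g X) - mu * (f X * f X)).
assert (cq : forall f g, contS f -> contS g -> contS (q f g)) by (intros; unfold q; contS_tac).
assert (sq : forall f g, contS f -> contS g ->
  surf (q f g) = - surf (fun X => f X * g X) - mu * surf (fun X => f X * f X)).
{ intros f g hf hg; unfold q.
  rewrite (surf_ext _ (fun X => (-1) * (f X * g X) - mu * (f X * f X))) by (intros; ring).
  rewrite surf_minus, !surf_scal; contS_tac; ring. }
assert (goal : 0 <= surf (q w L)); [|rewrite sq in goal by assumption; lra].
apply Ropp_le_cancel; rewrite Ropp_0; apply le_epsilon; intros eps he; rewrite Rplus_0_l.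
set (C := M1 + M2 + 1 + mu * (2 * M1 + 1)).
assert (pC : 0 < C) by (unfold C; nra).
set (e := Rmin 1 (eps / (2 * PI * PI * C))).
assert (pd : 0 < 2 * PI * PI * C) by (apply Rmult_lt_0_compat; nra).
assert (pe : 0 < e) by (apply Rmin_pos; [lra|]; apply Rdiv_lt_0_compat; lra).
assert (e1 : e <= 1) by apply Rmin_l.
assert (e2 : 2 * PI * PI * (C * e) <= eps).
{ replace eps with ((2 * PI * PI * C) * (eps / (2 * PI * PI * C))) by (field; lra).
  rewrite <- Rmult_assoc; apply Rmult_le_compat_l; [lra|apply Rmin_r]. }
destruct (Kop_approx w e cw pe) as [n1 k1]; destruct (Kop_approx L e cL pe) as [n2 k2].
set (n := Nat.max n1 n2); set (c := (INR n + 1) / (4 * PI)).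
specialize (k1 n); specialize (k2 n).
assert (a1 : forall X, Rabs (c * Kop n w X - w X) <= e) by (intros; apply k1; unfold n; lia).
assert (a2 : forall X, Rabs (c * Kop n L X - L X) <= e) by (intros; apply k2; unfold n; lia).
clear k1 k2.
assert (cK := contS_Kop n w cw); assert (cKL := contS_Kop n L cL).
set (v := fun X => c * Kop n w X) in *; set (l := fun X => c * Kop n L X) in *.
assert (cv : contS v) by (apply contS_mult; assumption || apply contS_const).
assert (cl : contS l) by (apply contS_mult; assumption || apply contS_const).
assert (pos : 0 <= surf (q v l)).
{ rewrite sq by assumption.
  generalize (band_energy _ _ _ _ (Kop_band N n w cw h0)); fold mu; intros en.
  assert (cKl : contS (Kop_lap n w)) by (apply (laplacian_Kop n w cw)).
  rewrite (surf_ext (fun X => v X * l X) (fun X => (c * c) * (Kop n w X * Kop_lap n w X))).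
  2:{ intros X; unfold v, l; rewrite (Kop_laplacian_comm n w L X hw); ring. }
  rewrite (surf_ext (fun X => v X * v X) (fun X => (c * c) * (Kop n w X * Kop n w X))).
  2:{ intros X; unfold v; ring. }
  rewrite !surf_scal; [|apply contS_mult; assumption|apply contS_mult; assumption].
  assert (0 <= c * c) by nra; nra. }
assert (d : Rabs (surf (q v l) - surf (q w L)) <= 2 * PI * PI * (C * e)).
{ apply surf_dist; auto.
  intros X; specialize (a1 X); specialize (a2 X); specialize (h1 X); specialize (h2 X).
  change (c * Kop n w X) with (v X) in a1; change (c * Kop n L X) with (l X) in a2.
  unfold q; set (x := v X - w X) in *; set (y := l X - L X) in *.
  replace (v X) with (w X + x) by (unfold x; ring); replace (l X) with (L X + y) by (unfold y; ring).
  apply Rabs_le_between in a1; apply Rabs_le_between in a2.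
  apply Rabs_le_between in h1; apply Rabs_le_between in h2.
  assert (prod : forall a b A B, - A <= a <= A -> - B <= b <= B -> - (A * B) <= a * b <= A * B).
  { intros a b A B ha hb; split; nra. }
  assert (b1 := prod _ _ _ _ h1 a2); assert (b2 := prod _ _ _ _ h2 a1).
  assert (b3 := prod _ _ _ _ a1 a2); assert (b4 := prod _ _ _ _ h1 a1); assert (b5 := prod _ _ _ _ a1 a1).
  assert (e3 : e * e <= e) by nra.
  assert (b6 : - ((2 * M1 + 1) * e) <= 2 * (w X * x) + x * x <= (2 * M1 + 1) * e) by nra.
  assert (b7 : - mu * ((2 * M1 + 1) * e) <= mu * (2 * (w X * x) + x * x) <= mu * ((2 * M1 + 1) * e)) by nra.
  replace (_ - _) with (- (w X * y + L X * x + x * y) - mu * (2 * (w X * x) + x * x)) by ring.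
  unfold C; apply Rabs_le; nra. }
apply Rabs_le_between in d; lra.
Qed.


Lemma C2_laplacian (psi : S2 -> R) : C2_sphere psi ->
  exists L, laplacian psi L /\ forall phi theta, laplace_beltrami psi phi theta = L (sph phi theta).
Proof.
intros h; destruct (C2_sphere_extension psi h) as [U [f [p [H e]]]].
exists (fun X => ext_lap p H (proj1_sig X)); split.
- exact (ext_laplacian psi U f p H e).
- intros; apply (laplace_beltrami_ext psi U f p H e).
Qed.

Lemma laplacian_of_coordinates (psi L : S2 -> R) : C2_sphere psi ->
  (forall phi theta, is_latitude theta -> laplace_beltrami psi phi theta = L (sph phi theta)) ->
  laplacian psi L.
Proof.
intros h e; destruct (C2_laplacian psi h) as [L' [hL hl]].
replace L with L'; [assumption|].
apply functional_extensionality; intros X; destruct (sph_surj X) as [phi [theta [_ [ht ->]]]].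
rewrite <- hl, <- e; trivial.
Qed.

Lemma solution_laplacian (F : R -> R) (omega : R) (psi : S2 -> R) :
  classical_solution F omega psi -> laplacian psi (fun X => F (psi X) - 2 * omega * sc ax3 X).
Proof. intros [h e]; now apply laplacian_of_coordinates. Qed.

Lemma eigenspace_laplacian (j : nat) (Y : S2 -> R) : eigenspace j Y ->
  laplacian Y (fun X => - (INR j * (INR j + 1)) * Y X).
Proof. intros [h e]; now apply laplacian_of_coordinates. Qed.

(** * Quadratic polynomials on the sphere *)

Definition lin (l : axis -> R) (X : vec) : R := sum3 (fun i => l i * coord i X).

Definition qform (a b c d e g : R) (X : vec) : R :=
  a * (px X * px X) + b * (py X * py X) + c * (pz X * pz X)
  + d * (px X * py X) + e * (px X * pz X) + g * (py X * pz X).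

Lemma quadratic_laplacian (l : axis -> R) (a b c d e g : R) : a + b + c = 0 ->
  let q := fun X : S2 => lin l (proj1_sig X) + qform a b c d e g (proj1_sig X) in
  C2_sphere q /\ forall phi theta, laplace_beltrami q phi theta =
    -2 * lin l (proj1_sig (sph phi theta)) - 6 * qform a b c d e g (proj1_sig (sph phi theta)).
Proof.
intros htr q.
set (p := fun i X => match i with
  | ax1 => l ax1 + 2 * a * px X + d * py X + e * pz X
  | ax2 => l ax2 + 2 * b * py X + d * px X + g * pz X
  | ax3 => l ax3 + 2 * c * pz X + e * px X + g * py X end).
set (H := fun (i j : axis) (X : vec) => match i, j with
  | ax1, ax1 => 2 * a | ax2, ax2 => 2 * b | ax3, ax3 => 2 * c
  | ax1, ax2 | ax2, ax1 => d | ax1, ax3 | ax3, ax1 => e | ax2, ax3 | ax3, ax2 => g end).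
destruct (C2_sphere_of_partials q (fun X => lin l X + qform a b c d e g X) p H) as [hC hE].
- reflexivity.
- intros X i _; destruct X as [[x y] z].
  unfold lin, qform, sum3, p; destruct i; cbn [upd coord]; unfold coord, px, py, pz; cbn [fst snd];
  auto_derive; trivial; ring.
- intros i X j _; destruct X as [[x y] z].
  unfold p, H; destruct i, j; cbn [upd coord]; unfold px, py, pz; cbn [fst snd];
  auto_derive; trivial; ring.
- intros i j X; unfold H; destruct i, j; apply continuous_const.
- split; [exact hC|]; intros phi theta; rewrite (laplace_beltrami_ext _ _ _ _ _ hE).
  generalize (proj2_sig (sph phi theta)); set (X := proj1_sig (sph phi theta)).
  unfold ext_lap, sum3, p, H, lin, qform, sum3, dot, coord.
  generalize (px X) (py X) (pz X); intros x y z hX.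
  transitivity (2 * (a + b + c) - 2 * (l ax1 * x + l ax2 * y + l ax3 * z)
    - 6 * (a * (x * x) + b * (y * y) + c * (z * z) + d * (x * y) + e * (x * z) + g * (y * z))); [ring|].
  rewrite htr; ring.
Qed.

Lemma laplacian_sc (i : axis) : laplacian (sc i) (fun X => -2 * sc i X).
Proof.
set (l := fun j => match i, j with ax1, ax1 | ax2, ax2 | ax3, ax3 => 1 | _, _ => 0 end).
destruct (quadratic_laplacian l 0 0 0 0 0 0) as [hC hl]; [ring|].
assert (e : forall X : S2, lin l (proj1_sig X) = sc i X).
{ intros X; unfold lin, sum3, l, sc; destruct i; ring. }
replace (sc i) with (fun X : S2 => lin l (proj1_sig X) + qform 0 0 0 0 0 0 (proj1_sig X)).
2:{ apply functional_extensionality; intros X; rewrite e; unfold qform; ring. }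
apply laplacian_of_coordinates; [exact hC|].
intros phi theta _; rewrite hl; unfold qform; ring.
Qed.

Lemma sin_lat_eigenspace (alpha : R) : eigenspace 1 (fun X => alpha * sin_lat X).
Proof.
destruct (quadratic_laplacian (fun j => match j with ax3 => alpha | _ => 0 end) 0 0 0 0 0 0)
  as [hC hl]; [ring|].
replace (fun X => alpha * sin_lat X) with (fun X : S2 =>
  lin (fun j => match j with ax3 => alpha | _ => 0 end) (proj1_sig X) + qform 0 0 0 0 0 0 (proj1_sig X)).
2:{ apply functional_extensionality; intros X; unfold lin, qform, sum3, sin_lat; simpl; ring. }
split; [exact hC|]; intros phi theta _; rewrite hl; unfold qform; simpl INR; ring.
Qed.

(** * First moments *)

Lemma Kop_0 (f : S2 -> R) (X : S2) : Kop 0 f X = surf f.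
Proof. unfold Kop; apply surf_ext; intros; simpl; ring. Qed.

Lemma Kop_1 (f : S2 -> R) (X : S2) : contS f ->
  Kop 1 f X = / 2 * (surf f + sum3 (fun i => sc i X * surf (fun Y => sc i Y * f Y))).
Proof. intros hf; rewrite Kop_S by assumption; unfold sum3; now rewrite !Kop_0. Qed.

(** [Kop 0] and [Kop 1] only see the mean and the first moments. *)
Lemma Kop_below_2 (f : S2 -> R) : contS f -> surf f = 0 ->
  (forall i, surf (fun Y => sc i Y * f Y) = 0) -> forall j X, (j < 2)%nat -> Kop j f X = 0.
Proof.
intros hf h0 h1 j X hj; destruct j as [|[|j]]; [now rewrite Kop_0| |lia].
rewrite Kop_1 by assumption; unfold sum3; rewrite h0, !h1; ring.
Qed.

(** * Rigidity *)

(** Two solutions whose difference [w] has no component of degree below [N] agree when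
    [F' > -N(N+1)]: the spectral gap bounds the integral of [w Lap w + N(N+1) w^2] above
    by zero, and [Lap w] is a difference of values of [F], so the mean value theorem makes
    the integrand positive wherever [w] is not zero. *)
Lemma rigidity (N : nat) (F : R -> R) (g psi1 psi2 : S2 -> R) :
  (forall s, ex_derive F s) -> (forall s, Derive F s > - (INR N * (INR N + 1))) ->
  laplacian psi1 (fun X => F (psi1 X) - g X) -> laplacian psi2 (fun X => F (psi2 X) - g X) ->
  (forall j X, (j < N)%nat -> Kop j (fun Y => psi1 Y - psi2 Y) X = 0) ->
  forall X, psi1 X = psi2 X.
Proof.
intros dF hF l1 l2 h0.
assert (l := laplacian_minus _ _ _ _ l1 l2).
assert (gap := spectral_gap N _ _ l h0).
set (mu := INR N * (INR N + 1)) in *.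
set (w := fun X => psi1 X - psi2 X) in *.
set (L := fun X => F (psi1 X) - g X - (F (psi2 X) - g X)) in *.
assert (cw : contS w) by apply l; assert (cL : contS L) by apply l.
assert (mvt : forall X, exists s, L X = Derive F s * w X).
{ intros X; destruct (MVT_gen F (psi2 X) (psi1 X) (Derive F)) as [s [_ e]].
  - intros; apply Derive_correct, dF.
  - intros; apply continuity_pt_filterlim, (ex_derive_continuous (V := R_NormedModule)), dF.
  - exists s; unfold L, w; lra. }
assert (hz : forall X, mu * (w X * w X) + w X * L X = 0).
{ apply surf_eq_0; [contS_tac| |].
  - intros X; destruct (mvt X) as [s ->]; generalize (hF s).
    replace (mu * (w X * w X) + w X * (Derive F s * w X)) with ((Derive F s + mu) * (w X * w X)) by ring.
    intros; apply Rmult_le_pos; [lra|nra].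
  - rewrite surf_plus, surf_scal; contS_tac; lra. }
intros X; generalize (hz X); destruct (mvt X) as [s ->]; generalize (hF s); intros hs e.
assert (e' : (Derive F s + mu) * (w X * w X) = 0) by lra.
apply Rmult_integral in e'; destruct e' as [e'|e']; [lra|].
assert (w X = 0) by (apply Rsqr_0_uniq; exact e'); unfold w in *; lra.
Qed.

Lemma sph_axrot (phi theta : R) : sph phi theta = rot (axrot ax3 phi) (sph 0 theta).
Proof.
apply S2_eq, vec_eq; intros i; destruct i; unfold rot, mulv, sph, coord, px, py, pz; simpl;
 rewrite ?cos_0, ?sin_0; ring.
Qed.

Lemma zonal_of_invariant (psi : S2 -> R) :
  (forall t X, psi (rot (axrot ax3 t) X) = psi X) -> zonal psi.
Proof.
intros h; exists (fun theta => psi (sph 0 theta)); intros phi theta _; now rewrite sph_axrot, h.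
Qed.

(** Here [psi] is compared with all its rotated copies; the difference always has mean
    zero by invariance of the integral. *)
Lemma constant_of_gap (F : R -> R) (psi : S2 -> R) :
  (forall s, ex_derive F s) -> (forall s, Derive F s > -2) ->
  laplacian psi (fun X => F (psi X)) -> constant_on_sphere psi.
Proof.
intros dF hF hl; exists (psi pole); intros X.
destruct (pole_moves X) as [G hG].
replace X with (rot G pole) by (apply S2_eq; now rewrite rot_pole).
apply (rigidity 1 F (fun _ => 0) (fun Y => psi (rot G Y)) psi); trivial.
- intros s; simpl INR; generalize (hF s); lra.
- replace (fun X => F (psi (rot G X)) - 0) with (fun X => F (psi (rot G X)))
    by (apply functional_extensionality; intros; ring).
  exact (laplacian_rot G _ _ hl).
- replace (fun X => F (psi X) - 0) with (fun X => F (psi X))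
    by (apply functional_extensionality; intros; ring).
  exact hl.
- intros j Z hj; replace j with 0%nat by lia; rewrite Kop_0.
  assert (c : contS psi) by apply hl.
  rewrite surf_minus, (surf_rot G psi); trivial; [ring|now apply (contS_rot G)].
Qed.

Lemma sc_axrot3 (t : R) (X : S2) :
  sc ax1 (rot (axrot ax3 t) X) = cos t * sc ax1 X - sin t * sc ax2 X /\
  sc ax2 (rot (axrot ax3 t) X) = sin t * sc ax1 X + cos t * sc ax2 X /\
  sc ax3 (rot (axrot ax3 t) X) = sc ax3 X.
Proof. rewrite !sc_rot; simpl; unfold px, py, pz; simpl; repeat split; ring. Qed.

(** A rotation about the polar axis preserves the polar component of the first moment and
    turns the horizontal ones, which are zero; so [psi o R - psi] is orthogonal to the
    harmonics of degree at most one. *)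
Lemma invariant_of_gap (F : R -> R) (omega : R) (psi : S2 -> R) :
  (forall s, ex_derive F s) -> (forall s, Derive F s > -6) ->
  laplacian psi (fun X => F (psi X) - 2 * omega * sc ax3 X) ->
  surf (fun X => sc ax1 X * psi X) = 0 -> surf (fun X => sc ax2 X * psi X) = 0 ->
  forall t X, psi (rot (axrot ax3 t) X) = psi X.
Proof.
intros dF hF hl m1 m2 t.
assert (c : contS psi) by apply hl.
assert (cr := contS_rot (axrot ax3 t) psi c).
assert (cs := contS_sc).
apply (rigidity 2 F (fun X => 2 * omega * sc ax3 X) (fun Y => psi (rot (axrot ax3 t) Y)) psi); trivial.
- intros s; simpl INR; generalize (hF s); lra.
- generalize (laplacian_rot (axrot ax3 t) _ _ hl).
  replace (fun X => F (psi (rot (axrot ax3 t) X)) - 2 * omega * sc ax3 (rot (axrot ax3 t) X))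
    with (fun X => F (psi (rot (axrot ax3 t) X)) - 2 * omega * sc ax3 X); [trivial|].
  apply functional_extensionality; intros X; destruct (sc_axrot3 t X) as [_ [_ e]]; now rewrite e.
- apply Kop_below_2; [contS_tac| |].
  + rewrite surf_minus, (surf_rot (axrot ax3 t) psi) by assumption; ring.
  + intros i.
    rewrite (surf_ext _ (fun Y => sc i Y * psi (rot (axrot ax3 t) Y) - sc i Y * psi Y)) by (intros; ring).
    rewrite surf_minus, surf_axrot_adjoint; contS_tac.
    destruct i.
    * rewrite (surf_ext _ (fun X => cos (- t) * (sc ax1 X * psi X) - sin (- t) * (sc ax2 X * psi X))).
      -- rewrite surf_minus, !surf_scal, m1, m2; contS_tac; ring.
      -- intros X; destruct (sc_axrot3 (- t) X) as [-> _]; ring.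
    * rewrite (surf_ext _ (fun X => sin (- t) * (sc ax1 X * psi X) + cos (- t) * (sc ax2 X * psi X))).
      -- rewrite surf_plus, !surf_scal, m1, m2; contS_tac; ring.
      -- intros X; destruct (sc_axrot3 (- t) X) as [_ [-> _]]; ring.
    * rewrite (surf_ext _ (fun X => sc ax3 X * psi X)); [ring|].
      intros X; destruct (sc_axrot3 (- t) X) as [_ [_ ->]]; ring.
Qed.

(** The first moment of [psi] is a vector that rotates with [psi]; it can be turned onto
    the polar axis. *)
Lemma align_moment (psi : S2 -> R) : contS psi -> exists G,
  surf (fun X => sc ax1 X * psi (rot G X)) = 0 /\ surf (fun X => sc ax2 X * psi (rot G X)) = 0.
Proof.
intros c.
set (a := fun i => surf (fun X => sc i X * psi X)).
assert (hm : forall G i col, (forall X, sc i (rot (trSO3 G) X) = sum3 (fun j => coord j col * sc j X)) ->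
  surf (fun X => sc i X * psi (rot G X)) = dot col (a ax1, a ax2, a ax3)).
{ intros G i col hcol.
  assert (cr := contS_rot G psi c); assert (cs := contS_sc).
  rewrite <- (surf_rot (trSO3 G) (fun X => sc i X * psi (rot G X))) by contS_tac.
  rewrite (surf_ext _ (fun X => sum3 (fun j => coord j col * (sc j X * psi X)))).
  2:{ intros X; rewrite rot_tr_r, hcol; unfold sum3; ring. }
  rewrite (surf_sum3 (fun j X => coord j col * (sc j X * psi X))) by (intros; contS_tac).
  unfold sum3; rewrite !surf_scal by contS_tac.
  unfold dot, coord, a, px, py, pz; cbn [fst snd]; ring. }
assert (h1 : forall G X, sc ax1 (rot (trSO3 G) X) = sum3 (fun j => coord j (col1 G) * sc j X)).
{ intros G X; rewrite sc_rot; reflexivity. }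
assert (h2 : forall G X, sc ax2 (rot (trSO3 G) X) = sum3 (fun j => coord j (col2 G) * sc j X)).
{ intros G X; rewrite sc_rot; reflexivity. }
set (r2 := a ax1 * a ax1 + a ax2 * a ax2 + a ax3 * a ax3).
destruct (Req_dec r2 0) as [e|e].
- exists idSO3; destruct (sum_sq3_0 _ _ _ e) as [e1 [e2 e3]].
  split; [rewrite (hm _ _ _ (h1 idSO3))|rewrite (hm _ _ _ (h2 idSO3))];
  rewrite e1, e2, e3; unfold dot, px, py, pz; simpl; ring.
- assert (pr : 0 < r2) by (unfold r2 in *; nra).
  assert (ps := sqrt_lt_R0 _ pr); assert (ss := sqrt_sqrt r2 (Rlt_le _ _ pr)).
  set (s := sqrt r2) in *.
  assert (hX : dot (a ax1 / s, a ax2 / s, a ax3 / s) (a ax1 / s, a ax2 / s, a ax3 / s) = 1).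
  { unfold dot, px, py, pz; simpl; transitivity (r2 / (s * s)); [unfold r2; field; lra|].
    rewrite ss; field; lra. }
  destruct (pole_moves (exist _ _ hX)) as [G hG]; simpl in hG; exists G.
  assert (d : forall col, dot col (a ax1, a ax2, a ax3) = s * dot col (col3 G)).
  { intros col; rewrite hG; unfold dot, px, py, pz; simpl; field; lra. }
  split; [rewrite (hm _ _ _ (h1 G)), d, col13|rewrite (hm _ _ _ (h2 G)), d, col23]; ring.
Qed.

(** * The first moment of a solution on the rotating sphere *)

(** For an antiderivative [Phi] of [F], the integral of [Phi(psi)] does not change when [psi]
    is rotated; by this expansion, [F(psi)] is then orthogonal to the variation of [psi] up
    to an error of second order. *)
Lemma antiderivative_taylor (F : R -> R) (psi : S2 -> R) : cont_differentiable F -> contS psi ->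
  exists Phi M, (forall s, continuous Phi s) /\ 0 <= M /\ forall X Y,
    Rabs (Phi (psi Y) - Phi (psi X) - F (psi X) * (psi Y - psi X))
     <= M * ((psi Y - psi X) * (psi Y - psi X)).
Proof.
intros dF c; destruct (contS_bounded psi c) as [B [pB hB]].
assert (cF : forall s, continuous F s).
{ intros s; apply (ex_derive_continuous (V := R_NormedModule)), dF. }
set (Phi := fun s => RInt F 0 s).
assert (dPhi : forall s, is_derive Phi s (F s)).
{ intros s; apply (is_derive_RInt F Phi 0 s); [|apply cF].
  apply filter_forall; intros t; apply (RInt_correct (V := R_CompleteNormedModule)).
  apply (ex_RInt_continuous (V := R_CompleteNormedModule)); intros; apply cF. }
destruct (continuity_ab_maj (fun s => Rabs (Derive F s)) (- B) B) as [m [hm _]]; [lra| |].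
{ intros s _; apply (continuity_pt_comp (Derive F) Rabs).
  - apply continuity_pt_filterlim, dF.
  - apply Rcontinuity_abs. }
exists Phi, (Rabs (Derive F m)); split; [|split; [apply Rabs_pos|]].
- intros s; apply (ex_derive_continuous (V := R_NormedModule)); exists (F s); apply dPhi.
- intros X Y; set (x := psi X); set (y := psi Y).
  assert (bx := hB X); assert (bY := hB Y); fold x in bx; fold y in bY.
  apply Rabs_le_between in bx; apply Rabs_le_between in bY.
  destruct (MVT_gen Phi x y F) as [u [hu e1]].
  { intros; apply dPhi. }
  { intros; apply continuity_pt_filterlim, (ex_derive_continuous (V := R_NormedModule)).
    exists (F x0); apply dPhi. }
  destruct (MVT_gen F x u (Derive F)) as [v [hv e2]].
  { intros; apply Derive_correct, dF. }
  { intros; apply continuity_pt_filterlim, cF. }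
  rewrite e1; replace (F u * (y - x) - F x * (y - x)) with ((F u - F x) * (y - x)) by ring.
  rewrite e2, !Rabs_mult.
  assert (hux : Rabs (u - x) <= Rabs (y - x)).
  { revert hu; unfold Rmin, Rmax; destruct (Rle_dec x y); intros hu;
    unfold Rabs; destruct (Rcase_abs (u - x)), (Rcase_abs (y - x)); lra. }
  assert (hvB : - B <= v <= B).
  { revert hu hv; unfold Rmin, Rmax; destruct (Rle_dec x y), (Rle_dec x u); lra. }
  replace ((y - x) * (y - x)) with (Rabs (y - x) * Rabs (y - x))
    by (generalize (Rsqr_abs (y - x)); unfold Rsqr; lra).
  rewrite Rmult_assoc; apply Rmult_le_compat; auto using Rabs_pos.
  + apply Rmult_le_pos; apply Rabs_pos.
  + apply Rmult_le_compat_r; [apply Rabs_pos|exact hux].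
Qed.

(** [|psi o R - psi|^2] integrates to minus the integral of [psi] against its second
    difference, and is therefore of second order in the angle. *)
Lemma rotation_increment (psi L : S2 -> R) : laplacian psi L ->
  exists C d, 0 < d /\ 0 < C /\ forall k t, 0 < t < d ->
    surf (fun X => (psi (rot (axrot k t) X) - psi X) * (psi (rot (axrot k t) X) - psi X)) <= C * (t * t) /\
    surf (fun X => (psi (rot (axrot k (- t)) X) - psi X) * (psi (rot (axrot k (- t)) X) - psi X)) <= C * (t * t).
Proof.
intros hl; assert (hpi := PI_RGT_0).
assert (c : contS psi) by apply hl; assert (cL : contS L) by apply hl.
destruct (contS_bounded psi c) as [M [pM hM]]; destruct (contS_bounded L cL) as [M' [pM' hM']].
destruct (laplacian_id psi L 1 hl Rlt_0_1) as [d [pd hd]].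
exists (2 * PI * PI * (M * (1 + M'))), d; split; [assumption|split].
{ apply Rmult_lt_0_compat; nra. }
intros k t ht.
assert (cr : forall i s, contS (fun X => psi (rot (axrot i s) X))).
{ intros; now apply (contS_rot _ psi). }
set (Q := fun i s => surf (fun X => (psi (rot (axrot i s) X) - psi X) * (psi (rot (axrot i s) X) - psi X))).
assert (hQ : forall i s, Q i s = - surf (fun X => psi X * second_diff s psi i X)).
{ intros i s; unfold Q; rewrite surf_second_diff by assumption.
  rewrite (surf_ext _ (fun X => psi (rot (axrot i s) X) * psi (rot (axrot i s) X) + psi X * psi X
    - 2 * (psi (rot (axrot i s) X) * psi X))) by (intros; ring).
  rewrite surf_minus, surf_plus, surf_scal; contS_tac.
  rewrite (surf_rot (axrot i s) (fun X => psi X * psi X)) by contS_tac.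
  rewrite (surf_ext (fun X => psi X * psi (rot (axrot i s) X)) (fun X => psi (rot (axrot i s) X) * psi X))
    by (intros; ring).
  ring. }
assert (pos : forall i s, 0 <= Q i s).
{ intros i s; unfold Q; replace 0 with (surf (fun _ => 0)) by (rewrite surf_const; ring).
  apply surf_le; contS_tac; intros X; apply Rle_0_sqr. }
assert (sgn : forall i s, Q i (- s) = Q i s).
{ intros i s; rewrite !hQ; f_equal; apply surf_ext; intros X; unfold second_diff.
  rewrite Ropp_involutive; ring. }
assert (csd : forall i s, contS (fun X => psi X * second_diff s psi i X)).
{ intros; unfold second_diff; contS_tac. }
assert (tot : Q ax1 t + Q ax2 t + Q ax3 t <= 2 * PI * PI * (M * (1 + M')) * (t * t)).
{ assert (e : Q ax1 t + Q ax2 t + Q ax3 t = - surf (fun X => psi X * rot_diff t psi X)).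
  { rewrite (surf_ext _ (fun X => sum3 (fun i => psi X * second_diff t psi i X)))
      by (intros; unfold rot_diff, sum3; ring).
    rewrite (surf_sum3 (fun i X => psi X * second_diff t psi i X)) by auto.
    unfold sum3; rewrite !hQ; ring. }
  rewrite e.
  assert (b : Rabs (surf (fun X => psi X * rot_diff t psi X)) <= 2 * PI * PI * (M * ((1 + M') * (t * t)))).
  { assert (crd := contS_rot_diff t psi c).
    apply surf_bound; [contS_tac|]; intros X; rewrite Rabs_mult.
    apply Rmult_le_compat; auto using Rabs_pos.
    replace (rot_diff t psi X) with ((rot_diff t psi X - t * t * L X) + t * t * L X) by ring.
    eapply Rle_trans; [apply Rabs_triang|].
    rewrite (Rabs_mult (t * t)), (Rabs_right (t * t)) by nra.
    generalize (hd t X ht) (hM' X); assert (0 <= t * t) by nra; nra. }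
  apply Rabs_le_between in b; lra. }
generalize (pos ax1 t) (pos ax2 t) (pos ax3 t) (sgn k t); unfold Q at 4 5; intros p1 p2 p3 ->.
assert (Q k t <= 2 * PI * PI * (M * (1 + M')) * (t * t)) by (destruct k; lra).
split; assumption.
Qed.

(** Rotating about an axis [k] of the equatorial plane moves [sin theta] towards the
    coordinate [i] orthogonal to [k].  Testing the equation with [psi o R - psi o R^-1],
    the Laplacian term vanishes by symmetry, the nonlinear term is of second order in
    the angle [t], and the rotation term equals [sin t] times the moment of [psi], up to
    a nonzero factor. *)
Lemma moment_vanishes (F : R -> R) (omega : R) (psi : S2 -> R) (k i : axis) (sigma : R) :
  cont_differentiable F -> omega <> 0 -> sigma <> 0 ->
  laplacian psi (fun X => F (psi X) - 2 * omega * sc ax3 X) ->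
  (forall t X, sc ax3 (rot (axrot k t) X) = cos t * sc ax3 X + sigma * sin t * sc i X) ->
  surf (fun X => sc i X * psi X) = 0.
Proof.
intros dF hom hsg hl hk.
assert (c : contS psi) by apply hl.
assert (cF : contS (fun X => F (psi X))).
{ apply (contS_comp F); [|assumption]; intros s; apply (ex_derive_continuous (V := R_NormedModule)), dF. }
destruct (antiderivative_taylor F psi dF c) as [Phi [M [cPhi [pM hM]]]].
assert (cP : contS (fun X => Phi (psi X))) by now apply contS_comp.
destruct (rotation_increment psi _ hl) as [C [d [pd [pC hC]]]].
assert (cr : forall s, contS (fun X => psi (rot (axrot k s) X))).
{ intros; now apply (contS_rot _ psi). }
assert (crs : forall s, contS (fun X => sc ax3 (rot (axrot k s) X))).
{ intros; apply (contS_rot _ (sc ax3)), contS_sc. }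
assert (cs := contS_sc).
set (m := surf (fun X => sc i X * psi X)).
set (D := fun s => surf (fun X => F (psi X) * (psi (rot (axrot k s) X) - psi X))).
assert (hD : forall s, Rabs (D s) <= M * surf (fun X =>
   (psi (rot (axrot k s) X) - psi X) * (psi (rot (axrot k s) X) - psi X))).
{ intros s; assert (cPr := contS_rot (axrot k s) _ cP); cbv beta in cPr.
  assert (e : - D s = surf (fun X => Phi (psi (rot (axrot k s) X)) - Phi (psi X)
     - F (psi X) * (psi (rot (axrot k s) X) - psi X))).
  { rewrite !surf_minus; contS_tac.
    rewrite (surf_rot (axrot k s) (fun X => Phi (psi X))) by assumption; unfold D; ring. }
  rewrite <- Rabs_Ropp, e, <- surf_scal by contS_tac.
  assert (b : forall X, Rabs (Phi (psi (rot (axrot k s) X)) - Phi (psi X)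
     - F (psi X) * (psi (rot (axrot k s) X) - psi X)) <= M *
     ((psi (rot (axrot k s) X) - psi X) * (psi (rot (axrot k s) X) - psi X))) by (intros; apply hM).
  apply Rabs_le; split.
  - match goal with |- - surf ?h <= _ => replace (- surf h) with (surf (fun X => (-1) * h X)) end.
    2:{ rewrite surf_scal by contS_tac; ring. }
    apply surf_le; contS_tac; intros X; generalize (b X); intros h; apply Rabs_le_between in h; lra.
  - apply surf_le; contS_tac; intros X; generalize (b X); intros h; apply Rabs_le_between in h; lra. }
(* the Laplacian drops out of the equation tested with psi o R - psi o R^-1 *)
assert (hE : forall t, D t - D (- t) = - (4 * omega * sigma * sin t * m)).
{ intros t.
  set (L := fun X => F (psi X) - 2 * omega * sc ax3 X) in *.
  assert (cL : contS L) by (unfold L; contS_tac).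
  assert (g : surf (fun X => L X * psi (rot (axrot k t) X)) = surf (fun X => L X * psi (rot (axrot k (- t)) X))).
  { generalize (green _ _ _ _ hl (laplacian_rot (axrot k t) _ _ hl)).
    rewrite surf_axrot_adjoint by assumption.
    intros e; rewrite (surf_ext (fun X => L X * psi (rot (axrot k t) X))
      (fun X => psi (rot (axrot k t) X) * L X)) by (intros; ring).
    rewrite <- e; apply surf_ext; intros; ring. }
  assert (hz : forall s, surf (fun X => sc ax3 X * psi (rot (axrot k s) X))
     = cos s * surf (fun X => sc ax3 X * psi X) - sigma * sin s * m).
  { intros s; rewrite surf_axrot_adjoint by contS_tac.
    rewrite (surf_ext _ (fun X => cos s * (sc ax3 X * psi X) - (sigma * sin s) * (sc i X * psi X))).
    - rewrite surf_minus, !surf_scal; contS_tac; reflexivity.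
    - intros X; rewrite hk, cos_neg, sin_neg; ring. }
  assert (hs : forall s, D s = surf (fun X => L X * psi (rot (axrot k s) X))
     + 2 * omega * (cos s * surf (fun X => sc ax3 X * psi X) - sigma * sin s * m)
     - surf (fun X => F (psi X) * psi X)).
  { intros s; rewrite <- hz, <- surf_scal, <- surf_plus, <- surf_minus; contS_tac.
    unfold D; apply surf_ext; intros X; unfold L; ring. }
  rewrite !hs, g, cos_neg, sin_neg; ring. }
destruct (proj1 (is_derive_eps sin 0 1)) with (eps := / 2) as [d' [pd' hd']]; [|lra|].
{ rewrite <- cos_0; apply is_derive_sin. }
assert (small : forall t, 0 < t < Rmin d d' -> Rabs (omega * sigma * m) <= M * C * t).
{ intros t ht.
  assert (t1 : 0 < t < d) by (generalize (Rmin_l d d'); lra).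
  assert (t2 : 0 < t < d') by (generalize (Rmin_r d d'); lra).
  assert (hsin : t / 2 <= sin t).
  { generalize (hd' t); rewrite sin_0, !Rminus_0_r, (Rabs_right t) by lra.
    intros h; specialize (h (proj2 t2)); apply Rabs_le_between in h; lra. }
  destruct (hC k t t1) as [q1 q2].
  assert (b : Rabs (D t - D (- t)) <= 2 * (M * (C * (t * t)))).
  { eapply Rle_trans; [apply Rabs_triang|]; rewrite Rabs_Ropp.
    generalize (hD t) (hD (- t)) (Rmult_le_compat_l M _ _ pM q1) (Rmult_le_compat_l M _ _ pM q2); lra. }
  rewrite hE, Rabs_Ropp in b.
  replace (4 * omega * sigma * sin t * m) with ((4 * sin t) * (omega * sigma * m)) in b by ring.
  rewrite Rabs_mult, (Rabs_right (4 * sin t)) in b by lra.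
  assert (hp := Rabs_pos (omega * sigma * m)).
  apply Rmult_le_reg_l with (2 * t); [lra|].
  apply Rle_trans with (4 * sin t * Rabs (omega * sigma * m)); [|lra].
  apply Rmult_le_compat_r; lra. }
assert (hz : omega * sigma * m = 0).
{ apply Rabs_small_0; intros eps he.
  assert (pt0 : 0 < Rmin d d') by now apply Rmin_pos.
  assert (pMC : 0 <= M * C) by nra.
  assert (pe : 0 < eps / (M * C + 1)) by (apply Rdiv_lt_0_compat; lra).
  set (t := Rmin (Rmin d d' / 2) (eps / (M * C + 1))).
  assert (l1 : t <= Rmin d d' / 2) by apply Rmin_l.
  assert (l2 : t <= eps / (M * C + 1)) by apply Rmin_r.
  assert (pt : 0 < t) by (apply Rmin_pos; lra).
  eapply Rle_trans; [apply (small t); lra|].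
  apply Rle_trans with (M * C * (eps / (M * C + 1))); [now apply Rmult_le_compat_l|].
  replace eps with ((M * C + 1) * (eps / (M * C + 1))) at 2 by (field; lra).
  apply Rmult_le_compat_r; lra. }
apply Rmult_integral in hz; destruct hz as [hz|hz]; [|exact hz].
apply Rmult_integral in hz; destruct hz; contradiction.
Qed.

Lemma moments_vanish (F : R -> R) (omega : R) (psi : S2 -> R) :
  cont_differentiable F -> classical_solution F omega psi -> omega <> 0 ->
  surf (fun X => sc ax1 X * psi X) = 0 /\ surf (fun X => sc ax2 X * psi X) = 0.
Proof.
intros dF hs hom; assert (hl := solution_laplacian _ _ _ hs); split.
- apply (moment_vanishes F omega psi ax2 ax1 (-1)); [exact dF|exact hom|lra|exact hl|].
  intros t X; rewrite sc_rot; simpl; unfold px, py, pz; simpl; ring.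
- apply (moment_vanishes F omega psi ax1 ax2 1); [exact dF|exact hom|lra|exact hl|].
  intros t X; rewrite sc_rot; simpl; unfold px, py, pz; simpl; ring.
Qed.

(** * The first eigenspace *)

Definition unit_vec (i : axis) : vec :=
  match i with ax1 => (1, 0, 0) | ax2 => (0, 1, 0) | ax3 => (0, 0, 1) end.

Lemma surf_sc (i : axis) : surf (sc i) = 0.
Proof.
generalize (green _ _ _ _ (laplacian_const 1) (laplacian_sc i)).
rewrite (surf_ext (fun X => 1 * _) (fun X => -2 * sc i X)) by (intros; ring).
rewrite (surf_ext (fun X => sc i X * 0) (fun _ => 0)) by (intros; ring).
rewrite surf_scal, surf_const by apply contS_sc; lra.
Qed.

Lemma surf_sc_sc (i j : axis) : surf (fun X => sc i X * sc j X)
  = match i, j with ax1, ax1 | ax2, ax2 | ax3, ax3 => 4 * PI / 3 | _, _ => 0 end.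
Proof.
assert (cs := contS_sc).
assert (diag : forall a, surf (fun X => sc a X * sc a X) = 4 * PI / 3).
{ intros a.
  assert (hu : dot (unit_vec a) (unit_vec a) = 1).
  { destruct a; unfold dot, px, py, pz; simpl; ring. }
  generalize (surf_ker 2 (exist _ _ hu)).
  rewrite (surf_ext _ (fun Y => / 4 * (1 + (2 * sc a Y + sc a Y * sc a Y)))).
  2:{ intros Y; rewrite affinity_sc.
      change (sc ax1 (exist _ _ hu)) with (coord ax1 (unit_vec a)).
      change (sc ax2 (exist _ _ hu)) with (coord ax2 (unit_vec a)).
      change (sc ax3 (exist _ _ hu)) with (coord ax3 (unit_vec a)).
      destruct a; unfold unit_vec, coord, px, py, pz; cbn [fst snd]; field. }
  rewrite surf_scal, !surf_plus, surf_scal, surf_const, surf_sc; contS_tac.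
  simpl INR; lra. }
(* the half turn about the axis i preserves x_i and reverses the other coordinates *)
assert (off : forall a b, a <> b -> surf (fun X => sc a X * sc b X) = 0).
{ intros a b hab.
  assert (e : surf (fun X => sc a X * sc b X) = - surf (fun X => sc a X * sc b X)).
  { rewrite <- (surf_rot (axrot a PI) (fun X => sc a X * sc b X)) at 1 by contS_tac.
    rewrite (surf_ext _ (fun X => (-1) * (sc a X * sc b X))).
    - rewrite surf_scal by contS_tac; ring.
    - intros X; rewrite !sc_rot; destruct a, b; try contradiction; simpl; unfold px, py, pz; simpl;
      rewrite ?cos_PI, ?sin_PI; ring. }
  lra. }
destruct i, j; try apply diag; apply off; discriminate.
Qed.

(** Subtracting its moments from a function of [E_1] leaves an eigenfunction of the
    eigenvalue [-2] without components of degree zero and one; the gap at [-6] kills it. *)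
Lemma eigenspace_1_linear (Y : S2 -> R) : eigenspace 1 Y ->
  exists b : axis -> R, forall X, Y X = sum3 (fun i => b i * sc i X).
Proof.
intros hY; assert (hpi := PI_RGT_0).
assert (l : laplacian Y (fun X => -2 * Y X)).
{ generalize (eigenspace_laplacian 1 Y hY); simpl INR.
  now replace (- (1 * (1 + 1))) with (-2) by ring. }
assert (c : contS Y) by apply l; assert (cs := contS_sc).
set (b := fun i => 3 / (4 * PI) * surf (fun X => sc i X * Y X)); exists b.
set (T := fun X => sum3 (fun i => b i * sc i X)).
assert (cT : contS T) by (unfold T; contS_tac).
assert (hT : laplacian T (fun X => -2 * T X)).
{ generalize (laplacian_plus _ _ _ _ (laplacian_plus _ _ _ _ (laplacian_scal (b ax1) _ _ (laplacian_sc ax1))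
   (laplacian_scal (b ax2) _ _ (laplacian_sc ax2))) (laplacian_scal (b ax3) _ _ (laplacian_sc ax3))).
  replace (fun X => -2 * T X) with (fun X => b ax1 * (-2 * sc ax1 X) + b ax2 * (-2 * sc ax2 X)
    + b ax3 * (-2 * sc ax3 X)); [trivial|].
  apply functional_extensionality; intros; unfold T, sum3; ring. }
assert (hw := laplacian_minus _ _ _ _ l hT).
assert (mY : surf Y = 0).
{ generalize (green _ _ _ _ (laplacian_const 1) l).
  rewrite (surf_ext (fun X => 1 * _) (fun X => -2 * Y X)) by (intros; ring).
  rewrite (surf_ext (fun X => Y X * 0) (fun _ => 0)) by (intros; ring).
  rewrite surf_scal, surf_const by assumption; lra. }
assert (mT : surf T = 0).
{ unfold T; rewrite (surf_sum3 (fun i X => b i * sc i X)) by (intros; contS_tac).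
  unfold sum3; rewrite !surf_scal, !surf_sc by apply contS_sc; ring. }
assert (mi : forall i, surf (fun X => sc i X * T X) = surf (fun X => sc i X * Y X)).
{ intros i; rewrite (surf_ext _ (fun X => sum3 (fun j => b j * (sc i X * sc j X))))
    by (intros; unfold T, sum3; ring).
  rewrite (surf_sum3 (fun j X => b j * (sc i X * sc j X))) by (intros; contS_tac).
  unfold sum3; rewrite !surf_scal, !surf_sc_sc by contS_tac.
  unfold b; destruct i; field; lra. }
assert (gap := spectral_gap 2 _ _ hw).
set (w := fun X => Y X - T X) in *.
assert (cw : contS w) by (unfold w; contS_tac).
assert (hz : forall X, w X * w X = 0).
{ apply surf_eq_0; [contS_tac|intros; apply Rle_0_sqr|].
  assert (g : INR 2 * (INR 2 + 1) * surf (fun X => w X * w X) <= - surf (fun X => w X * (-2 * Y X - -2 * T X))).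
  { apply gap, Kop_below_2; [assumption| |].
    - unfold w; rewrite surf_minus by assumption; lra.
    - intros i; unfold w.
      rewrite (surf_ext _ (fun X => sc i X * Y X - sc i X * T X)) by (intros; ring).
      rewrite surf_minus, mi; contS_tac; ring. }
  rewrite (surf_ext (fun X => w X * (-2 * Y X - -2 * T X)) (fun X => -2 * (w X * w X))) in g
    by (intros; unfold w; ring).
  rewrite surf_scal in g by contS_tac; simpl INR in g; lra. }
intros X; assert (w X = 0) by (apply Rsqr_0_uniq, hz).
unfold w in *; change (Y X = T X); lra.
Qed.

Lemma projection_of_moments (psi : S2 -> R) : contS psi ->
  surf (fun X => sc ax1 X * psi X) = 0 -> surf (fun X => sc ax2 X * psi X) = 0 ->
  exists alpha, is_projection 1 psi (fun X => alpha * sin_lat X).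
Proof.
intros c m1 m2; assert (hpi := PI_RGT_0); assert (cs := contS_sc).
set (alpha := 3 / (4 * PI) * surf (fun X => sc ax3 X * psi X)); exists alpha.
split; [apply sin_lat_eigenspace|].
intros Y hY; destruct (eigenspace_1_linear Y hY) as [b hb]; rewrite inner_surf.
rewrite (surf_ext _ (fun X => sum3 (fun i => b i * (sc i X * psi X - alpha * (sc ax3 X * sc i X))))).
2:{ intros X; rewrite hb; change (sin_lat X) with (sc ax3 X); unfold sum3; ring. }
rewrite (surf_sum3 (fun i X => b i * (sc i X * psi X - alpha * (sc ax3 X * sc i X))))
  by (intros; contS_tac).
unfold sum3; rewrite !surf_scal, !surf_minus, !surf_scal, !surf_sc_sc, m1, m2; contS_tac.
unfold alpha; field; lra.
Qed.

(** * Zonal quadratic polynomials *)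

Lemma sph_values (psi : S2 -> R) (f : R -> R) (h : vec -> R) :
  (forall X, psi X = h (proj1_sig X)) ->
  (forall phi theta, is_latitude theta -> psi (sph phi theta) = f theta) ->
  (forall phi phi' theta, is_latitude theta ->
     h (cos phi * cos theta, sin phi * cos theta, sin theta)
     = h (cos phi' * cos theta, sin phi' * cos theta, sin theta)).
Proof.
intros e hf phi phi' theta ht.
transitivity (psi (sph phi theta)); [symmetry; apply e|].
transitivity (psi (sph phi' theta)); [now rewrite !hf|apply e].
Qed.

(** It is enough to compare values at opposite and at perpendicular longitudes, on the
    equator and at latitude [PI / 4]. *)
Lemma zonal_quadratic (l : axis -> R) (a b c d e g : R) :
  zonal (fun X => lin l (proj1_sig X) + qform a b c d e g (proj1_sig X)) ->
  l ax1 = 0 /\ l ax2 = 0 /\ a = b /\ d = 0 /\ e = 0 /\ g = 0.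
Proof.
intros [f hf]; assert (hpi := PI_RGT_0).
assert (v := sph_values _ f (fun X => lin l X + qform a b c d e g X) (fun X => eq_refl) hf).
unfold lin, qform, sum3, coord, px, py, pz in v; cbn [fst snd] in v.
assert (l0 : is_latitude 0) by (unfold is_latitude; lra).
assert (l4 : is_latitude (PI / 4)) by (unfold is_latitude; lra).
assert (r2 := sqrt_lt_R0 2 Rlt_0_2); assert (q2 := sqrt_sqrt 2 (Rlt_le _ _ Rlt_0_2)).
set (s := / sqrt 2).
assert (ps : 0 < s) by (apply Rinv_0_lt_compat; lra).
assert (ss : s * s = / 2) by (unfold s; rewrite <- Rinv_mult, q2; reflexivity).
assert (c4 : cos (PI / 4) = s) by (rewrite cos_PI4; unfold s; field; lra).
assert (s4 : sin (PI / 4) = s) by (rewrite sin_PI4; unfold s; field; lra).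
assert (w1 := v 0 PI 0 l0); assert (w2 := v (PI / 2) (- (PI / 2)) 0 l0).
assert (w3 := v 0 (PI / 2) 0 l0); assert (w4 := v (PI / 4) (- (PI / 4)) 0 l0).
assert (w5 := v 0 PI (PI / 4) l4); assert (w6 := v (PI / 2) (- (PI / 2)) (PI / 4) l4).
rewrite ?cos_neg, ?sin_neg, ?cos_0, ?sin_0, ?cos_PI, ?sin_PI, ?cos_PI2, ?sin_PI2, ?c4, ?s4 in *.
assert (z1 : l ax1 = 0) by lra; assert (z2 : l ax2 = 0) by lra.
rewrite z1, z2 in *.
assert (z3 : a = b) by lra.
assert (z4 : d = 0) by nra; assert (z5 : e = 0) by nra; assert (z6 : g = 0) by nra.
repeat split; assumption.
Qed.

Lemma lin_mulv (l : axis -> R) (G : SO3) : exists l' : axis -> R,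
  l' ax1 = lin l (col1 G) /\ l' ax2 = lin l (col2 G) /\ l' ax3 = lin l (col3 G) /\
  forall X, lin l (mulv G X) = lin l' X.
Proof.
exists (fun i => lin l (match i with ax1 => col1 G | ax2 => col2 G | ax3 => col3 G end)).
repeat split; intros X; unfold lin, sum3; rewrite !mulv_sum; ring.
Qed.

Lemma qform_mulv (a b c d e g : R) (G : SO3) : exists a' b' c' d' e' g',
  forall X, qform a b c d e g (mulv G X) = qform a' b' c' d' e' g' X.
Proof.
set (q := qform a b c d e g).
set (B := fun X Y : vec => 2 * a * (px X * px Y) + 2 * b * (py X * py Y) + 2 * c * (pz X * pz Y)
  + d * (px X * py Y + py X * px Y) + e * (px X * pz Y + pz X * px Y) + g * (py X * pz Y + pz X * py Y)).
exists (q (col1 G)), (q (col2 G)), (q (col3 G)), (B (col1 G) (col2 G)), (B (col1 G) (col3 G)),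
 (B (col2 G) (col3 G)).
intros [[x y] z]; unfold q, B, qform, mulv.
destruct (col1 G) as [[a1 a2] a3], (col2 G) as [[b1 b2] b3], (col3 G) as [[c1 c2] c3].
unfold px, py, pz; cbn [fst snd]; ring.
Qed.

(** A symmetric tensor [u v + v u] built from orthonormal [u], [v] has the three distinct
    eigenvalues [1, 0, -1], whereas those of a zonal quadratic form are not distinct. *)
Lemma product_not_zonal : ~ zonal_up_to_rotation (fun X => sc ax1 X * sc ax2 X).
Proof.
intros [G hz].
generalize (SO3_rows G ax1 ax1) (SO3_rows G ax2 ax2) (SO3_rows G ax1 ax2); cbv beta iota.
set (u1 := coord ax1 (col1 G)); set (u2 := coord ax1 (col2 G)); set (u3 := coord ax1 (col3 G)).
set (v1 := coord ax2 (col1 G)); set (v2 := coord ax2 (col2 G)); set (v3 := coord ax2 (col3 G)).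
intros hu hv huv.
destruct (zonal_quadratic (fun _ => 0) (u1 * v1) (u2 * v2) (u3 * v3) (u1 * v2 + u2 * v1)
  (u1 * v3 + u3 * v1) (u2 * v3 + u3 * v2)) as [_ [_ [e1 [e2 [e3 e4]]]]].
{ destruct hz as [f hf]; exists f; intros phi theta ht; rewrite <- (hf phi theta ht), !sc_rot.
  fold u1 u2 u3 v1 v2 v3; unfold lin, qform, sum3, sc, coord; ring. }
assert (det : 8 * ((u1 * v1) * (u2 * v2) * (u3 * v3)) =
  2 * (u1 * v1) * ((u2 * v3 + u3 * v2) * (u2 * v3 + u3 * v2))
  + 2 * (u2 * v2) * ((u1 * v3 + u3 * v1) * (u1 * v3 + u3 * v1))
  + 2 * (u3 * v3) * ((u1 * v2 + u2 * v1) * (u1 * v2 + u2 * v1))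
  - 2 * ((u1 * v2 + u2 * v1) * (u1 * v3 + u3 * v1) * (u2 * v3 + u3 * v2))) by ring.
rewrite e2, e3, e4 in det.
assert (lag : 2 * ((u1 * u1 + u2 * u2 + u3 * u3) * (v1 * v1 + v2 * v2 + v3 * v3))
   + 2 * ((u1 * v1 + u2 * v2 + u3 * v3) * (u1 * v1 + u2 * v2 + u3 * v3))
  = 4 * ((u1 * v1) * (u1 * v1) + (u2 * v2) * (u2 * v2) + (u3 * v3) * (u3 * v3))
   + 2 * ((u1 * v2 + u2 * v1) * (u1 * v2 + u2 * v1) + (u1 * v3 + u3 * v1) * (u1 * v3 + u3 * v1)
          + (u2 * v3 + u3 * v2) * (u2 * v3 + u3 * v2))) by ring.
rewrite e2, e3, e4, huv in lag.
replace (u1 * u1 + u2 * u2 + u3 * u3) with 1 in lag by (symmetry; exact hu).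
replace (v1 * v1 + v2 * v2 + v3 * v3) with 1 in lag by (symmetry; exact hv).
set (x := u1 * v1) in *; set (y := u2 * v2) in *; set (z := u3 * v3) in *.
assert (hzz : z = - 2 * x) by lra.
rewrite <- e1, hzz in det, lag.
assert (x3 : x * x * x = 0) by nra.
assert (x = 0).
{ apply Rmult_integral in x3; destruct x3 as [x3|x3]; [|exact x3].
  apply Rsqr_0_uniq; exact x3. }
rewrite H in lag; lra.
Qed.

(** * Explicit spherical harmonics of degree two *)

(** The factor [sqrt (5 / (4 PI) (2 - m)! / (2 + m)!)] in the definition of [Y_2^m]. *)
Definition norm2 (m : nat) : R :=
  sqrt ((2 * INR 2 + 1) / (4 * PI) * (INR (fact (2 - m)) / INR (fact (2 + m)))).

Lemma norm2_pos (m : nat) : 0 < norm2 m.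
Proof.
apply sqrt_lt_R0; assert (hpi := PI_RGT_0).
apply Rmult_lt_0_compat; apply Rdiv_lt_0_compat; try apply INR_fact_lt_0; simpl INR; lra.
Qed.

Lemma rodrigues_2 (s : R) :
  let P := fun s => (s ^ 2 - 1) ^ 2 / (2 ^ 2 * INR (fact 2)) in
  Derive_n P 2 s = (3 * s ^ 2 - 1) / 2 /\ Derive_n P 3 s = 3 * s /\ Derive_n P 4 s = 3.
Proof.
intros P.
assert (e1 : Derive P = fun s => (s ^ 2 - 1) * s / 2).
{ apply functional_extensionality; intros t; apply is_derive_unique; unfold P; simpl fact; simpl INR.
  auto_derive; trivial; field. }
assert (e2 : Derive_n P 2 = fun s => (3 * s ^ 2 - 1) / 2).
{ change (Derive_n P 2) with (Derive (Derive P)); rewrite e1.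
  apply functional_extensionality; intros t; apply is_derive_unique; auto_derive; trivial; field. }
assert (e3 : Derive_n P 3 = fun s => 3 * s).
{ change (Derive_n P 3) with (Derive (Derive_n P 2)); rewrite e2.
  apply functional_extensionality; intros t; apply is_derive_unique; auto_derive; trivial; field. }
assert (e4 : Derive_n P 4 = fun s => 3).
{ change (Derive_n P 4) with (Derive (Derive_n P 3)); rewrite e3.
  apply functional_extensionality; intros t; apply is_derive_unique; auto_derive; trivial; ring. }
now rewrite e2, e3, e4.
Qed.

(** Real and imaginary parts of the sum of the [c_m Y_2^m], in Cartesian coordinates. *)
Definition comb_re (c : Z -> C) (X : vec) : R :=
  let n0 := norm2 0 in let n1 := norm2 1 in let n2 := norm2 2 in
  n0 * fst (c 0%Z) * (3 * (pz X * pz X) - 1) / 2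
  + 3 * n1 * ((fst (c (-1)%Z) - fst (c 1%Z)) * (px X * pz X) + (snd (c 1%Z) + snd (c (-1)%Z)) * (py X * pz X))
  + 3 * n2 * ((fst (c 2%Z) + fst (c (-2)%Z)) * (px X * px X - py X * py X)
              + 2 * (snd (c (-2)%Z) - snd (c 2%Z)) * (px X * py X)).

Definition comb_im (c : Z -> C) (X : vec) : R :=
  let n0 := norm2 0 in let n1 := norm2 1 in let n2 := norm2 2 in
  n0 * snd (c 0%Z) * (3 * (pz X * pz X) - 1) / 2
  + 3 * n1 * ((snd (c (-1)%Z) - snd (c 1%Z)) * (px X * pz X) - (fst (c 1%Z) + fst (c (-1)%Z)) * (py X * pz X))
  + 3 * n2 * ((snd (c 2%Z) + snd (c (-2)%Z)) * (px X * px X - py X * py X)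
              + 2 * (fst (c 2%Z) - fst (c (-2)%Z)) * (px X * py X)).

Lemma combination_value (c : Z -> C) (phi theta : R) :
  sum_n (fun k : nat => let m := (Z.of_nat k - Z.of_nat 2)%Z in Cmult (c m) (Ylm 2 m phi theta)) (2 * 2)
  = (comb_re c (proj1_sig (sph phi theta)), comb_im c (proj1_sig (sph phi theta))).
Proof.
destruct (rodrigues_2 (sin theta)) as [d2 [d3 d4]].
change (2 * 2)%nat with 4%nat; rewrite !sum_Sn, sum_O.
assert (Y0 : Ylm_nonneg 2 0 phi theta = (norm2 0 * ((3 * sin theta ^ 2 - 1) / 2), 0)).
{ unfold Ylm_nonneg; fold (norm2 0); change (2 + 0)%nat with 2%nat; rewrite d2.
  unfold Cmult, RtoC; cbn [fst snd]; simpl INR; rewrite Rmult_0_l, cos_0, sin_0; simpl pow.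
  apply f_equal2; ring. }
assert (Y1 : Ylm_nonneg 2 1 phi theta =
  (- 3 * norm2 1 * (cos theta * sin theta) * cos phi, - 3 * norm2 1 * (cos theta * sin theta) * sin phi)).
{ unfold Ylm_nonneg; fold (norm2 1); change (2 + 1)%nat with 3%nat; rewrite d3.
  unfold Cmult, RtoC; cbn [fst snd]; simpl INR; rewrite Rmult_1_l; simpl pow.
  apply f_equal2; ring. }
assert (Y2 : Ylm_nonneg 2 2 phi theta =
  (3 * norm2 2 * (cos theta * cos theta) * (cos phi * cos phi - sin phi * sin phi),
   3 * norm2 2 * (cos theta * cos theta) * (2 * sin phi * cos phi))).
{ unfold Ylm_nonneg; fold (norm2 2); change (2 + 2)%nat with 4%nat; rewrite d4.
  unfold Cmult, RtoC; cbn [fst snd]; replace (INR 2) with 2 by (simpl; ring).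
  rewrite cos_2a, sin_2a; simpl pow.
  apply f_equal2; ring. }
unfold Ylm.
change (Z.of_nat 0 - Z.of_nat 2)%Z with (-2)%Z; change (Z.of_nat 1 - Z.of_nat 2)%Z with (-1)%Z;
change (Z.of_nat 2 - Z.of_nat 2)%Z with 0%Z; change (Z.of_nat 3 - Z.of_nat 2)%Z with 1%Z;
change (Z.of_nat 4 - Z.of_nat 2)%Z with 2%Z; cbv zeta.
change (0 <=? -2)%Z with false; change (0 <=? -1)%Z with false; change (0 <=? 0)%Z with true;
change (0 <=? 1)%Z with true; change (0 <=? 2)%Z with true; cbv iota.
change (Z.to_nat (- -2)) with 2%nat; change (Z.to_nat (- -1)) with 1%nat;
change (Z.to_nat 0) with 0%nat; change (Z.to_nat 1) with 1%nat; change (Z.to_nat 2) with 2%nat.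
rewrite Y0, Y1, Y2; unfold comb_re, comb_im, sph, px, py, pz; cbn [proj1_sig fst snd]; cbv zeta.
destruct (c (-2)%Z) as [p1 p2], (c (-1)%Z) as [q1 q2], (c 0%Z) as [r1 r2], (c 1%Z) as [s1 s2],
 (c 2%Z) as [t1 t2].
generalize (norm2 0) (norm2 1) (norm2 2); intros n0 n1 n2.
unfold plus; simpl; unfold Cplus, Cmult, Cconj, RtoC; simpl.
apply f_equal2; field.
Qed.

Lemma combination_parts (c : Z -> C) (Y : S2 -> R) : is_combination 2 c Y <->
  (forall X, Y X = comb_re c (proj1_sig X)) /\ (forall X : S2, comb_im c (proj1_sig X) = 0).
Proof.
split.
- intros h; split; intros X; destruct (sph_surj X) as [phi [theta [_ [ht ->]]]];
  generalize (h phi theta ht); rewrite combination_value; unfold RtoC; intros e; injection e; auto.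
- intros [h1 h2] phi theta _; rewrite combination_value, h1, h2; reflexivity.
Qed.

(** On the sphere [3 z^2 - 1 = 2 z^2 - x^2 - y^2], which makes the form traceless. *)
Lemma comb_re_qform (c : Z -> C) (X : S2) : comb_re c (proj1_sig X) =
  let A := norm2 0 * fst (c 0%Z) / 2 in let B := 3 * norm2 2 * (fst (c 2%Z) + fst (c (-2)%Z)) in
  qform (- A + B) (- A - B) (2 * A)
   (6 * norm2 2 * (snd (c (-2)%Z) - snd (c 2%Z)))
   (3 * norm2 1 * (fst (c (-1)%Z) - fst (c 1%Z)))
   (3 * norm2 1 * (snd (c 1%Z) + snd (c (-1)%Z))) (proj1_sig X).
Proof.
generalize (sc_norm X); unfold sc, coord; cbv zeta; unfold comb_re, qform; cbv zeta; intros h.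
replace 1 with (px (proj1_sig X) * px (proj1_sig X) + py (proj1_sig X) * py (proj1_sig X)
  + pz (proj1_sig X) * pz (proj1_sig X)) at 1.
field.
Qed.

Lemma comb_im_qform (c : Z -> C) (X : S2) : comb_im c (proj1_sig X) =
  let A := norm2 0 * snd (c 0%Z) / 2 in let B := 3 * norm2 2 * (snd (c 2%Z) + snd (c (-2)%Z)) in
  qform (- A + B) (- A - B) (2 * A)
   (6 * norm2 2 * (fst (c 2%Z) - fst (c (-2)%Z)))
   (3 * norm2 1 * (snd (c (-1)%Z) - snd (c 1%Z)))
   (- (3 * norm2 1 * (fst (c 1%Z) + fst (c (-1)%Z)))) (proj1_sig X).
Proof.
generalize (sc_norm X); unfold sc, coord; cbv zeta; unfold comb_im, qform; cbv zeta; intros h.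
replace 1 with (px (proj1_sig X) * px (proj1_sig X) + py (proj1_sig X) * py (proj1_sig X)
  + pz (proj1_sig X) * pz (proj1_sig X)) at 1.
field.
Qed.

Lemma norm2_cancel (k x : R) (m : nat) : k <> 0 -> k * norm2 m * x = 0 -> x = 0.
Proof.
intros hk h; generalize (norm2_pos m); intros hp.
apply Rmult_integral in h; destruct h as [h|h]; [|exact h].
apply Rmult_integral in h; destruct h; [contradiction|lra].
Qed.

(** The real part of the sum is zonal by hypothesis and the imaginary part because it is
    zero; each gives one half of the equations on the coefficients. *)
Lemma zonal_combination (c : Z -> C) (Y : S2 -> R) (m : Z) : is_combination 2 c Y -> zonal Y ->
  (Z.abs m <= 2)%Z -> m <> 0%Z -> c m = RtoC 0.
Proof.
intros hc [f hf] hm hm0; apply combination_parts in hc; destruct hc as [hr hi].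
destruct (zonal_quadratic (fun _ => 0)
 (- (norm2 0 * fst (c 0%Z) / 2) + 3 * norm2 2 * (fst (c 2%Z) + fst (c (-2)%Z)))
 (- (norm2 0 * fst (c 0%Z) / 2) - 3 * norm2 2 * (fst (c 2%Z) + fst (c (-2)%Z)))
 (2 * (norm2 0 * fst (c 0%Z) / 2))
 (6 * norm2 2 * (snd (c (-2)%Z) - snd (c 2%Z)))
 (3 * norm2 1 * (fst (c (-1)%Z) - fst (c 1%Z)))
 (3 * norm2 1 * (snd (c 1%Z) + snd (c (-1)%Z)))) as [_ [_ [e1 [e2 [e3 e4]]]]].
{ exists f; intros phi theta ht; rewrite <- (hf phi theta ht), hr, comb_re_qform.
  unfold lin, sum3; cbv zeta; ring. }
destruct (zonal_quadratic (fun _ => 0)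
 (- (norm2 0 * snd (c 0%Z) / 2) + 3 * norm2 2 * (snd (c 2%Z) + snd (c (-2)%Z)))
 (- (norm2 0 * snd (c 0%Z) / 2) - 3 * norm2 2 * (snd (c 2%Z) + snd (c (-2)%Z)))
 (2 * (norm2 0 * snd (c 0%Z) / 2))
 (6 * norm2 2 * (fst (c 2%Z) - fst (c (-2)%Z)))
 (3 * norm2 1 * (snd (c (-1)%Z) - snd (c 1%Z)))
 (- (3 * norm2 1 * (fst (c 1%Z) + fst (c (-1)%Z))))) as [_ [_ [i1 [i2 [i3 i4]]]]].
{ exists (fun _ => 0); intros phi theta ht.
  transitivity (comb_im c (proj1_sig (sph phi theta))); [|apply hi].
  rewrite comb_im_qform; unfold lin, sum3; cbv zeta; ring. }
assert (e1' : 3 * norm2 2 * (fst (c 2%Z) + fst (c (-2)%Z)) = 0) by lra.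
assert (i1' : 3 * norm2 2 * (snd (c 2%Z) + snd (c (-2)%Z)) = 0) by lra.
assert (i4' : 3 * norm2 1 * (fst (c 1%Z) + fst (c (-1)%Z)) = 0) by lra.
apply norm2_cancel in e1', e2, e3, e4, i1', i2, i3, i4'; try lra.
assert (z : forall w : C, fst w = 0 -> snd w = 0 -> w = RtoC 0).
{ intros [a b]; simpl; intros -> ->; reflexivity. }
assert (hm' : m = 2%Z \/ m = (-2)%Z \/ m = 1%Z \/ m = (-1)%Z) by lia.
destruct hm' as [-> | [-> | [-> | ->]]]; apply z; lra.
Qed.

(** A rotation whose third row is along the polar axis preserves the sine of the latitude up
    to a sign, hence permutes the circles of latitude. *)
Lemma zonal_of_polar_rotation (psi : S2 -> R) (G : SO3) :
  coord ax3 (col1 G) = 0 -> coord ax3 (col2 G) = 0 -> zonal (fun X => psi (rot G X)) -> zonal psi.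
Proof.
intros h1 h2 [f hf].
generalize (SO3_rows G ax3 ax3) (SO3_rows G ax1 ax3) (SO3_rows G ax2 ax3); cbv beta iota.
rewrite h1, h2; set (s := coord ax3 (col3 G)); intros r3 r1 r2.
assert (hs : s * s = 1) by lra.
assert (c1 : coord ax1 (col3 G) = 0) by nra; assert (c2 : coord ax2 (col3 G) = 0) by nra.
exists (fun theta => f (s * theta)); intros phi theta ht.
rewrite <- (rot_tr_r G (sph phi theta)).
destruct (sph_surj (rot (trSO3 G) (sph phi theta))) as [phi' [theta' [_ [ht' e]]]].
assert (hz : sin theta' = s * sin theta).
{ change (sin theta') with (sc ax3 (sph phi' theta')); rewrite <- e, sc_rot.
  change (coord ax3 (col1 (trSO3 G))) with (coord ax1 (col3 G)).
  change (coord ax3 (col2 (trSO3 G))) with (coord ax2 (col3 G)).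
  change (coord ax3 (col3 (trSO3 G))) with s.
  rewrite c1, c2; change (sc ax3 (sph phi theta)) with (sin theta); ring. }
assert (hs' : s = 1 \/ s = -1).
{ assert (k : (s - 1) * (s + 1) = 0) by lra; apply Rmult_integral in k; destruct k; [left|right]; lra. }
assert (et : theta' = s * theta).
{ unfold is_latitude in *; destruct hs' as [k|k]; rewrite k in hz |- *.
  - apply sin_inj; try lra; rewrite hz, !Rmult_1_l; reflexivity.
  - apply sin_inj; try lra; rewrite hz.
    replace (-1 * theta) with (- theta) by ring; rewrite sin_neg; ring. }
rewrite e, <- et; now apply hf.
Qed.

Lemma lin_polar (k : R) (X : vec) :
  lin (fun i => match i with ax3 => k | _ => 0 end) X = k * coord ax3 X.
Proof. unfold lin, sum3; ring. Qed.

Lemma rossby_haurwitz_quadratic (omega beta : R) (c : Z -> C) (Y : S2 -> R) :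
  is_combination 2 c Y -> exists a b g d e h, a + b + g = 0 /\
  (forall X, beta * Y X = qform a b g d e h (proj1_sig X)) /\
  rossby_haurwitz omega beta Y = fun X =>
    lin (fun i => match i with ax3 => - (omega / 2) | _ => 0 end) (proj1_sig X)
    + qform a b g d e h (proj1_sig X).
Proof.
intros hc; apply combination_parts in hc; destruct hc as [hr _].
set (A := norm2 0 * fst (c 0%Z) / 2); set (B := 3 * norm2 2 * (fst (c 2%Z) + fst (c (-2)%Z))).
exists (beta * (- A + B)), (beta * (- A - B)), (beta * (2 * A)),
   (beta * (6 * norm2 2 * (snd (c (-2)%Z) - snd (c 2%Z)))),
   (beta * (3 * norm2 1 * (fst (c (-1)%Z) - fst (c 1%Z)))),
   (beta * (3 * norm2 1 * (snd (c 1%Z) + snd (c (-1)%Z)))).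
assert (e : forall X, beta * Y X = qform (beta * (- A + B)) (beta * (- A - B)) (beta * (2 * A))
   (beta * (6 * norm2 2 * (snd (c (-2)%Z) - snd (c 2%Z))))
   (beta * (3 * norm2 1 * (fst (c (-1)%Z) - fst (c 1%Z))))
   (beta * (3 * norm2 1 * (snd (c 1%Z) + snd (c (-1)%Z)))) (proj1_sig X)).
{ intros X; rewrite hr, comb_re_qform; cbv zeta; fold A B; unfold qform; ring. }
split; [ring|split; [exact e|]].
apply functional_extensionality; intros X; rewrite lin_polar, <- e; reflexivity.
Qed.

Lemma rossby_haurwitz_solution (omega beta : R) (c : Z -> C) (Y : S2 -> R) : is_combination 2 c Y ->
  classical_solution (fun s => -6 * s) omega (rossby_haurwitz omega beta Y).
Proof.
intros hc; destruct (rossby_haurwitz_quadratic omega beta c Y hc) as [a [b [g [d [e [h [htr [_ ->]]]]]]]].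
destruct (quadratic_laplacian (fun i => match i with ax3 => - (omega / 2) | _ => 0 end) a b g d e h htr)
  as [hC hl].
split; [exact hC|]; intros phi theta _; rewrite hl, lin_polar.
change (coord ax3 (proj1_sig (sph phi theta))) with (sin theta); field.
Qed.

Lemma combination_eigenspace (c : Z -> C) (Y : S2 -> R) : is_combination 2 c Y -> eigenspace 2 Y.
Proof.
intros hc; generalize (rossby_haurwitz_solution 0 1 c Y hc).
replace (rossby_haurwitz 0 1 Y) with Y.
- intros [hC hl]; split; [exact hC|]; intros phi theta ht; rewrite hl by assumption; simpl INR; ring.
- apply functional_extensionality; intros X; unfold rossby_haurwitz; field.
Qed.

Lemma rossby_haurwitz_not_zonal (omega beta : R) (c : Z -> C) (Y : S2 -> R) (m : Z) :
  omega <> 0 -> beta <> 0 -> is_combination 2 c Y ->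
  (Z.abs m <= 2)%Z -> m <> 0%Z -> c m <> RtoC 0 ->
  ~ zonal_up_to_rotation (rossby_haurwitz omega beta Y).
Proof.
intros hom hbe hc hm hm0 hcm [G hz]; apply hcm.
destruct (rossby_haurwitz_quadratic omega beta c Y hc) as [a [b [g [d [e [h [_ [_ er]]]]]]]].
set (l := fun i => match i with ax3 => - (omega / 2) | _ => 0 end) in er.
(* the linear part of a zonal polynomial is along the axis, so G preserves the axis *)
destruct (lin_mulv l G) as [l' [l1 [l2 [_ hl']]]].
destruct (qform_mulv a b g d e h G) as [a' [b' [g' [d' [e' [h' hq']]]]]].
destruct (zonal_quadratic l' a' b' g' d' e' h') as [z1 [z2 _]].
{ destruct hz as [f hf]; exists f; intros phi theta ht; rewrite <- (hf phi theta ht), er.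
  rewrite <- hl', <- hq'; reflexivity. }
assert (ho : - (omega / 2) <> 0) by lra.
rewrite l1 in z1; rewrite l2 in z2; unfold l in z1, z2; rewrite lin_polar in z1, z2.
apply Rmult_integral in z1; destruct z1 as [z1|z1]; [contradiction|].
apply Rmult_integral in z2; destruct z2 as [z2|z2]; [contradiction|].
destruct (zonal_of_polar_rotation _ G z1 z2 hz) as [f hf].
apply (zonal_combination c Y m hc); trivial.
exists (fun theta => / beta * (f theta + omega / 2 * sin theta)); intros phi theta ht.
rewrite <- (hf phi theta ht); unfold rossby_haurwitz.
change (sin_lat (sph phi theta)) with (sin theta); field; exact hbe.
Qed.

Theorem theorem4 :
  (* (i) *)
  ((forall (F : R -> R) (omega : R) (psi : S2 -> R),
      cont_differentiable F -> classical_solution F omega psi ->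
      omega = 0 -> (forall s, Derive F s > -2) -> constant_on_sphere psi)
   /\ (exists Y, eigenspace 1 Y /\ ~ constant_on_sphere Y)
   /\ (forall Y, eigenspace 1 Y -> ~ constant_on_sphere Y ->
         classical_solution (fun s => -2 * s) 0 Y))
  /\
  (* (ii) *)
  ((forall (F : R -> R) (omega : R) (psi : S2 -> R),
      cont_differentiable F -> classical_solution F omega psi ->
      omega = 0 -> (forall s, Derive F s > -6) -> zonal_up_to_rotation psi)
   /\ (exists Y, eigenspace 2 Y /\ ~ zonal_up_to_rotation Y)
   /\ (forall Y, eigenspace 2 Y -> ~ zonal Y ->
         classical_solution (fun s => -6 * s) 0 Y))
  /\
  (* (iii) *)
  (forall (F : R -> R) (omega : R) (psi : S2 -> R),
      cont_differentiable F -> classical_solution F omega psi ->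
      omega <> 0 ->
      exists alpha : R, is_projection 1 psi (fun X => alpha * sin_lat X))
  /\
  (* (iv) *)
  ((forall (F : R -> R) (omega : R) (psi : S2 -> R),
      cont_differentiable F -> classical_solution F omega psi ->
      omega <> 0 -> (forall s, Derive F s > -6) -> zonal_up_to_rotation psi)
   /\ (exists (c : Z -> C) (Y : S2 -> R),
         (forall m, (Z.abs m <= 2)%Z -> c m <> RtoC 0) /\ is_combination 2 c Y)
   /\ (forall (omega beta : R) (c : Z -> C) (Y : S2 -> R),
         omega <> 0 -> beta <> 0 ->
         (exists m, (Z.abs m <= 2)%Z /\ c m <> RtoC 0) ->
         is_combination 2 c Y ->
         eigenspace 2 Y
         /\ classical_solution (fun s => -6 * s) omega
              (rossby_haurwitz omega beta Y)
         /\ ((exists m, (Z.abs m <= 2)%Z /\ m <> 0%Z /\ c m <> RtoC 0) ->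
             ~ zonal_up_to_rotation (rossby_haurwitz omega beta Y)))).
Proof.
assert (hom : forall F psi, classical_solution F 0 psi -> laplacian psi (fun X => F (psi X))).
{ intros F psi h; generalize (solution_laplacian _ _ _ h).
  replace (fun X => F (psi X) - 2 * 0 * sc ax3 X) with (fun X => F (psi X)); [trivial|].
  apply functional_extensionality; intros; ring. }
split; [split; [|split]|split; [split; [|split]|split; [|split; [|split]]]].
- intros F omega psi dF hs -> hF; apply (constant_of_gap F); auto; apply dF.
- exists (fun X => 1 * sin_lat X); split; [apply sin_lat_eigenspace|].
  intros [k hk]; generalize (hk (sph 0 0)) (hk pole); unfold sin_lat; rewrite pole_coord.
  simpl; unfold pz; simpl; rewrite sin_0; lra.
- intros Y [hC hl] _; split; [exact hC|]; intros phi theta ht; rewrite hl by assumption.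
  simpl INR; ring.
- intros F omega psi dF hs -> hF; assert (hl := hom F psi hs).
  destruct (align_moment psi) as [G [m1 m2]]; [apply hl|].
  exists G; apply zonal_of_invariant.
  apply (invariant_of_gap F 0 (fun X => psi (rot G X))); trivial; [apply dF|].
  replace (fun X => F (psi (rot G X)) - 2 * 0 * sc ax3 X) with (fun X => F (psi (rot G X))).
  + exact (laplacian_rot G _ _ hl).
  + apply functional_extensionality; intros; ring.
- exists (fun X => sc ax1 X * sc ax2 X); split; [|apply product_not_zonal].
  destruct (quadratic_laplacian (fun _ => 0) 0 0 0 1 0 0) as [hC hl]; [ring|].
  replace (fun X => sc ax1 X * sc ax2 X) with
    (fun X : S2 => lin (fun _ => 0) (proj1_sig X) + qform 0 0 0 1 0 0 (proj1_sig X)).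
  + split; [exact hC|]; intros phi theta _; rewrite hl; unfold lin, sum3; simpl INR; ring.
  + apply functional_extensionality; intros X; unfold lin, sum3, qform, sc, coord; ring.
- intros Y [hC hl] _; split; [exact hC|]; intros phi theta ht; rewrite hl by assumption.
  simpl INR; ring.
- intros F omega psi dF hs ho; destruct (moments_vanish F omega psi dF hs ho) as [m1 m2].
  apply projection_of_moments; trivial; apply (solution_laplacian _ _ _ hs).
- intros F omega psi dF hs ho hF; destruct (moments_vanish F omega psi dF hs ho) as [m1 m2].
  exists idSO3.
  replace (fun X => psi (rot idSO3 X)) with psi
    by (apply functional_extensionality; intros; now rewrite rot_id).
  apply zonal_of_invariant, (invariant_of_gap F omega); trivial; [apply dF|].
  now apply solution_laplacian.
(* Y_2^{-m} is (-1)^m times the conjugate of Y_2^m, so c_{-1} = - c_1 makes the sum real *)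
- set (c := fun m : Z => if (m =? -1)%Z then RtoC (-1) else RtoC 1).
  exists c, (fun X => comb_re c (proj1_sig X)); split.
  + intros m _; unfold c; destruct (m =? -1)%Z; intros e; injection e; lra.
  + apply combination_parts; split; [trivial|].
    intros X; unfold comb_im, c; simpl; field.
- intros omega beta c Y ho hb _ hc; split; [now apply (combination_eigenspace c)|split].
  + now apply (rossby_haurwitz_solution omega beta c).
  + intros [m [hm [hm0 hcm]]]; now apply (rossby_haurwitz_not_zonal omega beta c Y m).
Qed.
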